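(* Assume the standing setup and fix $0\le q\le d/2$. Suppose that: (i) for every non-face $F\subseteq V$ of $\Delta$ with $|F|=d$, the algebra $\overline H_F(\Delta)$ has the strong Lefschetz property in degree $q$; and (ii) for every facet $G$ of $\Delta$, letting $\Delta_G$ be the stellar subdivision of $\Delta$ in the interior of $G$ (with the orientation described below), for every non-face $F$ of $\Delta_G$ of size $d$, $\overline H_F(\Delta_G)$ has the strong Lefschetz property in degree $q$. Then $D_q\neq 0$ and for every subset $F\subseteq V$ of size $d$, $$\mathrm{ord}_{[F]}(D_q)=\begin{cases}1 & \text{if } F \text{ is a facet of }\Delta,\\ 0&\text{otherwise,}\end{cases}$$ in $\mathbb Z/2\mathbb Z$.
   Context: Standing setup. $k$ is a field, $d\ge 2$ is an integer, and $\Delta$ is a simplicial complex of dimension $d-1$ with vertex set $V=\{1,\dots,n\}$. $\Delta$ is a connected $k$-homology manifold: $\Delta$ is connected and, for every nonempty face $G$, the link of $G$ has the same homology over $k$ as a sphere of dimension $d-|G|-1$ (in particular every $(d-2)$-dimensional face lies in exactly two facets). $\Delta$ is oriented: if $\mathrm{char}\,k\neq 2$, an orientation is a choice, for each facet, of an ordering of its vertices up to even permutations, such that for every $(d-2)$-face the two orientations induced on it by the two facets containing it are opposite; a facet ordered $v_1,\dots,v_d$ induces on the face omitting $v_i$ the ordering $v_1,\dots,\widehat{v_i},\dots,v_d$ if $i-1$ is even, and the opposite orientation if $i-1$ is odd. If $\mathrm{char}\,k=2$, every such $\Delta$ is regarded as oriented. For a facet $F=\{j_1<\dots<j_d\}$,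 $\epsilon_F\in\{\pm1\}$ is the sign of the permutation taking $(j_1,\dots,j_d)$ to the chosen ordering ($\epsilon_F=1$ if $\mathrm{char}\,k=2$). Let $K=k(a_{i,j}:1\le i\le d,\ 1\le j\le n)$ with the $a_{i,j}$ independent indeterminates, let $K[\Delta]$ be the Stanley–Reisner ring of $\Delta$ over $K$ in variables $x_1,\dots,x_n$, and for a face $G$ write $x_G=\prod_{j\in G}x_j$. For a subset $F=\{j_1<\dots<j_d\}\subseteq V$ of size $d$, $[F]\in k[a_{i,j}]$ is the determinant of the $d\times d$ matrix whose $(i,m)$ entry is $a_{i,j_m}$; it is an irreducible polynomial, and $\mathrm{ord}_{[F]}:K^\times\to\mathbb Z$ is the valuation given by order of vanishing along $[F]$, which induces $\mathrm{ord}_{[F]}:K^\times/(K^\times)^2\to\mathbb Z/2\mathbb Z$. Set $\theta_i=\sum_{j}a_{i,j}x_j$ and $H(\Delta)=K[\Delta]/(\theta_1,\dots,\theta_d)$, graded with pieces $H^q(\Delta)$. $H^d(\Delta)$ is one-dimensional and $\deg:H^d(\Delta)\to K$ is the $K$-linear isomorphism with $\deg(x_F)=\epsilon_F/[F]$ for every facet $F$; for an element $y$ of $H(\Delta)$ (or of $K[\Delta]$), $\deg(y)$ means $\deg$ of its degree-$d$ component (image). The Gorenstein quotient $\overline H(\Delta)$ is $H(\Delta)$ modulo the ideal of all $y$ with $\deg(yz)=0$ for all $z\in H(\Delta)$; $\deg$ descends to it. Let $\ell$ be the image of $x_1+\dots+x_n$. For $0\le q\le d/2$, the Hodge–Riemann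 form on $\overline H^q(\Delta)$ is $(y,z)\mapsto\deg(\ell^{d-2q}yz)$, and $D_q$ denotes its determinant (the determinant of its Gram matrix in any basis), a well-defined element of $K$ modulo multiplication by nonzero squares; when nonzero it is a class in $K^\times/(K^\times)^2$. Other linear systems of parameters. For degree-one elements $\mu_i=\sum_j\mu_{i,j}x_j$ ($\mu_{i,j}\in K$, $1\le i\le d$), let $\mathrm{ev}_\mu:k[a_{i,j}]\to K$ be the $k$-algebra map $a_{i,j}\mapsto\mu_{i,j}$; $\mu=(\mu_1,\dots,\mu_d)$ is a linear system of parameters (l.s.o.p.) for $K[\Delta]$ if and only if $\mathrm{ev}_\mu([F])\neq 0$ for every facet $F$. For an l.s.o.p. $\mu$, $H_\mu(\Delta)=K[\Delta]/(\mu_1,\dots,\mu_d)$, $H^d_\mu(\Delta)$ is one-dimensional, $\deg_\mu:H^d_\mu(\Delta)\to K$ is the isomorphism with $\deg_\mu(x_F)=\epsilon_F/\mathrm{ev}_\mu([F])$ for every facet $F$, and $\overline H_\mu(\Delta)$ is the Gorenstein quotient of $H_\mu(\Delta)$ by the ideal of $y$ with $\deg_\mu(yz)=0$ for all $z$. For a non-face $F\subseteq V$ of size $d$, let $\theta_1^F=\sum_{j\notin F}a_{1,j}x_j$; then $\theta_F=(\theta_1^F,\theta_2,\dots,\theta_d)$ is an l.s.o.p. and we write $H_F(\Delta)$, $\overline H_F(\Delta)$, $\deg_F$ for $H_{\theta_F}(\Delta)$, $\overline H_{\theta_F}(\Delta)$, $\deg_{\theta_F}$. A graded algebra $A=\bigoplus_{i=0}^dA^i$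 of this kind has the strong Lefschetz property in degree $q$ if there is $y\in A^1$ such that multiplication by $y^{d-2q}$ is an isomorphism $A^q\to A^{d-q}$. Stellar subdivision: for a facet $G$ of $\Delta$, $\Delta_G$ has vertex set $\{1,\dots,n+1\}$, and its facets are the facets of $\Delta$ other than $G$ together with $(G\cup\{n+1\})\smallsetminus\{j\}$ for $j\in G$; it is again a connected $k$-homology manifold of dimension $d-1$, oriented by giving the facets shared with $\Delta$ the same orientation as in $\Delta$ (this extends uniquely to an orientation of $\Delta_G$). The objects above for $\Delta_G$ are defined in the same way with $n+1$ vertices. *)

(* Defs.v *)
From HB Require Import structures.
From mathcomp Require Import all_boot all_order all_algebra.
From mathcomp Require Import fraction.
From mathcomp.multinomials Require Import mpoly.

Set Implicit Arguments.
Unset Strict Implicit.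
Unset Printing Implicit Defensive.

Import Order.TTheory GRing.Theory.
Local Open Scope ring_scope.

(* Vertices {1,...,n} of the paper are modelled by 'I_n = {0,...,n-1};
   a simplicial complex is the set of its faces. *)

Definition simplicial_complex (n : nat) (D : {set {set 'I_n}}) : Prop :=
  [/\ set0 \in D,
      (forall F G : {set 'I_n}, F \in D -> G \subset F -> G \in D) &
      (forall v : 'I_n, [set v] \in D) (* vertex set is all of V *) ].

(* dimension d-1 : the largest faces have d vertices *)
Definition has_dim (n : nat) (D : {set {set 'I_n}}) (d : nat) : Prop :=
  (exists F, F \in D /\ #|F| = d) /\ (forall F, F \in D -> (#|F| <= d)%N).

Definition facet (n : nat) (D : {set {set 'I_n}}) (F : {set 'I_n}) : bool :=
  (F \in D) && [forall H : {set 'I_n}, (H \in D) ==> ~~ (F \proper H)].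

Definition connected_cx (n : nat) (D : {set {set 'I_n}}) : Prop :=
  forall u v : 'I_n, connect (fun x y : 'I_n => [set x; y] \in D) u v.

Definition link (n : nat) (D : {set {set 'I_n}}) (G : {set 'I_n})
  : {set {set 'I_n}} :=
  [set H in D | [disjoint H & G] && ((H :|: G) \in D)].

(* Simplicial boundary matrix over k from the faces of L with s vertices to
   the faces of L with s-1 vertices (rows and columns indexed by all subsets
   of 'I_n, entries zero outside the relevant faces).  The sign of omitting v
   from the increasingly ordered face sigma is (-1)^(position of v). *)
Definition bdmx (k : fieldType) (n : nat) (L : {set {set 'I_n}}) (s : nat)
  : 'M[k]_(#|{set 'I_n}|, #|{set 'I_n}|) :=
  \matrix_(i, j)
    (let sigma : {set 'I_n} := enum_val i in
     let tau : {set 'I_n} := enum_val j in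
     if (sigma \in L) && (tau \in L) && (#|sigma| == s) then
       \sum_(v in sigma | tau == sigma :\ v)
          (-1) ^+ #|[set u in sigma | (u < v)%N]|
     else 0).

(* reduced Betti number  ~beta_{s-1}(L; k)  (s = number of vertices of the
   chains, so s = 0 corresponds to homological degree -1) *)
Definition rbetti (k : fieldType) (n : nat) (L : {set {set 'I_n}}) (s : nat)
  : nat :=
  (#|[set sigma in L | #|sigma| == s]| - \rank (bdmx k L s)
     - \rank (bdmx k L s.+1))%N.

(* k-homology manifold condition: link of every nonempty face G has the
   (reduced) homology over k of a sphere of dimension d-|G|-1 *)
Definition homology_manifold (k : fieldType) (n : nat)
  (D : {set {set 'I_n}}) (d : nat) : Prop :=
  forall G, G \in D -> G != set0 ->
    forall s : nat, rbetti k (link D G) s = (s == d - #|G|)%N.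

Definition inversions (n : nat) (s : seq 'I_n) : nat :=
  (\sum_(i < size s) \sum_(j < size s | (i < j)%N)
     (nth 0%N (map val s) j < nth 0%N (map val s) i)%N)%N.

Definition seq_sign (n : nat) (s : seq 'I_n) : int := (-1) ^+ inversions s.

(* sign (w.r.t. the increasing ordering) of the orientation induced by the
   ordered facet s on the face obtained by omitting v, v = v_i, i = index+1 *)
Definition induced_sign (n : nat) (s : seq 'I_n) (v : 'I_n) : int :=
  (-1) ^+ index v s * seq_sign (rem v s).

Definition orderings (n : nat) (D : {set {set 'I_n}})
  (o : {set 'I_n} -> seq 'I_n) : Prop :=
  forall F, facet D F -> perm_eq (o F) (enum F).

Definition orientation_cond (n : nat) (D : {set {set 'I_n}})
  (o : {set 'I_n} -> seq 'I_n) : Prop :=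
  forall (tau F1 F2 : {set 'I_n}) (v1 v2 : 'I_n),
    facet D F1 -> facet D F2 -> F1 != F2 ->
    v1 \notin tau -> v2 \notin tau -> F1 = v1 |: tau -> F2 = v2 |: tau ->
    induced_sign (o F1) v1 = - induced_sign (o F2) v2.

Definition eps (n : nat) (o : {set 'I_n} -> seq 'I_n) (F : {set 'I_n}) : int :=
  seq_sign (o F).

Definition Kf (k : fieldType) (N : nat) : fieldType := {fraction {mpoly k[N]}}.

Definition avar (k : fieldType) (d n : nat) (i : 'I_d) (j : 'I_n)
  : Kf k (d * n) := FracField.tofrac ('X_(mxvec_index i j) : {mpoly k[d * n]}).

Definition theta (k : fieldType) (d n : nat) (i : 'I_d)
  : {mpoly (Kf k (d * n))[n]} :=
  \sum_(j < n) avar k i j *: 'X_j.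

Definition thetaF (k : fieldType) (d n : nat) (F : {set 'I_n}) (i : 'I_d)
  : {mpoly (Kf k (d * n))[n]} :=
  if val i == 0%N then \sum_(j < n | j \notin F) avar k i j *: 'X_j
  else @theta k d n i.

Definition ell (K : fieldType) (n : nat) : {mpoly K[n]} := \sum_(j < n) 'X_j.

Definition bracket (k : fieldType) (d n : nat) (F : {set 'I_n})
  : {mpoly k[d * n]} :=
  \det (\matrix_(i < d, m < d)
          nth 0 [seq ('X_(mxvec_index i j) : {mpoly k[d * n]}) | j <- enum F] m).

Definition msupport (n : nat) (m : 'X_{1..n}) : {set 'I_n} :=
  [set j | m j != 0%N].

Definition is_homog (K : fieldType) (n : nat) (j : nat) (p : {mpoly K[n]}) : Prop :=
  forall m, p@_m != 0 -> mdeg m = j.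

(* p lies in the ideal I_Delta + (mu_1, ..., mu_d) of K[x_1..x_n]
   (I_Delta is spanned by the monomials whose support is a non-face) *)
Definition inJ (K : fieldType) (n d : nat) (D : {set {set 'I_n}})
  (mu : 'I_d -> {mpoly K[n]}) (p : {mpoly K[n]}) : Prop :=
  exists s : 'I_d -> {mpoly K[n]},
    forall m, (p - \sum_(i < d) s i * mu i)@_m != 0 -> msupport m \notin D.

(* degree-j elements of K[x] whose image in H_mu lies in the Gorenstein
   ideal: y with y z = 0 in H_mu^d for all z (i.e. deg_mu(yz) = 0) *)
Definition inN (K : fieldType) (n d : nat) (D : {set {set 'I_n}})
  (mu : 'I_d -> {mpoly K[n]}) (j : nat) (a : {mpoly K[n]}) : Prop :=
  is_homog j a /\ (forall b, is_homog (d - j) b -> inJ D mu (a * b)).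

Definition SLP (K : fieldType) (n d : nat) (D : {set {set 'I_n}})
  (mu : 'I_d -> {mpoly K[n]}) (q : nat) : Prop :=
  exists y : {mpoly K[n]}, is_homog 1 y /\
    (forall a, is_homog q a -> inN D mu (d - q) (y ^+ (d - 2 * q) * a) ->
               inN D mu q a) /\
    (forall c, is_homog (d - q) c ->
       exists a, is_homog q a /\ inN D mu (d - q) (c - y ^+ (d - 2 * q) * a)).

Definition is_deg (k : fieldType) (d n : nat) (D : {set {set 'I_n}})
  (o : {set 'I_n} -> seq 'I_n) (degf : {mpoly (Kf k (d * n))[n]} -> Kf k (d * n))
  : Prop :=
  [/\ (forall c p r, degf (c *: p + r) = c * degf p + degf r),
      (forall m, mdeg m != d -> degf 'X_[m] = 0),
      (forall p, inJ D (@theta k d n) p -> degf p = 0) &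
      (forall F, facet D F ->
         degf (\prod_(j in F) 'X_j) =
         (eps o F)%:~R / FracField.tofrac (@bracket k d n F))].

Definition Hbar_basis (K : fieldType) (n d : nat) (D : {set {set 'I_n}})
  (mu : 'I_d -> {mpoly K[n]}) (q m : nat) (b : 'I_m -> {mpoly K[n]}) : Prop :=
  [/\ (forall i, is_homog q (b i)),
      (forall c : 'I_m -> K, inN D mu q (\sum_i c i *: b i) -> forall i, c i = 0) &
      (forall a, is_homog q a -> exists c : 'I_m -> K,
                   inN D mu q (a - \sum_i c i *: b i))].

Definition pdivides (R : comNzRingType) (P : R) (e : nat) (p : R) : Prop :=
  exists r, p = P ^+ e * r.

Definition has_ord (k : fieldType) (N : nat) (P : {mpoly k[N]}) (x : Kf k N)
  (e : int) : Prop :=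
  exists (a b : {mpoly k[N]}) (e1 e2 : nat),
    [/\ (a != 0) && (b != 0), x = FracField.tofrac a / FracField.tofrac b,
        (pdivides P e1 a /\ ~ pdivides P e1.+1 a),
        (pdivides P e2 b /\ ~ pdivides P e2.+1 b) &
        e = e1%:Z - e2%:Z].

Definition liftS (n : nat) (H : {set 'I_n}) : {set 'I_n.+1} :=
  [set widen_ord (leqnSn n) x | x in H].

(* new vertex = ord_max (the paper's n+1); faces = subsets of the facets *)
Definition stellar (n : nat) (D : {set {set 'I_n}}) (G : {set 'I_n})
  : {set {set 'I_n.+1}} :=
  [set S : {set 'I_n.+1} |
     [exists T : {set 'I_n}, facet D T && (T != G) && (S \subset liftS T)]
     || [exists j in G, S \subset (ord_max |: liftS G) :\ widen_ord (leqnSn n) j]].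

(* Main.v *)
(** H(Delta) is controlled by the double complex of faces H and monomials supported in H,
    with the simplicial boundary in H and a Koszul differential built from the parameters.
    It expresses the rank of the degree pairing in degree q as the rank of a constant
    matrix minus that of a matrix specializing well, so this rank is the same for all
    linear systems of parameters defined over K. Hence a Gram determinant of monomials
    which is generically a basis of the Gorenstein quotient remains one under a_{1,j} = 0
    for j in a non-face F, and the strong Lefschetz property of the specialization says
    that this determinant, a polynomial over powers of the brackets of facets, is not
    divisible by [F]: rescaling the variables turns ell into a generic linear form. So
    ord_[F] D_q = 0 for non-faces F.

    If G is a facet, it is a non-face of the stellar subdivision Delta_G, so that the
    determinant of Delta_G has order 0 along [G]. The degree map of Delta_G is that of
    Delta plus a multiple of p |-> p(c), where c is the vector of coefficients of the linear
    relation between the parameter vectors of G and of the new vertex. In the basis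
    consisting of a basis of Delta, corrected to vanish at c, and x_{n+1}^q, the form of
    Delta_G is the sum of that of Delta and of a rank one form of odd order along [G]:
    the product of the d + 1 coordinates of c, one of which is [G], occurs in it
    once. So ord_[G] D_q is odd, and D_q does not vanish. *)
From Stdlib Require Import FunctionalExtensionality Classical_Prop.
Require Import Defs.
From HB Require Import structures.
From mathcomp Require Import all_boot all_order all_algebra.
From mathcomp Require Import fraction ring zify perm generic_quotient.
From mathcomp.multinomials Require Import mpoly.

Set Implicit Arguments.
Unset Strict Implicit.
Unset Printing Implicit Defensive.

Import Order.TTheory GRing.Theory.
Local Open Scope ring_scope.

(** * Contractions and wedges *)

(** The obstacle is the dimension of the Gorenstein quotient: its pairing matrix has brackets as
    denominators, and semicontinuity only says that the rank cannot grow under specialization. The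
    double complex gives the opposite bound. For a fixed face it is a Koszul complex, exact away
    from the monomial 1; for a fixed monomial other than 1 it is the chain complex of a star, exact
    below the facets. The class [e * p], which lives on facets, can therefore be moved to the
    monomial 1. There it is, for each face G with d - q vertices, a form of degree q in d variables
    killed by the d - q parameter vectors of G: a single scalar, proportional to deg(x_G p). The
    families of forms that occur are an image intersected with a kernel, and only the kernel depends
    on the parameters, linearly. Stars are controlled for nonempty faces only, so this needs q > 0,
    and q = 0 is treated apart. Orders are compared modulo squares and factors not divisible by the
    bracket, so that only signs and squares of transition determinants are lost: the degree of a
    facet monomial is needed up to sign, and any basis may be replaced by a monomial one. *)

Lemma sum_antisym (N : nat) (V : zmodType) (g : 'I_N -> 'I_N -> V) :
  (forall i j, g i j = - g j i) -> (forall i, g i i = 0) ->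
  \sum_i \sum_j g i j = 0.
Proof.
move=> gA g0.
have -> : \sum_i \sum_j g i j =
   \sum_(i < N) \sum_(j : 'I_N | (i < j)%N) g i j + \sum_(i < N) \sum_(j : 'I_N | (j < i)%N) g i j.
  rewrite -big_split; apply: eq_bigr => i _ /=.
  rewrite (bigID (fun j : 'I_N => (i < j)%N)) /=; congr (_ + _).
  rewrite (bigD1 i) ?ltnn //= g0 add0r; apply: eq_bigl => j.
  by rewrite -leqNgt ltn_neqAle andbC.
rewrite [X in _ + X](exchange_big_dep xpredT) //= -big_split big1 // => i _ /=.
by rewrite -big_split big1 // => j _ /=; rewrite gA addNr.
Qed.

Section Exterior.
Variables (N : nat) (L : fieldType).
Implicit Types (f g : {set 'I_N} -> L) (H : {set 'I_N}) (v w : 'I_N).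

(* A function on {set 'I_N} is an element of the exterior algebra on N generators;
   [io v] is the contraction by the v-th dual vector, [ep v] the wedge by the v-th vector. *)
Definition sg v H : nat := #|[set u in H | (u < v)%N]|.

Lemma sgU v w H : w \notin H -> sg v (w |: H) = ((w < v) + sg v H)%N.
Proof.
move=> wH; rewrite /sg.
case: (boolP (w < v)%N) => wv /=.
  rewrite (_ : [set u in w |: H | _] = w |: [set u in H | (u < v)%N]) ?cardsU1 ?inE ?(negbTE wH) //.
  by apply/setP=> u; rewrite !inE; case: eqVneq => //= ->; rewrite wv.
apply: eq_card => u; rewrite !inE; case: eqVneq => //= ->.
by rewrite (negbTE wH) (negbTE wv).
Qed.

Lemma sgD v H : sg v (H :\ v) = sg v H.
Proof.
by apply: eq_card => u; rewrite !inE; case: eqVneq => //= ->; rewrite ltnn andbF.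
Qed.

Lemma sgU1 v H : sg v (v |: H) = sg v H.
Proof.
by apply: eq_card => u; rewrite !inE; case: eqVneq => //= ->; rewrite ltnn andbF.
Qed.

Definition io v f H : L := if v \in H then 0 else (-1) ^+ sg v H * f (v |: H).
Definition ep v f H : L := if v \in H then (-1) ^+ sg v H * f (H :\ v) else 0.

Lemma io_eq v f g : f =1 g -> io v f =1 io v g.
Proof. by move=> fg H; rewrite /io fg. Qed.
Lemma ioio v f H : io v (io v f) H = 0.
Proof. by rewrite /io setU11 mulr0 if_same. Qed.

Lemma ioC v w f H : io v (io w f) H = - io w (io v f) H.
Proof.
case: (eqVneq v w) => [->|vw]; first by rewrite ioio oppr0.
have wv : (w == v) = false by rewrite eq_sym (negbTE vw).
rewrite /io !inE (negbTE vw) wv /=.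
case: (boolP (v \in H)) => vH; case: (boolP (w \in H)) => wH; rewrite ?(mulr0, oppr0) //.
rewrite !sgU // setUCA !mulrA -mulNr; congr (_ * _).
rewrite !exprD.
have := vw; rewrite neq_ltn => /orP[] lt; rewrite lt ltnNge (ltnW lt) /=.
  by rewrite expr0 expr1 mul1r mulN1r mulrN [in RHS]mulrC.
by rewrite expr0 expr1 mul1r mulN1r mulrN opprK mulrC.
Qed.

Lemma ioep v w f H : io v (ep w f) H + ep w (io v f) H = (v == w)%:R * f H.
Proof.
case: (eqVneq v w) => [<-|vw].
  rewrite /io /ep mul1r setU11 in_setD1 eqxx /= sgU1 sgD.
  case: (boolP (v \in H)) => vH.
    by rewrite setD1K // mulrA -expr2 sqrr_sign mul1r add0r.
  rewrite addr0 mulrA -expr2 sqrr_sign mul1r setU1K //.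
have wv : (w == v) = false by rewrite eq_sym (negbTE vw).
rewrite mul0r /io /ep !inE (negbTE vw) wv /=.
case: (boolP (v \in H)) => vH; case: (boolP (w \in H)) => wH; rewrite ?(mulr0, addr0) //.
have -> : (v |: H) :\ w = v |: (H :\ w).
  apply/setP=> x; rewrite !inE; case: (eqVneq x v) => // ->; by rewrite vw.
have sv : sg v H = ((w < v) + sg v (H :\ w))%N.
  by rewrite -{1}(setD1K wH) sgU // !inE eqxx.
rewrite sgU // sv !mulrA -mulrDl.
rewrite (_ : _ + _ = 0) ?mul0r //.
rewrite !exprD.
have := vw; rewrite neq_ltn => /orP[] lt; rewrite lt ltnNge (ltnW lt) /=.
  by rewrite expr0 expr1 !mul1r !mulN1r mulrN [X in _ + X]mulrC addNr.
by rewrite expr0 expr1 !mul1r !mulN1r mulNr mulrC addNr.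
Qed.

Definition ioV (a : 'I_N -> L) f H := \sum_i a i * io i f H.
Definition epV (a : 'I_N -> L) f H := \sum_i a i * ep i f H.

Lemma ioD v f g H : io v (fun X => f X + g X) H = io v f H + io v g H.
Proof. by rewrite /io; case: ifP; rewrite ?addr0 // mulrDr. Qed.
Lemma ioZ v c f H : io v (fun X => c * f X) H = c * io v f H.
Proof. by rewrite /io; case: ifP; rewrite ?mulr0 // mulrCA. Qed.
Lemma epZ v c f H : ep v (fun X => c * f X) H = c * ep v f H.
Proof. by rewrite /ep; case: ifP; rewrite ?mulr0 // mulrCA. Qed.
Lemma io_sum (J : Type) (r : seq J) (P : pred J) v (F : J -> {set 'I_N} -> L) H :
  io v (fun X => \sum_(j <- r | P j) F j X) H = \sum_(j <- r | P j) io v (F j) H.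
Proof.
rewrite /io; case: ifP => _; first by rewrite big1.
by rewrite mulr_sumr.
Qed.
Lemma ep_sum (J : Type) (r : seq J) (P : pred J) v (F : J -> {set 'I_N} -> L) H :
  ep v (fun X => \sum_(j <- r | P j) F j X) H = \sum_(j <- r | P j) ep v (F j) H.
Proof.
rewrite /ep; case: ifP => _; last by rewrite big1.
by rewrite mulr_sumr.
Qed.

Lemma ioV_eq a f g : f =1 g -> ioV a f =1 ioV a g.
Proof. by move=> fg H; apply: eq_bigr => i _; rewrite (io_eq i fg). Qed.
Lemma ioVD a f g H : ioV a (fun X => f X + g X) H = ioV a f H + ioV a g H.
Proof. by rewrite -big_split; apply: eq_bigr => i _; rewrite ioD mulrDr. Qed.
Lemma ioVZ a c f H : ioV a (fun X => c * f X) H = c * ioV a f H.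
Proof. by rewrite mulr_sumr; apply: eq_bigr => i _; rewrite ioZ mulrCA. Qed.
Lemma ioV0 a f H : (forall X, f X = 0) -> ioV a f H = 0.
Proof.
by move=> f0; rewrite /ioV big1 // => i _; rewrite /io f0 mulr0 if_same mulr0.
Qed.
Lemma ioV_sum (J : Type) (r : seq J) (P : pred J) a (F : J -> {set 'I_N} -> L) H :
  ioV a (fun X => \sum_(j <- r | P j) F j X) H = \sum_(j <- r | P j) ioV a (F j) H.
Proof.
rewrite /ioV exchange_big; apply: eq_bigr => i _ /=.
by rewrite io_sum mulr_sumr.
Qed.
Lemma epV0 a f H : (forall X, f X = 0) -> epV a f H = 0.
Proof.
by move=> f0; rewrite /epV big1 // => i _; rewrite /ep f0 mulr0 if_same mulr0.
Qed.
Lemma epV_sum (J : Type) (r : seq J) (P : pred J) a (F : J -> {set 'I_N} -> L) H :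
  epV a (fun X => \sum_(j <- r | P j) F j X) H = \sum_(j <- r | P j) epV a (F j) H.
Proof.
rewrite /epV exchange_big; apply: eq_bigr => i _ /=.
by rewrite ep_sum mulr_sumr.
Qed.

Lemma ioVioV a f H : ioV a (ioV a f) H = 0.
Proof.
rewrite /ioV.
under eq_bigr => i _ do [rewrite io_sum mulr_sumr; under eq_bigr => j _ do rewrite ioZ].
apply: sum_antisym => [i j|i].
  by rewrite ioC !mulrN mulrCA.
by rewrite ioio !mulr0.
Qed.

Lemma ioVC a b f H : ioV a (ioV b f) H = - ioV b (ioV a f) H.
Proof.
rewrite /ioV.
under eq_bigr => i _ do [rewrite io_sum mulr_sumr; under eq_bigr => j _ do rewrite ioZ].
rewrite exchange_big -sumrN; apply: eq_bigr => i _ /=.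
rewrite io_sum mulr_sumr -sumrN; apply: eq_bigr => j _.
by rewrite ioZ ioC !mulrN mulrCA.
Qed.

(** The Clifford relation: wedging with [b] is a contracting homotopy for contraction with [a] once
    they pair to 1. The Koszul exactness below rests on it. *)
Lemma ioVepV a b f H :
  ioV a (epV b f) H + epV b (ioV a f) H = (\sum_i a i * b i) * f H.
Proof.
rewrite /ioV /epV.
under eq_bigr => i _ do [rewrite io_sum mulr_sumr; under eq_bigr => j _ do rewrite ioZ].
under [X in _ + X]eq_bigr => i _ do
  [rewrite ep_sum mulr_sumr; under eq_bigr => j _ do rewrite epZ].
rewrite [X in _ + X]exchange_big -big_split /= mulr_suml; apply: eq_bigr => i _.
rewrite -big_split /=.
under eq_bigr => j _ do rewrite [X in _ + X]mulrCA -!mulrDr ioep.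
rewrite (bigD1 i) //= eqxx mul1r mulrA big1 ?addr0 // => j ji.
by rewrite eq_sym (negbTE ji) mul0r !mulr0.
Qed.

Lemma ioV_supp a f H m :
  (forall X, f X != 0 -> #|X| = m.+1) -> ioV a f H != 0 -> #|H| = m.
Proof.
move=> fm; apply: contraNeq => Hm.
rewrite /ioV big1 // => i _; rewrite /io; case: (boolP (i \in H)) => iH; rewrite ?mulr0 //.
have [->|/fm] := eqVneq (f (i |: H)) 0; first by rewrite !mulr0.
by rewrite cardsU1 iH add1n => -[] /eqP; rewrite (negbTE Hm).
Qed.

Lemma epV_supp a f H m :
  (forall X, f X != 0 -> #|X| = m) -> epV a f H != 0 -> #|H| = m.+1.
Proof.
move=> fm; apply: contraNeq => Hm.
rewrite /epV big1 // => i _; rewrite /ep; case: (boolP (i \in H)) => iH; rewrite ?mulr0 //.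
have [->|/fm] := eqVneq (f (H :\ i)) 0; first by rewrite !mulr0.
by move=> X; move: Hm; rewrite (cardsD1 i H) iH X eqxx.
Qed.

(* A form of degree i killed by more than N - i independent contractions is 0:
   write it as a contraction of a form of degree > N. *)
Lemma ioV_kill (M : finType) (mu lam : M -> 'I_N -> L) (A : {set M}) f m :
  (forall h h', h \in A -> h' \in A ->
     \sum_i mu h i * lam h' i = (h == h')%:R) ->
  (forall X, f X != 0 -> #|X| = m) ->
  (forall h, h \in A -> ioV (mu h) f =1 fun=> 0) ->
  (N < #|A| + m)%N -> f =1 fun=> 0.
Proof.
elim: {A}_.+1 {-2}A (ltnSn #|A|) f m => // r IH A Ar f m dual fm kill.
case: (set_0Vmem A) => [-> | [h hA]].
  rewrite cards0 add0n => Nm X; apply/eqP; apply: contraTT Nm => /fm <-.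
  by rewrite -leqNgt -[leqRHS](card_ord N) max_card.
move=> lt X.
have -> : f X = ioV (mu h) (epV (lam h) f) X.
  have := ioVepV (mu h) (lam h) f X; rewrite dual // eqxx mul1r => <-.
  by rewrite (epV0 _ _ (kill h hA)) addr0.
apply: ioV0; apply: (IH (A :\ h) _ _ m.+1).
- by move: Ar; rewrite (cardsD1 h A) hA.
- by move=> a b /setD1P[_ aA] /setD1P[_ bA]; apply: dual.
- by move=> Y; apply: epV_supp.
- move=> h' /setD1P[h'h h'A] Y.
  have := ioVepV (mu h') (lam h) f Y; rewrite dual // (negbTE h'h) mul0r.
  by rewrite [X in _ + X](epV0 _ _ (kill h' h'A)) addr0.
by move: lt; rewrite (cardsD1 h A) hA addSn addnS.
Qed.

End Exterior.

(** * Koszul exactness *)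

Section Multinomials.
Variable n : nat.
Implicit Types (m : 'X_{1..n}) (h : 'I_n).

Lemma msupport0 : msupport (0%MM : 'X_{1..n}) = set0.
Proof. by apply/setP => j; rewrite !inE mnm0E. Qed.

Lemma msupportD m1 m2 : msupport (m1 + m2) = msupport m1 :|: msupport m2.
Proof. by apply/setP => j; rewrite !inE mnmDE addn_eq0 negb_and. Qed.

Lemma msupport1 h : msupport U_(h)%MM = [set h].
Proof. by apply/setP => j; rewrite !inE mnm1E eqb0 negbK eq_sym. Qed.

Lemma msupport_eq0 m : (msupport m == set0) = (m == 0%MM).
Proof.
apply/eqP/eqP => [m0|->]; last exact: msupport0.
apply/mnmP => j; rewrite mnm0E; apply/eqP.
by have /setP/(_ j) := m0; rewrite !inE => /negbFE.
Qed.

Lemma msubK m h : (0 < m h)%N -> (m - U_(h) + U_(h))%MM = m.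
Proof. by move=> mh; rewrite submK // lep1mP -lt0n. Qed.

Lemma mdeg_sub1 m h : (0 < m h)%N -> mdeg (m - U_(h)) = (mdeg m).-1.
Proof. by move=> mh; rewrite -[in RHS](msubK mh) mdegD mdeg1 addn1. Qed.

End Multinomials.

Section Koszul.
Variables (n d : nat) (L : fieldType) (mu : 'I_n -> 'I_d -> L).
Implicit Types (s t : 'X_{1..n} -> {set 'I_d} -> L) (H : {set 'I_n}) (h : 'I_n).

(* [s al I] is the coefficient of x^al e_I. *)
Definition xs h s (al : 'X_{1..n}) I : L := if (0 < al h)%N then s (al - U_(h))%MM I else 0.

(** Summed over [h] first, this is the Koszul differential of the linear forms
    [\sum_(h in H) mu h i * x_h], the restrictions of the parameters to the face [H]. *)
Definition kap H s al I := \sum_(h in H) ioV (mu h) (xs h s al) I.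

Lemma xsE h s al I : xs h s (al + U_(h)) I = s al I.
Proof. by rewrite /xs mnmDE mnm1E eqxx addn1 /= addmK. Qed.

Lemma xsC h h' s al I : xs h (xs h' s) al I = xs h' (xs h s) al I.
Proof.
rewrite /xs !mnmBE !mnm1E eq_sym; case: eqVneq => [->//|hh'] /=.
rewrite !subn0; case: (0 < al h)%N; case: (0 < al h')%N => //.
by rewrite !submDA addmC.
Qed.

Lemma kap_eq H s t al I : (forall a J, s a J = t a J) -> kap H s al I = kap H t al I.
Proof.
by move=> st; apply: eq_bigr => h _; apply: ioV_eq => J; rewrite /xs st.
Qed.

Lemma kapD H s t al I : kap H (fun a J => s a J + t a J) al I = kap H s al I + kap H t al I.
Proof.
rewrite -big_split; apply: eq_bigr => h _ /=; rewrite -ioVD; apply: ioV_eq => J.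
by rewrite /xs; case: ifP; rewrite ?addr0.
Qed.

Lemma kapZ H c s al I : kap H (fun a J => c * s a J) al I = c * kap H s al I.
Proof.
rewrite mulr_sumr; apply: eq_bigr => h _ /=; rewrite -ioVZ; apply: ioV_eq => J.
by rewrite /xs; case: ifP; rewrite ?mulr0.
Qed.

Lemma kapB H s t al I : kap H (fun a J => s a J - t a J) al I = kap H s al I - kap H t al I.
Proof.
rewrite -[X in _ - X]mul1r -mulNr -kapZ -kapD; apply: kap_eq => a J.
by rewrite mulN1r.
Qed.

Lemma kap0 H s al I : (forall a J, s a J = 0) -> kap H s al I = 0.
Proof.
by move=> s0; rewrite /kap big1 // => h _; apply: ioV0 => J; rewrite /xs s0 if_same.
Qed.

Lemma xs_kap H h s al I :
  xs h (kap H s) al I = \sum_(h' in H) ioV (mu h') (xs h (xs h' s) al) I.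
Proof.
rewrite /xs; case: ifP => [_|ah]; first by apply: eq_bigr.
by rewrite big1 // => h' _; apply: ioV0.
Qed.

Lemma kap_kap H s al I : kap H (kap H s) al I = 0.
Proof.
rewrite /kap.
under eq_bigr => h _ do
  [rewrite (ioV_eq _ (xs_kap H h s al)) ioV_sum big_mkcond].
rewrite big_mkcond /=.
rewrite (eq_bigr (fun h => \sum_h' if (h \in H) && (h' \in H) then
   ioV (mu h) (ioV (mu h') (xs h (xs h' s) al)) I else 0)); last first.
  move=> h _; case: (h \in H) => //=; by rewrite big1.
apply: sum_antisym => [i j|i]; last by rewrite ioVioV if_same.
rewrite andbC; case: ifP => _; rewrite ?oppr0 // ioVC.
by congr (- _); apply: ioV_eq => J; apply: ioV_eq => J'; rewrite xsC.
Qed.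

Lemma kap_supp H s r m :
  (forall al I, s al I != 0 -> [/\ msupport al \subset H, mdeg al = r & #|I| = m.+1]) ->
  forall al I, kap H s al I != 0 -> [/\ msupport al \subset H, mdeg al = r.+1 & #|I| = m].
Proof.
move=> sP al I.
rewrite /kap => nz.
have /existsP[h /andP[hH]] : [exists h, (h \in H) && (ioV (mu h) (xs h s al) I != 0)].
  apply: contraNT nz; rewrite negb_exists => /forallP z; rewrite big1 // => h hH.
  by apply/eqP; have := z h; rewrite hH /= negbK.
move=> nz'; have xsP J : xs h s al J != 0 -> [/\ msupport al \subset H, mdeg al = r.+1 & #|J| = m.+1].
  rewrite /xs; case: ifP; rewrite ?eqxx // => ah /sP[sH dr ->]; split => //.
    rewrite -(msubK ah) msupportD msupport1 subUset sH; by rewrite sub1set.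
  by rewrite -dr mdeg_sub1 // prednK // -(msubK ah) mdegD mdeg1 addn1.
split.
- apply/negPn/negP => no; move: nz'; rewrite ioV0 ?eqxx // => X.
  by apply/eqP; apply: contraNT no => /xsP[].
- apply/eqP/negPn/negP => no; move: nz'; rewrite ioV0 ?eqxx // => X.
  by apply/eqP; apply: contraNT no => /xsP[_ -> _].
- by apply: (ioV_supp _ nz') => X /xsP[].
Qed.

(* Peel off one variable x_h: with lam dual to mu h, wedging by lam is a
   contracting homotopy for multiplication by x_h. *)
Lemma kap_exact H (lam : 'I_n -> 'I_d -> L) :
  (forall h h', h \in H -> h' \in H -> \sum_i mu h i * lam h' i = (h == h')%:R) ->
  forall s r m,
  (forall al I, s al I != 0 -> [/\ msupport al \subset H, mdeg al = r.+1 & #|I| = m]) ->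
  (forall al I, kap H s al I = 0) ->
  exists t, (forall al I, t al I != 0 -> [/\ msupport al \subset H, mdeg al = r & #|I| = m.+1])
    /\ forall al I, s al I = kap H t al I.
Proof.
elim: {H}_.+1 {-2}H (ltnSn #|H|) => // k IH H Hk dual s r m sP sK.
case: (set_0Vmem H) => [H0 | [h hH]].
  exists (fun _ _ => 0); split => [al I|al I]; first by rewrite eqxx.
  rewrite kap0 //; apply/eqP; apply/negPn/negP => /sP[].
  by rewrite H0 subset0 msupport_eq0 => /eqP ->; rewrite mdeg0.
(* The part of [s] free of [x_h] is a cycle for [H :\ h], so induction applies to it; what it leaves
   of [s] is a multiple of [x_h]. *)
pose s0 (al : 'X_{1..n}) I := if al h == 0%N then s al I else 0.
have [||||t0 [t0P s0E]] := IH (H :\ h) _ _ s0 r m.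
- by move: Hk; rewrite (cardsD1 h H) hH.
- by move=> a b /setD1P[_ aH] /setD1P[_ bH]; apply: dual.
- move=> al I; rewrite /s0; case: (al h =P 0%N) => [ah|_]; last by rewrite eqxx.
  move=> /sP[sH -> ->]; split=> //; rewrite subsetD1 sH.
  by rewrite inE ah.
- move=> al I; case: (posnP (al h)) => ah.
    rewrite -(sK al I) /kap [RHS](big_setD1 h) //=.
    rewrite [X in X + _]ioV0 ?add0r; last by move=> J; rewrite /xs ah.
    apply: eq_bigr => h' /setD1P[h'h _]; apply: ioV_eq => J; rewrite /xs /s0.
    by rewrite mnmBE ah sub0n eqxx.
  rewrite /kap big1 // => h' /setD1P[h'h _]; apply: ioV0 => J; rewrite /xs /s0.
  by rewrite mnmBE mnm1E (negbTE h'h) subn0 (gtn_eqF ah) if_same.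
have t0P' al I : t0 al I != 0 -> [/\ msupport al \subset H, mdeg al = r & #|I| = m.+1].
  by move=> /t0P[sH -> ->]; split=> //; apply: subset_trans sH (subsetDl _ _).
pose w (al : 'X_{1..n}) I := s al I - kap H t0 al I.
have w0 (al : 'X_{1..n}) I : al h = 0%N -> w al I = 0.
  move=> ah; rewrite /w; have := s0E al I; rewrite /s0 ah eqxx => ->.
  rewrite /kap [X in _ - X](big_setD1 h) //= [X in _ - (X + _)]ioV0 ?add0r ?subrr //.
  by move=> J; rewrite /xs ah.
have wP al I : w al I != 0 -> [/\ msupport al \subset H, mdeg al = r.+1 & #|I| = m].
  rewrite /w; have [->|/sP //] := eqVneq (s al I) 0.
  by rewrite sub0r oppr_eq0; apply: kap_supp.
pose w' (al : 'X_{1..n}) I := w (al + U_(h))%MM I.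
have wE al I : w al I = xs h w' al I.
  rewrite /xs; case: ifP => ah; first by rewrite /w' msubK.
  by rewrite w0 //; case: (al h) ah.
have w'P al I : w' al I != 0 -> [/\ msupport al \subset H, mdeg al = r & #|I| = m].
  move=> /wP[]; rewrite mdegD mdeg1 addn1 msupportD subUset => /andP[-> _].
  by case.
have w'K al I : kap H w' al I = 0.
  have : kap H w (al + U_(h))%MM I = 0.
    by rewrite kapB sK sub0r kap_kap oppr0.
  move=> <-; apply: eq_bigr => h' _; apply: ioV_eq => J.
  rewrite -(xsE h (xs h' w')) xsC.
  by rewrite /xs; case: ifP => // _; rewrite wE.
(* By the Clifford relation, [kap] of the wedge of [lam h] with [w'] is [x_h w'] minus the wedge of
   [kap w' = 0]. *)
exists (fun al I => t0 al I + epV (lam h) (w' al) I); split => [al I|al I].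
  have [->|/t0P' //] := eqVneq (t0 al I) 0; rewrite add0r => nz.
  have w'nz : [&& msupport al \subset H & mdeg al == r].
    apply: contraNT nz => no; apply/eqP; apply: epV0 => J.
    by apply/eqP; apply: contraNT no => /w'P[-> -> _]; rewrite eqxx.
  case/andP: w'nz => -> /eqP ->; split=> //.
  by apply: (epV_supp _ nz) => J /w'P[].
rewrite kapD -[s al I](subrK (kap H t0 al I)) addrC; congr (_ + _).
rewrite -/(w al I) wE.
rewrite (_ : kap H (fun a J => epV (lam h) (w' a) J) al I =
   \sum_(h' in H) ioV (mu h') (epV (lam h) (xs h' w' al)) I); last first.
  apply: eq_bigr => h' _; apply: ioV_eq => J; rewrite /xs.
  by case: ifP => // _; rewrite epV0.
rewrite (eq_bigr (fun h' => (h' == h)%:R * xs h' w' al I -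
   epV (lam h) (ioV (mu h') (xs h' w' al)) I)); last first.
  move=> h' h'H; rewrite -(dual h' h) // -ioVepV addrK //.
rewrite sumrB -epV_sum (epV0 _ _ (w'K al)) subr0.
by rewrite (bigD1 h) //= eqxx mul1r big1 ?addr0 // => h' /andP[_ /negbTE ->]; rewrite mul0r.
Qed.

End Koszul.

(** * Oriented homology manifolds and the total complex *)

Section Boundary.
Variables (n d : nat) (L : fieldType).
Implicit Types (H T : {set 'I_n}) (c b e : {set 'I_n} -> L) (D : {set {set 'I_n}}).

(** The simplicial boundary read on coefficients: [H] collects the values at its cofaces [v |: H].
    It is the contraction with the all-ones covector, so the sign rules of the exterior algebra
    apply. *)
Definition bd c H : L := \sum_v io v c H.

Lemma bd_eq c b H : c =1 b -> bd c H = bd b H.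
Proof. by move=> cb; apply: eq_bigr => v _; apply: io_eq. Qed.
Lemma bdD c b H : bd (fun X => c X + b X) H = bd c H + bd b H.
Proof. by rewrite -big_split; apply: eq_bigr => v _; apply: ioD. Qed.
Lemma bdZ a c H : bd (fun X => a * c X) H = a * bd c H.
Proof. by rewrite mulr_sumr; apply: eq_bigr => v _; apply: ioZ. Qed.
Lemma bdB c b H : bd (fun X => c X - b X) H = bd c H - bd b H.
Proof.
rewrite -[X in _ - X]mul1r -mulNr -bdZ -bdD; apply: bd_eq => X.
by rewrite mulN1r.
Qed.
Lemma bd_ext c b H : (forall v, v \notin H -> c (v |: H) = b (v |: H)) -> bd c H = bd b H.
Proof. by move=> cb; apply: eq_bigr => v _; rewrite /io; case: ifPn => // vH; rewrite cb. Qed.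
Lemma bd0 c H : (forall v, v \notin H -> c (v |: H) = 0) -> bd c H = 0.
Proof.
by move=> c0; rewrite /bd big1 // => v _; rewrite /io; case: ifPn => // vH; rewrite c0 ?mulr0.
Qed.
Lemma bd_sum (J : Type) (r : seq J) (P : pred J) (F : J -> {set 'I_n} -> L) H :
  bd (fun X => \sum_(j <- r | P j) F j X) H = \sum_(j <- r | P j) bd (F j) H.
Proof. by rewrite /bd exchange_big; apply: eq_bigr => v _; apply: io_sum. Qed.
Lemma bdbd c H : bd (bd c) H = 0.
Proof.
rewrite /bd; under eq_bigr => v _ do rewrite io_sum.
by apply: sum_antisym => [i j|i]; [apply: ioC | apply: ioio].
Qed.
Lemma bd_nz c H : bd c H != 0 -> exists2 v, v \notin H & c (v |: H) != 0.
Proof.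
move=> nz; have /existsP[v /andP[vH cv]] : [exists v, (v \notin H) && (c (v |: H) != 0)].
  apply: contraNT nz; rewrite negb_exists => /forallP z; rewrite bd0 // => v vH.
  by apply/eqP; have := z v; rewrite vH /= negbK.
by exists v.
Qed.

(* Abstract properties of an oriented connected homology manifold: [exact] and
   [top] say that the complex of the faces containing a nonempty face has
   homology only at the facets, spanned there by the orientation class e. *)
Record good D e : Prop := Good {
  good_closed : forall F G : {set 'I_n}, F \in D -> G \subset F -> G \in D;
  good_dim : forall F : {set 'I_n}, F \in D -> (#|F| <= d)%N;
  good_facet : exists F : {set 'I_n}, F \in D /\ #|F| = d;
  good_exact : forall T i c, T \in D -> T != set0 -> (i < d)%N ->
    (forall H, c H != 0 -> [/\ H \in D, T \subset H & #|H| = i]) ->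
    (forall H, T \subset H -> bd c H = 0) ->
    exists b, (forall H, b H != 0 -> [/\ H \in D, T \subset H & #|H| = i.+1]) /\
              (forall H, T \subset H -> bd b H = c H);
  good_top : forall T c, T \in D -> T != set0 ->
    (forall H, c H != 0 -> [/\ H \in D, T \subset H & #|H| = d]) ->
    (forall H, T \subset H -> bd c H = 0) ->
    exists a, forall H, T \subset H -> c H = a * e H;
  good_e : forall H, (e H != 0) = (H \in D) && (#|H| == d);
  good_cycle : forall H, bd e H = 0;
  good_conn : forall P : pred 'I_n,
    (forall x y, [set x; y] \in D -> P x -> P y) -> forall x y, P x -> P y }.
End Boundary.

Section Total.
Variables (n d : nat) (L : fieldType) (mu : 'I_n -> 'I_d -> L).
Variables (D : {set {set 'I_n}}) (e : {set 'I_n} -> L) (gD : good d D e).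
Hypothesis indep : forall H, H \in D -> exists lam : 'I_n -> 'I_d -> L,
  forall h h', h \in H -> h' \in H -> \sum_i mu h i * lam h' i = (h == h')%:R.
Variables (G : {set 'I_n}) (q : nat).
Implicit Types (H T : {set 'I_n}) (f g : {set 'I_n} -> 'X_{1..n} -> {set 'I_d} -> L)
  (al : 'X_{1..n}) (I : {set 'I_d}).

(* The double complex of functions f H al I, where H is a face containing G and the
   support of al: the simplicial boundary in H, the Koszul differential in al and I. *)
Definition bdt f H al I : L :=
  if msupport al :|: G \subset H then bd (fun X => f X al I) H else 0.
Definition kp f H al I : L := (-1) ^+ #|H| * kap mu H (f H) al I.
Definition DD f H al I := bdt f H al I + kp f H al I.

Definition tchom t f := forall H al I, f H al I != 0 ->
  [/\ H \in D, msupport al :|: G \subset H, (#|H| + #|I|)%N = t & (mdeg al + #|I|)%N = q].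

Lemma DD_eq f g : (forall H al I, f H al I = g H al I) -> forall H al I, DD f H al I = DD g H al I.
Proof.
move=> fg H al I; rewrite /DD /bdt /kp; congr (_ + _).
  by case: ifP => // _; apply: bd_eq => X.
by congr (_ * _); apply: kap_eq.
Qed.
Lemma DDD f g H al I :
  DD (fun H al I => f H al I + g H al I) H al I = DD f H al I + DD g H al I.
Proof.
rewrite /DD addrACA; congr (_ + _).
  by rewrite /bdt; case: ifP => _; rewrite ?addr0 // bdD.
by rewrite /kp -mulrDr; congr (_ * _); rewrite kapD.
Qed.
Lemma DDZ c f H al I : DD (fun H al I => c * f H al I) H al I = c * DD f H al I.
Proof.
rewrite /DD mulrDr; congr (_ + _).
  by rewrite /bdt; case: ifP => _; rewrite ?mulr0 // bdZ.
by rewrite /kp mulrCA; congr (_ * _); rewrite kapZ.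
Qed.
Lemma DDB f g H al I :
  DD (fun H al I => f H al I - g H al I) H al I = DD f H al I - DD g H al I.
Proof.
rewrite -[X in _ - X]mul1r -mulNr -DDZ -DDD; apply: DD_eq => X a J.
by rewrite mulN1r.
Qed.

Lemma bdtbdt f H al I : bdt (bdt f) H al I = 0.
Proof.
rewrite /bdt; case: ifP => // sH; rewrite -[RHS](bdbd (fun X => f X al I) H).
by apply: bd_ext => v vH; rewrite (subset_trans sH (subsetUr _ _)).
Qed.

Lemma kpkp f H al I : kp (kp f) H al I = 0.
Proof. by rewrite /kp kapZ kap_kap !mulr0. Qed.

(** The factor [(-1) ^+ #|H|] in [kp] makes two commuting differentials anticommute. A vertex [v]
    outside [H] has [al v = 0], so it contributes nothing to the Koszul sum over [v |: H]. *)
Lemma bdtkp f H al I : bdt (kp f) H al I + kp (bdt f) H al I = 0.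
Proof.
rewrite {1}/bdt; case: ifPn => [sH|nsH]; last first.
  rewrite add0r /kp /kap big1 ?mulr0 // => h hH; apply: ioV0 => J.
  rewrite /xs; case: ifP => // ah; rewrite /bdt ifN //.
  apply: contra nsH; rewrite !subUset -{2}(msubK ah) msupportD msupport1 subUset sub1set hH.
  by case/andP=> -> ->.
have vH v : v \notin H -> al v = 0%N.
  move=> vH; apply/eqP; apply: contraNT vH => av.
  by apply: (subsetP sH); rewrite !inE av.
transitivity (bd (fun X => (-1) ^+ #|X| * \sum_(h in H) ioV (mu h) (xs h (f X) al) I) H +
  kp (bdt f) H al I).
  congr (_ + _); apply: bd_ext => v nv; rewrite /kp /kap big_setU1 //= [X in X + _]ioV0 ?add0r //.
  by move=> J; rewrite /xs vH.
transitivity (- (-1) ^+ #|H| * bd (fun X => \sum_(h in H) ioV (mu h) (xs h (f X) al) I) H +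
  kp (bdt f) H al I).
  congr (_ + _); rewrite -bdZ; apply: bd_ext => v nv.
  by rewrite cardsU1 nv exprS mulN1r.
rewrite mulNr bd_sum /kp /kap addrC -mulrBr -sumrB big1 ?mulr0 // => h hH.
apply/eqP; rewrite subr_eq0; apply/eqP.
transitivity (ioV (mu h) (fun J => bd (fun X => xs h (f X) al J) H) I).
  apply: ioV_eq => J; rewrite /xs; case: ifP => ah; last by rewrite bd0.
  rewrite /bdt ifT //; apply: subset_trans sH; rewrite setSU //.
  by apply/subsetP=> x; rewrite !inE mnmBE; apply: contraNN => /eqP ->.
rewrite /bd ioV_sum; apply: eq_bigr => v _; rewrite /ioV /io.
case: ifP => vH'; first by rewrite big1 // => i _; case: ifP => _; rewrite !mulr0.
rewrite mulr_sumr; apply: eq_bigr => i _; case: ifP => _; rewrite ?mulr0 //.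
by rewrite mulrCA [LHS]mulrCA [RHS]mulrCA; congr (_ * _); apply: mulrCA.
Qed.

Lemma DDDD f H al I : DD (DD f) H al I = 0.
Proof.
rewrite (_ : DD (DD f) H al I =
  (bdt (bdt f) H al I + bdt (kp f) H al I) + (kp (bdt f) H al I + kp (kp f) H al I)).
  by rewrite bdtbdt kpkp add0r addr0 bdtkp.
rewrite {1}/DD; congr (_ + _).
  by rewrite /bdt; case: ifP => _; rewrite ?addr0 // -bdD.
by rewrite /kp -mulrDr -kapD.
Qed.

Lemma kap_hom t f H : tchom t f ->
  forall al I, kap mu H (f H) al I != 0 ->
   [/\ H \in D, msupport al :|: G \subset H, (#|H| + #|I|).+1 = t & (mdeg al + #|I|)%N = q].
Proof.
move=> fP al I nz.
case: (ltnP #|H| t) => [tH|tH]; last first.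
  move: nz; rewrite /kap big1 ?eqxx // => h hH; apply: big1 => i _.
  rewrite /io; case: ifPn => iI; rewrite ?mulr0 //.
  rewrite /xs; case: ifP => _; rewrite ?mulr0 //.
  have [->|/fP[_ _ E _]] := eqVneq (f H (al - U_(h))%MM (i |: I)) 0; first by rewrite !mulr0.
  by move: tH; rewrite -E leqNgt cardsU1 iI addnA addn1 addSn ltnS leq_addr.
have [t' tE] : exists m, t = (#|H| + m.+1)%N.
  by exists (t - #|H|).-1; rewrite prednK ?subn_gt0 // subnKC // ltnW.
case: (leqP t'.+1 q) => qt; last first.
  move: nz; rewrite /kap big1 ?eqxx // => h hH; apply: big1 => i _.
  rewrite /io; case: ifPn => iI; rewrite ?mulr0 //.
  rewrite /xs; case: ifP => _; rewrite ?mulr0 //.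
  have [->|/fP[_ _ E E']] := eqVneq (f H (al - U_(h))%MM (i |: I)) 0; first by rewrite !mulr0.
  by move: E; rewrite tE => /addnI E; move: qt; rewrite -E' E ltnNge leq_addl.
have HD : H \in D /\ G \subset H.
  have /existsP[h /existsP[i nz']] :
     [exists h, [exists i, xs h (f H) al (i |: I) != 0]].
    apply: contraNT nz; rewrite negb_exists => /forallP z; rewrite /kap big1 // => h _.
    have := z h; rewrite negb_exists => /forallP z'; apply: big1 => i _.
    have := z' i; rewrite negbK /io => /eqP ->; rewrite !mulr0.
    by case: ifP => _; rewrite mulr0.
  move: nz'; rewrite /xs; case: ifP => _; last by rewrite eqxx.
  by case/fP=> HD; rewrite subUset => /andP[_ ->].
have [|sH -> ->] := kap_supp (H := H) (r := (q - t'.+1)%N) (m := t') _ nz.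
  move=> a J /fP[_]; rewrite subUset => /andP[-> _]; rewrite tE => /addnI -> <-.
  by split=> //; rewrite addnK.
rewrite subUset sH tE addnS; case: HD => -> ->; split=> //.
by rewrite addSn -addnS subnK.
Qed.

Lemma hom_DD t f : tchom t.+1 f -> tchom t (DD f).
Proof.
move=> fP H al I; rewrite /DD => nz.
have [k0|k0] := eqVneq (kap mu H (f H) al I) 0; last by have [? ? [?] ?] := kap_hom fP k0.
move: nz; rewrite /kp k0 mulr0 addr0 /bdt; case: ifP => sH; last by rewrite eqxx.
case/bd_nz => v vH /fP[vD _ + ->]; rewrite cardsU1 vH => -[<-]; split=> //.
exact: good_closed gD _ _ vD (subsetUr _ _).
Qed.

Lemma kap_at0 (s : 'X_{1..n} -> {set 'I_d} -> L) H I : kap mu H s 0%MM I = 0.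
Proof. by rewrite /kap big1 // => h _; apply: ioV0 => J; rewrite /xs mnm0E. Qed.

Lemma homB t f g : tchom t f -> tchom t g -> tchom t (fun H al I => f H al I - g H al I).
Proof.
move=> fP gP H al I; have [->|/fP//] := eqVneq (f H al I) 0.
by rewrite sub0r oppr_eq0; apply: gP.
Qed.
Lemma homD t f g : tchom t f -> tchom t g -> tchom t (fun H al I => f H al I + g H al I).
Proof.
move=> fP gP H al I; have [->|/fP//] := eqVneq (f H al I) 0.
by rewrite add0r; apply: gP.
Qed.
Lemma homZ t c f : tchom t f -> tchom t (fun H al I => c * f H al I).
Proof. by move=> fP H al I; rewrite mulf_eq0 negb_or => /andP[_ /fP]. Qed.

(* Eliminate the faces from the largest down, by exactness of the Koszul complexes. *)
Lemma eliminate_down t f : tchom t f ->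
  (forall H al I, al != 0%MM -> DD f H al I = 0) ->
  exists g, tchom t.+1 g /\ forall H al I, al != 0%MM -> f H al I = DD g H al I.
Proof.
move=> fP fD.
suff X k : exists g, tchom t.+1 g /\
    forall H al I, al != 0%MM -> (n < #|H| + k)%N -> f H al I = DD g H al I.
  have [g [gP gE]] := X n.+1; exists g; split=> // H al I a0.
  by apply: gE => //; rewrite addnS ltnS leq_addl.
elim: k => [|k [g [gP gE]]].
  exists (fun _ _ _ => 0); split => [H al I|H al I _]; first by rewrite eqxx.
  by rewrite addn0 ltnNge -[X in (_ <= X)%N](card_ord n) max_card.
pose f1 H al I := f H al I - DD g H al I.
have f1P : tchom t f1 by apply: homB => //; apply: hom_DD.
have f1D H al I : al != 0%MM -> DD f1 H al I = 0.
  by move=> a0; rewrite DDB fD // DDDD subr0.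
have f1k H al I : al != 0%MM -> (n < #|H| + k)%N -> f1 H al I = 0.
  by move=> a0 nk; rewrite /f1 gE // subrr.
have ex H : exists s : 'X_{1..n} -> {set 'I_d} -> L,
    (forall al I, s al I != 0 -> [/\ H \in D, msupport al :|: G \subset H,
         (#|H| + #|I|)%N = t.+1 & (mdeg al + #|I|)%N = q]) /\
    ((#|H| + k)%N = n -> forall al I, al != 0%MM -> f1 H al I = kap mu H s al I).
  case: (boolP [&& H \in D, G \subset H, (#|H| + k)%N == n, (#|H| <= t)%N & (t - #|H| < q)%N]);
    last first.
    move=> no; exists (fun _ _ => 0); split => [al I|Hk al I a0]; first by rewrite eqxx.
    rewrite kap0 //; apply: contraNeq no => /f1P[HD].
    rewrite subUset => /andP[_ GH] <- <-; rewrite HD GH Hk eqxx leq_addr addKn /=.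
    by rewrite -[X in (X < _)%N]add0n ltn_add2r lt0n mdeg_eq0.
  case/and5P=> HD GH /eqP Hk Ht tq.
  have [lam dual] := indep HD.
  have sP al I : f1 H al I != 0 -> [/\ msupport al \subset H,
       mdeg al = (q - (t - #|H|)).-1.+1 & #|I| = (t - #|H|)%N].
    case/f1P=> _; rewrite subUset => /andP[-> _] E1 E2.
    have I1 : #|I| = (t - #|H|)%N by rewrite -E1 addKn.
    split=> //; rewrite prednK ?subn_gt0 //; by rewrite -I1 -E2 addnK.
  have [|s [s1 s2]] := kap_exact dual sP.
    move=> al I; have [->|a0] := eqVneq al 0%MM; first exact: kap_at0.
    (* [f1] already vanishes on faces with one more vertex, so its boundary at [H] is 0 and
       [DD f1 = 0] says that [f1 H] is a Koszul cycle. *)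
    have := f1D H al I a0; rewrite /DD /bdt bd0 ?if_same ?add0r => [|v vH]; last first.
      by apply: f1k => //; rewrite cardsU1 vH add1n addSn Hk.
    rewrite /kp => /eqP; rewrite mulf_eq0 signr_eq0 /= => /eqP //.
  exists s; split=> // al I /[dup] sn /s1[sH m1 I1]; rewrite HD subUset sH GH; split=> //.
    by rewrite I1 addnS subnKC.
  by rewrite m1 I1 addnS -addSn prednK ?subn_gt0 // subnK // ltnW.
have [s sP] := fin_all_exists ex.
pose gk H al I := if (#|H| + k)%N == n then (-1) ^+ #|H| * s H al I else 0.
have gkP : tchom t.+1 gk.
  move=> H al I; rewrite /gk; case: ((#|H| + k)%N =P n) => [Hk|_]; last by rewrite eqxx.
  rewrite mulf_eq0 signr_eq0 /=; exact: (sP H).1.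
exists (fun H al I => g H al I + gk H al I); split; first exact: homD.
move=> H al I a0 nk; rewrite DDD.
have b0 : bdt gk H al I = 0.
  rewrite /bdt bd0 ?if_same // => v vH; rewrite /gk cardsU1 vH add1n addSn -addnS.
  by rewrite (gtn_eqF nk).
rewrite [DD gk _ _ _]/DD b0 add0r /kp.
case: (eqVneq (#|H| + k)%N n) => Hk; last first.
  rewrite kap0; last by move=> a J; rewrite /gk (negbTE Hk).
  rewrite mulr0 addr0 gE //.
  by rewrite ltn_neqAle eq_sym Hk -ltnS -addnS.
rewrite (kap_eq _ _ _ (t := fun a J => (-1) ^+ #|H| * s H a J)); last first.
  by move=> a J; rewrite /gk Hk eqxx.
rewrite kapZ mulrA -expr2 sqrr_sign mul1r -(sP H).2 //.
by rewrite /f1 addrC subrK.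
Qed.

(* Eliminate the faces from the smallest up, by exactness of the complexes of
   the faces containing a nonempty face. *)
Lemma eliminate_up t f : tchom t f -> (forall H I, f H 0%MM I = 0) ->
  (forall H al I, DD f H al I = 0) ->
  exists g, tchom t.+1 g /\ forall H al I, (#|H| < d)%N -> f H al I = DD g H al I.
Proof.
move=> fP f0 fD.
suff X k : (k <= d)%N -> exists g, [/\ tchom t.+1 g, (forall H I, g H 0%MM I = 0) &
    forall H al I, (#|H| < k)%N -> f H al I = DD g H al I].
  by have [//|g [gP _ gE]] := X d; exists g; split=> // H al I; apply: gE.
elim: k => [_|k IH kd].
  by exists (fun _ _ _ => 0); split => // H al I; rewrite eqxx.
have [g [gP g0 gE]] := IH (ltnW kd).
pose f1 H al I := f H al I - DD g H al I.
have f1P : tchom t f1 by apply: homB => //; apply: hom_DD.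
have f1D H al I : DD f1 H al I = 0 by rewrite DDB fD DDDD subr0.
have f1k H al I : (#|H| < k)%N -> f1 H al I = 0 by move=> Hk; rewrite /f1 gE // subrr.
have f10 H I : f1 H 0%MM I = 0.
  rewrite /f1 f0 sub0r /DD /kp kap_at0 mulr0 addr0 /bdt.
  by case: ifP; rewrite ?oppr0 // => _; rewrite bd0 ?oppr0.
(* Monomials of degree at most [q] form a finite type, which lets the choices for all of them be
   made at once. *)
have ex (x : 'X_{1..n < q.+1} * {set 'I_d}) : exists b : {set 'I_n} -> L,
   (forall H, b H != 0 -> [/\ H \in D, msupport x.1 :|: G \subset H, #|H| = k.+1,
       (k.+1 + #|x.2|)%N = t.+1 & (mdeg x.1 + #|x.2|)%N = q /\ val x.1 != 0%MM]) /\
   forall H, msupport x.1 :|: G \subset H -> #|H| = k -> bd b H = f1 H x.1 x.2.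
  case: x => al I /=.
  case: (boolP [&& msupport al :|: G \in D, val al != 0%MM, (k + #|I| == t)%N & (mdeg al + #|I| == q)%N]);
    last first.
    move=> no; exists (fun _ => 0); split=> [H|H sH Hk]; first by rewrite eqxx.
    rewrite bd0 //; apply/esym/eqP; apply: contraNT no => nz.
    have [HD _ E1 E2] := f1P _ _ _ nz.
    rewrite (good_closed gD HD sH) -{1}Hk E1 E2 !eqxx !andbT.
    by apply: contraNneq nz => ->; rewrite f10.
  case/and4P=> TD al0 /eqP E1 /eqP E2.
  pose c H := if #|H| == k then f1 H al I else 0.
  have [|||b [bP bE]] := good_exact gD (c := c) TD _ kd.
  (* Exactness is available only over a nonempty face; [al != 0] provides one, and this is why [f]
     has to vanish at the monomial 1. *)
  - apply: contraNneq al0 => T0; rewrite -msupport_eq0 -subset0 -T0; exact: subsetUl.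
  - move=> H; rewrite /c; case: (#|H| =P k) => [Hk /f1P[]//|_]; by rewrite eqxx.
  - move=> H sH; have [Hk|Hk] := eqVneq #|H|.+1 k; last first.
      by rewrite bd0 // => v vH; rewrite /c cardsU1 vH add1n (negbTE Hk).
    have := f1D H al I; rewrite /DD /bdt sH /kp kap0 ?mulr0 ?addr0 => [|a J]; last first.
      by apply: f1k; rewrite -Hk.
    by move=> <-; apply: bd_ext => v vH; rewrite /c cardsU1 vH add1n Hk eqxx.
  exists b; split=> [H /bP[HD sH Hk]|H sH Hk].
    by split=> //; rewrite addSn E1.
  by rewrite bE // /c Hk eqxx.
have [b bP] := fin_all_exists ex.
pose gk H al I := if insub al is Some al' then b (al' : 'X_{1..n < q.+1}, I) H else 0.
have gkE (al : 'X_{1..n}) (alq : (mdeg al < q.+1)%N) H I : gk H al I = b (BMultinom alq, I) H.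
  by rewrite /gk insubT.
have gkP : tchom t.+1 gk.
  move=> H al I; rewrite /gk; case: insubP => [al' _ <-|_]; last by rewrite eqxx.
  by case/(proj1 (bP (al', I))) => HD sH -> E [E2 _]; split.
exists (fun H al I => g H al I + gk H al I); split; first exact: homD.
  move=> H I; rewrite g0 add0r gkE ?mdeg0 // => alq.
  by apply/eqP; apply/negPn/negP => /(proj1 (bP _))[_ _ _ _ [_]]; rewrite eqxx.
move=> H al I Hk; rewrite DDD.
have K0 : kp gk H al I = 0.
  rewrite /kp kap0 ?mulr0 // => a J; rewrite /gk; case: insubP => // al' _ _.
  apply/eqP; apply/negPn/negP => /(proj1 (bP _))[_ _ E _ _].
  by move: Hk; rewrite E ltnn.
rewrite [DD gk _ _ _]/DD K0 addr0.
move: Hk; rewrite ltnS leq_eqVlt => /predU1P[Hk|Hk]; last first.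
  rewrite gE // /bdt bd0 ?if_same ?addr0 // => v vH; rewrite /gk.
  case: insubP => // al' _ _.
  apply/eqP; apply/negPn/negP => /(proj1 (bP _))[_ _ E _ _].
  by move: E Hk; rewrite cardsU1 vH add1n => -[->]; rewrite ltnn.
suff -> : bdt gk H al I = f1 H al I by rewrite /f1 addrC subrK.
rewrite /bdt; case: ifPn => sH; last first.
  by apply/esym/eqP; apply: contraNT sH => /f1P[].
have [qa|qa] := ltnP (mdeg al) q.+1.
  rewrite -(proj2 (bP (BMultinom qa, I)) H) //=.
  by apply: bd_eq => X; rewrite gkE.
rewrite bd0 => [|v vH]; last by rewrite /gk insubN // -leqNgt.
apply/esym/eqP/negPn/negP => /f1P[_ _ _ E]; move: qa; rewrite -E.
by rewrite ltnNge leq_addr.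
Qed.

End Total.

(** * The top degree of the Stanley-Reisner ring modulo parameters *)

Section Ideal.
Variables (n d : nat) (L : fieldType) (th : 'I_d -> {mpoly L[n]}).
Variable (D : {set {set 'I_n}}).
Hypothesis closed : forall F G : {set 'I_n}, F \in D -> G \subset F -> G \in D.
Implicit Types (p r : {mpoly L[n]}) (m : 'X_{1..n}).

Lemma inJD p r : inJ D th p -> inJ D th r -> inJ D th (p + r).
Proof.
case=> s sP [t tP]; exists (fun i => s i + t i) => m.
rewrite (eq_bigr (fun i => s i * th i + t i * th i)); last by move=> i _; rewrite mulrDl.
rewrite big_split opprD addrACA mcoeffD.
by have [->|/sP //] := eqVneq (p - \sum_(i < d) s i * th i)@_m 0; rewrite add0r => /tP.
Qed.

Lemma inJM p r : inJ D th p -> inJ D th (r * p).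
Proof.
case=> s sP; exists (fun i => r * s i) => m.
rewrite (eq_bigr (fun i => r * (s i * th i))); last by move=> i _; rewrite mulrA.
rewrite -mulr_sumr -mulrBr -mcoeff_msupp => /msuppM_le /allpairsP[[m1 m2] /= [_ h2 ->]].
move: h2; rewrite mcoeff_msupp => /sP; apply: contra; rewrite msupportD => /closed; apply.
exact: subsetUr.
Qed.

Lemma inJZ c p : inJ D th p -> inJ D th (c *: p).
Proof. by move=> Jp; rewrite -mul_mpolyC; apply: inJM. Qed.

Lemma inJN p : inJ D th p -> inJ D th (- p).
Proof. by move=> Jp; rewrite -scaleN1r; apply: inJZ. Qed.

Lemma inJ0 : inJ D th 0.
Proof.
exists (fun=> 0) => m; rewrite big1 ?subr0 ?mcoeff0 ?eqxx // => i _; exact: mul0r.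
Qed.

Lemma inJ_sum (J : Type) (s : seq J) (P : pred J) (F : J -> {mpoly L[n]}) :
  (forall j, P j -> inJ D th (F j)) -> inJ D th (\sum_(j <- s | P j) F j).
Proof. by move=> FJ; elim/big_ind: _ => //; [apply: inJ0 | apply: inJD]. Qed.

Lemma inJ_th i : inJ D th (th i).
Proof.
exists (fun j => (j == i)%:R) => m; rewrite (bigD1 i) //= eqxx mul1r big1 ?addr0.
  by rewrite subrr mcoeff0 eqxx.
by move=> j /negbTE ->; rewrite mul0r.
Qed.

Lemma inJ_nonface p : (forall m, p@_m != 0 -> msupport m \notin D) -> inJ D th p.
Proof. by move=> pP; exists (fun=> 0) => m; rewrite big1 ?subr0 => [/pP//|i _]; rewrite mul0r. Qed.

Lemma inJ_X m : msupport m \notin D -> inJ D th 'X_[m].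
Proof.
by move=> mD; apply: inJ_nonface => m'; rewrite mcoeffX; case: (m =P m') => [<-|_]; rewrite ?eqxx.
Qed.

End Ideal.

Section SquareFree.
Variable n : nat.
Implicit Types (A B : {set 'I_n}) (m : 'X_{1..n}).

Definition mset A : 'X_{1..n} := [multinom (i \in A : nat) | i < n].

Lemma msetE A i : mset A i = (i \in A). Proof. exact: mnmE. Qed.
Lemma msupport_mset A : msupport (mset A) = A.
Proof. by apply/setP => i; rewrite inE msetE eqb0 negbK. Qed.
Lemma mdeg_mset A : mdeg (mset A) = #|A|.
Proof. by rewrite mdegE -sum1_card [RHS]big_mkcond; apply: eq_bigr => i _; rewrite msetE; case: (i \in A). Qed.
Lemma msetU1 h A : h \notin A -> mset (h |: A) = (mset A + U_(h))%MM.
Proof.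
move=> hA; apply/mnmP => i; rewrite mnmDE !msetE mnm1E !inE eq_sym.
by case: eqVneq => [<-|_] /=; rewrite ?(negbTE hA) ?addn0.
Qed.
Lemma mset_prod (L : fieldType) A : \prod_(j in A) 'X_j = 'X_[mset A] :> {mpoly L[n]}.
Proof.
rewrite mprodXE; congr mpolyX; apply/mnmP => i; rewrite mnm_sumE msetE.
rewrite (eq_bigr (fun j => (j == i) : nat)); last by move=> j _; rewrite mnm1E.
case: (boolP (i \in A)) => iA.
  by rewrite (bigD1 i) //= eqxx big1 // => j /andP[_ /negbTE ->].
by rewrite big1 // => j jA; case: (j =P i) jA => // ->; rewrite (negbTE iA).
Qed.
Lemma mset_supp m : (forall i, (m i <= 1)%N) -> mset (msupport m) = m.
Proof.
by move=> m1; apply/mnmP => i; rewrite msetE inE; case: (m i) (m1 i) => [|[]].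
Qed.
Lemma card_msupport m : (#|msupport m| <= mdeg m)%N.
Proof.
rewrite mdegE -sum1_card big_mkcond; apply: leq_sum => i _.
by rewrite inE; case: (m i).
Qed.
End SquareFree.

(** * Purity, ridges and strong connectedness of stars *)

Section Facets.
Variables (n d : nat) (L : fieldType).
Variables (D : {set {set 'I_n}}) (e : {set 'I_n} -> L) (gD : good d D e) (d2 : (1 < d)%N).
Implicit Types (H T F G : {set 'I_n}).

(** The chain concentrated at a nonempty face [H] has no boundary among the faces containing [H].
    Below dimension [d - 1] it is therefore a boundary there, so [H] has a coface. *)
Lemma pure H : H \in D -> exists F, [/\ F \in D, #|F| = d & H \subset F].
Proof.
have [F0 [F0D F0d]] := good_facet gD.
elim: {H}(d - #|H|)%N {-2}H (erefl (d - #|H|)%N) => [|k IH] H Hk HD.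
  exists H; split=> //; apply/eqP; rewrite eqn_leq (good_dim gD HD) -subn_eq0.
  by rewrite Hk.
have [H0|H0] := eqVneq H set0; first by exists F0; split=> //; rewrite H0 sub0set.
have Hd : (#|H| < d)%N by rewrite -subn_gt0 Hk.
have [||b [bP bE]] := good_exact gD (c := fun X => (X == H)%:R) HD H0 Hd.
- by move=> X; case: (X =P H) => [->|_]; rewrite ?subxx // eqxx.
- move=> X HX; rewrite bd0 // => v vX.
  case: eqP => // E; move: vX; rewrite (subsetP HX) // -E setU11 //.
have : bd b H != 0 by rewrite bE // eqxx oner_eq0.
case/bd_nz => v vH /bP[vD _ _].
have [|F [FD Fd sF]] := IH (v |: H) _ vD; first by rewrite cardsU1 vH add1n subnS Hk.
by exists F; split=> //; apply: subset_trans sF; apply: subsetUr.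
Qed.

(** Two facets through [H], weighted with opposite induced signs, form a cycle in the star of [H].
    It must be a multiple of [e], which does not vanish on a third facet. *)
Lemma two_facets H v1 v2 v3 : #|H| = d.-1 ->
  v1 \notin H -> v2 \notin H -> v3 \notin H ->
  v1 |: H \in D -> v2 |: H \in D -> v3 |: H \in D ->
  [|| v1 == v2, v1 == v3 | v2 == v3].
Proof.
move=> Hd h1 h2 h3 D1 D2 D3; apply/negPn; rewrite !negb_or; apply/negP.
case/and3P=> n12 n13 n23.
have HD : H \in D by apply: good_closed gD _ _ D1 (subsetUr _ _).
have H0 : H != set0 by rewrite -card_gt0 Hd -subn1 subn_gt0.
have inj v w : v \notin H -> w \notin H -> (v |: H == w |: H) = (v == w).
  move=> vH wH; apply/eqP/eqP => [/setP/(_ v)|->//]; rewrite !inE eqxx (negbTE vH) !orbF /=.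
  by move=> /esym/eqP. 
pose c X : L := (X == v1 |: H)%:R * (-1) ^+ sg v1 H - (X == v2 |: H)%:R * (-1) ^+ sg v2 H.
have cd v : v \notin H -> #|v |: H| = d.
  by move=> vH; rewrite cardsU1 vH Hd add1n prednK // ltnW.
have [||a aE] := good_top gD (c := c) HD H0.
- move=> X; rewrite /c; case: (X =P v1 |: H) => [->|_]; first by rewrite subsetUr cd.
  case: (X =P v2 |: H) => [->|_]; first by rewrite subsetUr cd.
  by rewrite !mul0r subrr eqxx.
- move=> X HX; have [XH|XH] := eqVneq X H.
    rewrite XH /bd (bigD1 v1) //= (bigD1 v2) 1?eq_sym //= big1 => [|v /andP[vv1 vv2]].
      rewrite /io (negbTE h1) (negbTE h2) /c !eqxx !inj // (negbTE n12) eq_sym (negbTE n12).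
      by rewrite !mul1r !mul0r subr0 sub0r mulrN -!expr2 !sqrr_sign addr0 addrN.
    rewrite /io; case: ifPn => // vH; rewrite /c !inj // (negbTE vv1) (negbTE vv2).
    by rewrite !mul0r subrr mulr0.
  rewrite bd0 // => v vX; rewrite /c.
  have E w : (v |: X == w |: H) = false.
    apply/negP => /eqP E.
    have : (#|X| < #|v |: X|)%N by rewrite cardsU1 vX.
    have /proper_card : H \proper X by rewrite properEneq eq_sym XH.
    rewrite E cardsU1; case: (w \in H) => /=; rewrite ?add0n ?add1n ?ltnS.
      by move=> /ltn_trans lt /lt; rewrite ltnn.
    by move=> lt /(leq_trans lt); rewrite ltnn.
  by rewrite !E !mul0r subrr.
have := aE (v3 |: H) (subsetUr _ _); rewrite /c !inj // !(eq_sym v3) (negbTE n13) (negbTE n23).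
rewrite !mul0r subrr => /esym/eqP; rewrite mulf_eq0.
have := good_e gD (v3 |: H); rewrite D3 cd // eqxx => /negbTE -> /=; rewrite orbF => /eqP a0.
have := aE (v1 |: H) (subsetUr _ _); rewrite /c !inj // eqxx (negbTE n12) a0 mul0r.
by rewrite mul1r mul0r subr0 => /eqP; rewrite signr_eq0.
Qed.

Definition adjF G := [rel F F' : {set 'I_n} | [&& F \in D, F' \in D, #|F| == d, #|F'| == d,
   G \subset F :&: F' & #|F :&: F'| == d.-1]].

(** Cutting [e] down to the facets reachable from [F0] leaves a cycle in the star of [T], because
    the facets around a ridge are reachable together. Uniqueness of the top class makes it all of
    [e] there, or nothing. *)
Lemma facet_reach_star G T F1 F2 F0 : T \in D -> T != set0 -> G \subset T ->
  F1 \in D -> #|F1| = d -> T \subset F1 -> F2 \in D -> #|F2| = d -> T \subset F2 ->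
  connect (adjF G) F0 F1 -> connect (adjF G) F0 F2.
Proof.
move=> TD T0 GT D1 c1 T1 D2 c2 T2 con.
pose c X := if connect (adjF G) F0 X && (T \subset X) then e X else 0.
have [||a aE] := good_top gD (c := c) TD T0.
- move=> X; rewrite /c; case: ifP => [/andP[_ ->]|_]; last by rewrite eqxx.
  by rewrite (good_e gD) => /andP[-> /eqP].
- move=> H TH.
  have [/existsP[v /and3P[vH eH vc]]|] := boolP [exists v, [&& v \notin H, e (v |: H) != 0 &
      connect (adjF G) F0 (v |: H)]]; last first.
    rewrite negb_exists => /forallP no; rewrite bd0 // => v vH; rewrite /c.
    case: ifP => // /andP[cv _]; have := no v; rewrite vH cv andbT /= negbK => /eqP //.
  rewrite -[RHS](good_cycle gD H); apply: bd_ext => w wH; rewrite /c.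
  rewrite (subset_trans TH (subsetUr _ _)) andbT; case: ifPn => // nc.
  apply/esym/eqP; apply: contraNT nc; rewrite (good_e gD) => /andP[wD /eqP wd].
  move: eH; rewrite (good_e gD) => /andP[vD /eqP vd].
  have [<-//|vw] := eqVneq v w.
  apply: connect_trans vc (connect1 _); rewrite /= vD wD vd wd !eqxx /=.
  have -> : (v |: H) :&: (w |: H) = H.
    apply/setP => x; rewrite !inE; case: (eqVneq x v) => [->|] /=; last first.
      by case: (x == w); case: (x \in H).
    by rewrite (negbTE vw) (negbTE vH).
  rewrite (subset_trans GT TH) /=; apply/eqP.
  by move: vd; rewrite cardsU1 vH add1n => <-.
have e1 : e F1 != 0 by rewrite (good_e gD) D1 c1 eqxx.
have := aE F1 T1; rewrite /c con T1 /= => a1.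
have {a1} a1 : a = 1 by apply: (mulIf e1); rewrite mul1r.
have := aE F2 T2; rewrite /c T2 andbT a1 mul1r; case: ifP => // _ /esym/eqP.
by rewrite -[_ == 0]negbK (good_e gD) D2 c2 eqxx.
Qed.

(** For nonempty [G] the star of [G] itself serves. For empty [G] one moves between stars of
    vertices: an edge lies in a facet, which belongs to the stars of both its ends. *)
Lemma facet_reach G F1 F2 : F1 \in D -> #|F1| = d -> G \subset F1 ->
  F2 \in D -> #|F2| = d -> G \subset F2 -> connect (adjF G) F1 F2.
Proof.
move=> D1 c1 s1 D2 c2 s2.
have [G0|G0] := eqVneq G set0; last first.
  by apply: (facet_reach_star (T := G) (F1 := F1)) => //; exact: good_closed gD _ _ D1 s1.
have vert F x : F \in D -> x \in F -> [set x] \in D.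
  by move=> FD xF; apply: good_closed gD _ _ FD _; rewrite sub1set.
pose P x := [exists F, [&& F \in D, #|F| == d, x \in F & connect (adjF G) F1 F]].
have PF x F : P x -> F \in D -> #|F| = d -> x \in F -> connect (adjF G) F1 F.
  case/existsP => F' /and4P[D' /eqP d' x' c'] FD Fd xF.
  apply: (facet_reach_star (T := [set x]) (F1 := F')); rewrite ?sub1set //.
  - exact: vert xF.
  - by apply/set0Pn; exists x; rewrite inE.
  - by rewrite G0 sub0set.
have ne F : #|F| = d -> exists x, x \in F.
  by move=> Fd; apply/set0Pn; rewrite -card_gt0 Fd ltnW.
have [x xF] := ne F1 c1; have [y yF] := ne F2 c2.
apply: (PF y) => //.
apply: (good_conn gD (P := P) _ (x := x)); last first.
  by apply/existsP; exists F1; rewrite D1 c1 eqxx xF /= connect0.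
move=> a b abD Pa; have [F [FD Fd]] := pure abD.
rewrite subUset !sub1set => /andP[aF bF].
by apply/existsP; exists F; rewrite FD Fd eqxx bF /=; apply: PF aF.
Qed.

End Facets.

Definition linsys n d (L : fieldType) (mu : 'I_n -> 'I_d -> L) (i : 'I_d) : {mpoly L[n]} :=
  \sum_(j < n) mu j i *: 'X_j.

Definition lsop n d (L : fieldType) (D : {set {set 'I_n}}) (mu : 'I_n -> 'I_d -> L) :=
  forall H, H \in D -> exists lam : 'I_n -> 'I_d -> L,
  forall h h', h \in H -> h' \in H -> \sum_i mu h i * lam h' i = (h == h')%:R.

(** * Generation of the top degree by one facet monomial *)

Section TopDegree.
Variables (n d : nat) (L : fieldType) (D : {set {set 'I_n}}) (e : {set 'I_n} -> L).
Hypotheses (gD : good d D e) (d2 : (1 < d)%N).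
Variable mu : 'I_n -> 'I_d -> L.
Hypothesis indep : lsop D mu.
Implicit Types (H T F G : {set 'I_n}) (be ga : 'X_{1..n}).
Local Notation th := (linsys mu).

(** The closed star of [G]. Multiplication by [x_G] sends its ideal into that of [D] ([star_inJ]),
    so degrees of multiples of [x_G] can be computed in the star. *)
Definition star_cx G := [set H | H :|: G \in D].

Lemma star_cx_closed G F H : F \in star_cx G -> H \subset F -> H \in star_cx G.
Proof. by rewrite !inE => FD HF; apply: good_closed gD _ _ FD _; apply: setSU. Qed.

Lemma linsysM ga (lam : 'I_d -> L) :
  'X_[ga] * (\sum_i lam i *: th i) = \sum_j (\sum_i mu j i * lam i) *: 'X_[ga + U_(j)].
Proof.
rewrite /linsys; under eq_bigr => i _ do rewrite scaler_sumr.
rewrite exchange_big mulr_sumr; apply: eq_bigr => j _ /=.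
rewrite (eq_bigr (fun i => (mu j i * lam i) *: 'X_j)); last first.
  by move=> i _; rewrite scalerA mulrC.
by rewrite -scaler_suml -scalerAr -mpolyXD.
Qed.

(** The combination of the parameters dual to [v] on the face [T] has coefficient 1 at [x_v] and 0
    at the other vertices of [T], so [x_v] can be traded for variables outside [T]. *)
Lemma rewrite_vertex G ga T v : T \in D -> v \in T ->
  exists c : 'I_n -> L, inJ (star_cx G) th
    ('X_[ga + U_(v)] + \sum_(j | j \notin T) c j *: 'X_[ga + U_(j)]).
Proof.
move=> TD vT; have [lam dual] := indep TD.
exists (fun j => \sum_i mu j i * lam v i).
suff -> : 'X_[ga + U_(v)] + \sum_(j | j \notin T) (\sum_i mu j i * lam v i) *: 'X_[ga + U_(j)] =
    'X_[ga] * (\sum_i lam v i *: th i).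
  apply: inJM; first exact: star_cx_closed.
  by apply: inJ_sum => i _; apply: inJZ; [exact: star_cx_closed|apply: inJ_th].
rewrite linsysM [RHS](bigID (fun j => j \in T)) /=; congr (_ + _).
rewrite (bigD1 v) //= dual // eqxx scale1r big1 ?addr0 // => j /andP[jT jv].
by rewrite dual // (negbTE jv) scale0r.
Qed.

Section OneDim.
Variables (G F0 : {set 'I_n}) (F0D : F0 \in D) (F0d : #|F0| = d) (GF0 : G \subset F0).
Local Notation W p := (exists c, inJ (star_cx G) th (p - c *: 'X_[mset (F0 :\: G)])).

Lemma top_lin c p r : W p -> W r -> W (c *: p + r).
Proof.
case=> a pa [b rb]; exists (c * a + b).
rewrite scalerDl opprD addrACA -scalerA -scalerBr.
by apply: inJD => //; apply: inJZ => //; apply: star_cx_closed.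
Qed.

Lemma top_mod p r : inJ (star_cx G) th (p - r) -> W r -> W p.
Proof.
move=> pr [c rc]; exists c; rewrite -(subrK r p) -addrA.
exact: inJD.
Qed.

Lemma top_J p : inJ (star_cx G) th p -> W p.
Proof. by move=> pJ; exists 0; rewrite scale0r subr0. Qed.

Lemma top_sum (J : Type) (s : seq J) (P : pred J) (c : J -> L) (F : J -> {mpoly L[n]}) :
  (forall j, P j -> W (F j)) -> W (\sum_(j <- s | P j) c j *: F j).
Proof.
move=> FW; elim/big_rec: _ => [|j p Pj Wp]; last by apply: top_lin => //; apply: FW.
by apply: top_J; apply: inJ0.
Qed.

(** Induction along a path of adjacent facets: across a ridge [H] the relation that eliminates [x_v]
    leaves a single other facet, since a ridge has at most two cofaces. *)
Lemma top_facet F : F \in D -> #|F| = d -> G \subset F -> W 'X_[mset (F :\: G)].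
Proof.
move=> FD Fd GF.
have /connectP[s] := facet_reach gD d2 F0D F0d GF0 FD Fd GF.
elim/last_ind: s F FD Fd GF => [|s F' IH] F FD Fd GF.
  move=> _ ->; exists 1; rewrite scale1r subrr; exact: inJ0.
rewrite rcons_path last_rcons => /andP[ps /and5P[D1 D2 /eqP c1 /eqP c2 /andP[GI /eqP cI]]] FE.
subst F'; set F1 := last F0 s in D1 c1 GI cI.
have {IH} IH : W 'X_[mset (F1 :\: G)].
  by apply: IH => //; apply: subset_trans GI (subsetIl _ _).
set H := F1 :&: F in GI cI.
have dS : d.-1.+1 = d by rewrite prednK // ltnW.
have /cards1P[v vE] : #|F :\: H| == 1%N.
  rewrite cardsD (setIidPr _) ?subsetIr // c2 cI -{1}dS subSn // subnn //.
have /cards1P[w wE] : #|F1 :\: H| == 1%N.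
  rewrite cardsD (setIidPr _) ?subsetIl // c1 cI -{1}dS subSn // subnn //.
have FE : F = v |: H by rewrite -vE setUC -{1}(setID F H) (setIidPr _) // subsetIr.
have FE1 : F1 = w |: H by rewrite -wE setUC -{1}(setID F1 H) (setIidPr _) // subsetIl.
have vH : v \notin H by have : v \in F :\: H by [rewrite vE inE]; rewrite inE => /andP[].
have wH : w \notin H by have : w \in F1 :\: H by [rewrite wE inE]; rewrite inE => /andP[].
have vF : v \in F by rewrite FE setU11.
have vG : v \notin G by apply: contraNN vH; apply: subsetP.
have wG : w \notin G by apply: contraNN wH; apply: subsetP.
have DE x : x \notin H -> x \notin G -> mset ((x |: H) :\: G) = (mset (H :\: G) + U_(x))%MM.
  move=> xH xG; have -> : (x |: H) :\: G = x |: (H :\: G).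
    by apply/setP => y; rewrite !inE; case: (y =P x) => [->|]; rewrite ?xG.
  by rewrite msetU1 // inE negb_and xH orbT.
have [c cP] := rewrite_vertex G (mset (H :\: G)) FD vF.
rewrite FE DE //; apply: (top_mod (r := - c w *: 'X_[mset (F1 :\: G)])); last first.
  by rewrite -[_ *: _]addr0; apply: top_lin => //; apply: top_J; apply: inJ0.
have wv : w != v.
  apply/eqP => wv; have FF : F1 = F by rewrite FE1 wv -FE.
  have HF : H = F by rewrite /H FF setIid.
  by move: dS; rewrite -cI HF c2 => /eqP; rewrite eqn_leq ltnn.
clearbody H F1.
have wF : w \notin F by rewrite FE !inE negb_or wH wv.
move: cP; rewrite FE1 DE // (bigD1 w) //= addrA => cP.
rewrite scaleNr opprK -[X in inJ _ _ X](addrK (\sum_(i | (i \notin F) && (i != w))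
  c i *: 'X_[(mset (H :\: G) + U_(i))%MM])).
apply: inJD cP _; apply: inJN; first exact: star_cx_closed.
apply: inJ_sum => j /andP[jF jw]; apply: inJZ; first exact: star_cx_closed.
apply: inJ_X; rewrite msupportD msupport_mset msupport1 inE.
have -> : H :\: G :|: [set j] :|: G = j |: H.
  apply/setP => x; rewrite !inE; have := subsetP (subset_trans GI (subxx H)) x.
  by case: (x \in G) => [->//|_]; rewrite ?orbT ?orbF //= orbC.
move: jF; rewrite FE !inE negb_or => /andP[jv jH].
apply/negP => jD; have := two_facets gD d2 cI vH wH jH.
rewrite -FE -FE1 => /(_ FD D1 jD); rewrite eq_sym (negbTE wv) /=.
by rewrite eq_sym (negbTE jv) /= eq_sym (negbTE jw).
Qed.

(** A monomial that has a repeated vertex or meets [G] is rewritten into monomials whose support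
    together with [G] is strictly larger; this ends at facets and at non-faces. *)
Lemma one_dim_X q be : (#|G| + q)%N = d -> mdeg be = q -> W 'X_[be].
Proof.
move=> Gq; elim: {be}_.+1 {-2}be (ltnSn (n - #|msupport be :|: G|)) => // k IH be Hk bq.
set T := msupport be :|: G in Hk *.
have [TD|TD] := boolP (T \in D); last by apply: top_J; apply: inJ_X; rewrite inE.
have [/existsP[v /andP[v0 vP]]|] :=
   boolP [exists v, (0 < be v)%N && ((1 < be v)%N || (v \in G))]; last first.
  rewrite negb_exists => /forallP sqf.
  have b1 i : (be i <= 1)%N.
    by have := sqf i; case: posnP => [->//|_] /=; rewrite negb_or -leqNgt => /andP[].
  have bG i : i \in G -> be i = 0%N.
    by move=> iG; have := sqf i; case: posnP => [->//|_] /=; rewrite iG orbT.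
  have <- : mset (T :\: G) = be.
    rewrite -[RHS](mset_supp b1); congr mset; apply/setP => i; rewrite !inE.
    by case: (boolP (i \in G)) => [/bG ->|] //=; rewrite orbF.
  apply: top_facet; rewrite ?subsetUr //.
  rewrite -Gq addnC cardsU (_ : _ :&: _ = set0) ?cards0 ?subn0.
    by rewrite -bq -[in RHS](mset_supp b1) mdeg_mset.
  by apply/setP => i; rewrite !inE andbC; case: (boolP (i \in G)) => // /bG ->.
have vT : v \in T by rewrite !inE -lt0n v0.
pose ga := (be - U_(v))%MM.
have beE : be = (ga + U_(v))%MM by rewrite /ga msubK.
have [c cP] := rewrite_vertex G ga TD vT.
rewrite beE; apply: (top_mod (r := - \sum_(j | j \notin T) c j *: 'X_[(ga + U_(j))%MM])).
  by rewrite opprK.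
rewrite -sumrN (eq_bigr (fun j => (- c j) *: 'X_[(ga + U_(j))%MM])); last by move=> j _; rewrite scaleNr.
apply: top_sum => j jT.
have sT : msupport ga :|: G = T.
  apply/setP => x; rewrite /T beE !inE mnmDE mnm1E; case: (v =P x) => [<-|]; last by rewrite addn0.
  rewrite addn1 /= /ga mnmBE mnm1E eqxx.
  by case/orP: vP => [|->]; rewrite ?orbT // -subn_gt0 lt0n => ->.
apply: IH.
  rewrite msupportD msupport1 setUAC sT setUC cardsU1 jT add1n.
  have : (#|T| < n)%N.
    by rewrite -[X in (_ < X)%N](card_ord n) -cardsT proper_card // properT; apply: contraNneq jT => ->; rewrite inE.
  by move: Hk; rewrite ltnS; move: #|T| => t Hk tn; apply: leq_trans Hk; rewrite subnS prednK ?subn_gt0.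
by rewrite mdegD mdeg1 -bq beE mdegD mdeg1.
Qed.

Lemma one_dim q p : (#|G| + q)%N = d -> is_homog q p -> W p.
Proof.
move=> Gq hp; rewrite (mpolyE p) big_seq; apply: top_sum => m.
by rewrite mcoeff_msupp => /hp; apply: one_dim_X.
Qed.

End OneDim.

(** A degree map given by its values on monomials. On facets it is merely nonzero, so that scaled
    and specialized degree maps are objects of the same kind. *)
Definition degcond (dg : 'X_{1..n} -> L) := [/\
  forall be i, (mdeg be).+1 = d -> \sum_j mu j i * dg (be + U_(j))%MM = 0,
  forall al, mdeg al = d -> msupport al \notin D -> dg al = 0 &
  forall F, F \in D -> #|F| = d -> dg (mset F) != 0].

Variable dg : 'X_{1..n} -> L.
Hypothesis dgP : degcond dg.

Definition dgp (p : {mpoly L[n]}) : L :=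
  \sum_(m : 'X_{1..n < d.+1} | mdeg m == d) p@_m * dg m.

Lemma dgpD p r : dgp (p + r) = dgp p + dgp r.
Proof. by rewrite -big_split; apply: eq_bigr => m _; rewrite mcoeffD mulrDl. Qed.
Lemma dgpZ c p : dgp (c *: p) = c * dgp p.
Proof. by rewrite mulr_sumr; apply: eq_bigr => m _; rewrite mcoeffZ mulrA. Qed.
Lemma dgp0 : dgp 0 = 0.
Proof. by rewrite /dgp big1 // => m _; rewrite mcoeff0 mul0r. Qed.
Lemma dgpB p r : dgp (p - r) = dgp p - dgp r.
Proof. by rewrite -scaleN1r dgpD dgpZ mulN1r. Qed.
Lemma dgp_sum (J : Type) (s : seq J) (P : pred J) (F : J -> {mpoly L[n]}) :
  dgp (\sum_(j <- s | P j) F j) = \sum_(j <- s | P j) dgp (F j).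
Proof. exact: (big_morph dgp dgpD dgp0). Qed.

Lemma dgpX m : dgp 'X_[m] = if mdeg m == d then dg m else 0.
Proof.
case: (mdeg m =P d) => md; last first.
  rewrite /dgp big1 // => m' /eqP m'd; rewrite mcoeffX; case: (m =P m') => [E|]; last by rewrite mul0r.
  by case: md; rewrite E.
have md' : (mdeg m < d.+1)%N by rewrite md.
rewrite /dgp (bigD1 (BMultinom md')) /= ?md // mcoeffX eqxx mul1r big1 ?addr0 // => m' /andP[_ m'm].
by rewrite mcoeffX; move: m'm; rewrite -val_eqE eq_sym /= => /negbTE ->; rewrite mul0r.
Qed.

Lemma dgp_inJ p : inJ D th p -> dgp p = 0.
Proof.
case=> s sP; rewrite -(subrK (\sum_i s i * th i) p) dgpD.
rewrite [X in X + _](_ : _ = 0) ?add0r; last first.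
  rewrite /dgp big1 // => m /eqP md.
  have [->|/sP mD] := eqVneq (p - \sum_i s i * th i)@_m 0; first by rewrite mul0r.
  by have [_ -> //] := dgP; rewrite mulr0.
rewrite dgp_sum big1 // => i _; rewrite {1}(mpolyE (s i)) mulr_suml dgp_sum big1 // => m _.
have -> : (s i)@_m *: 'X_[m] * th i = (s i)@_m *: \sum_j mu j i *: 'X_[m + U_(j)].
  rewrite -scalerAl /linsys mulr_sumr; congr (_ *: _); apply: eq_bigr => j _.
  by rewrite -scalerAr -mpolyXD.
rewrite dgpZ dgp_sum (eq_bigr (fun j => mu j i *
   (if (mdeg m).+1 == d then dg (m + U_(j))%MM else 0))); last first.
  by move=> j _; rewrite dgpZ dgpX mdegD mdeg1 addn1.
have [md|md] := eqVneq (mdeg m).+1 d; last by rewrite big1 ?mulr0 // => j _; rewrite mulr0.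
by have [-> //] := dgP; rewrite mulr0.
Qed.

Lemma star_cx0 : star_cx set0 = D.
Proof. by apply/setP => H; rewrite inE setU0. Qed.

(** Modulo the ideal, [p] is a multiple of one facet monomial, whose degree is nonzero. *)
Lemma inJ_dgp p : is_homog d p -> inJ D th p <-> dgp p = 0.
Proof.
move=> hp; split; first exact: dgp_inJ.
have [F0 [F0D F0d]] := good_facet gD.
have [|c] := one_dim F0D F0d (sub0set _) (q := d) (p := p) _ hp; first by rewrite cards0.
rewrite star_cx0 setD0 => Jp p0; have := dgp_inJ Jp.
rewrite dgpB p0 dgpZ dgpX mdeg_mset F0d eqxx sub0r => /eqP; rewrite oppr_eq0 mulf_eq0.
have [_ _ /(_ _ F0D F0d)/negbTE ->] := dgP; rewrite orbF => /eqP c0.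
by move: Jp; rewrite c0 scale0r subr0.
Qed.

End TopDegree.

(** * The rank of the degree pairing *)

Section Zigzag.
Variables (n d : nat) (L : fieldType) (D : {set {set 'I_n}}) (e : {set 'I_n} -> L).
Hypotheses (gD : good d D e) (d2 : (1 < d)%N).
Variable mu : 'I_n -> 'I_d -> L.
Hypothesis indep : lsop D mu.
Variable q : nat.
Hypothesis q0 : (0 < q)%N.
Implicit Types (G H T F : {set 'I_n}) (al : 'X_{1..n}) (I : {set 'I_d}) (p r : {mpoly L[n]})
  (u s : {set 'I_n} -> {set 'I_d} -> L).
Local Notation th := (linsys mu).

(** The cycle [e * p]: for each monomial of [p], the orientation class on the facets through its
    support. Both differentials kill it. *)
Definition epsp G p H al I : L :=
  if (I == set0) && (msupport al :|: G \subset H) then e H * p@_al else 0.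

Definition at0 u H al I : L := if al == 0%MM then u H I else 0.

(* [zig G p u]: the class of u and that of e * p agree in the total complex of
   the star of G; then u computes the values deg (p * x_H). *)
Definition zig G p u := exists g, tchom D G q d.+1 g /\
  forall H al I, at0 u H al I - epsp G p H al I = DD mu G g H al I.

Lemma epsp_hom G p : is_homog q p -> tchom D G q d (epsp G p).
Proof.
move=> hp H al I; rewrite /epsp; case: ifP => [/andP[/eqP -> sH]|_]; last by rewrite eqxx.
rewrite mulf_eq0 negb_or (good_e gD) => /andP[/andP[HD /eqP Hd] /hp <-].
by rewrite cards0 Hd !addn0.
Qed.

Lemma bdt_epsp G p H al I : bdt G (epsp G p) H al I = 0.
Proof.
rewrite /bdt; case: ifP => // sH.
have [I0|I0] := eqVneq I set0; last by rewrite bd0 // => v vH; rewrite /epsp (negbTE I0).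
rewrite -[RHS](mulr0 p@_al) -(good_cycle gD H) -bdZ; apply: bd_ext => v vH.
by rewrite /epsp I0 eqxx (subset_trans sH (subsetUr _ _)) mulrC.
Qed.

Lemma kp_epsp G p H al I : kp mu (epsp G p) H al I = 0.
Proof.
rewrite /kp /kap big1 ?mulr0 // => h _; rewrite /ioV big1 // => i _.
rewrite /io; case: ifP => iI; rewrite ?mulr0 // /xs; case: ifP => _; rewrite ?mulr0 // /epsp.
rewrite (_ : (i |: I == set0) = false) ?mulr0 //.
by apply/negbTE/set0Pn; exists i; rewrite setU11.
Qed.

Lemma DD_epsp G p H al I : DD mu G (epsp G p) H al I = 0.
Proof. by rewrite /DD bdt_epsp kp_epsp addr0. Qed.

Lemma kap_at0U u H al I : kap mu H (at0 u H) al I =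
  \sum_(h in H) (al == U_(h)%MM)%:R * ioV (mu h) (u H) I.
Proof.
apply: eq_bigr => h hH; case: (al =P U_(h)%MM) => [->|no].
  rewrite mul1r; apply: ioV_eq => J; rewrite /xs /at0 mnm1E eqxx /=.
  suff -> : (U_(h) - U_(h) == 0 :> 'X_{1..n})%MM by [].
  by apply/eqP/mnmP => i; rewrite mnmBE subnn mnm0E.
rewrite mul0r; apply: ioV0 => J; rewrite /xs; case: ifP => // ah; rewrite /at0.
case: eqP => // E; case: no; by rewrite -(msubK ah) E add0m.
Qed.

Lemma zig_lin G c p r u s : zig G p u -> zig G r s ->
  zig G (c *: p + r) (fun H I => c * u H I + s H I).
Proof.
case=> g [gP gE] [g' [gP' gE']].
exists (fun H al I => c * g H al I + g' H al I); split.
  by apply: homD => //; apply: homZ.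
move=> H al I; rewrite (DDD mu G (fun H al I => c * g H al I) g') DDZ -gE -gE'.
rewrite /at0 /epsp mcoeffD mcoeffZ; by case: eqP => _; case: ifP => _; ring.
Qed.

Lemma zig_eq G p u s : (forall H I, u H I = s H I) -> zig G p u -> zig G p s.
Proof. by move=> us [g [gP gE]]; exists g; split=> // H al I; rewrite -gE /at0 us. Qed.

Definition top_supp G u := forall H I, u H I != 0 ->
  [/\ H \in D, G \subset H, (#|H| + q)%N = d & #|I| = q].

Lemma zig_supp G p u : is_homog q p -> zig G p u -> top_supp G u.
Proof.
move=> hp [g [gP gE]] H I nz.
have := gE H 0%MM I; rewrite /at0 eqxx.
have -> : epsp G p H 0%MM I = 0.
  rewrite /epsp; case: ifP => // _; apply/eqP; rewrite mulf_eq0; apply/orP; right.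
  by apply: contraLR q0 => /hp <-; rewrite mdeg0.
rewrite subr0 => E; move: nz; rewrite E.
case/(hom_DD gD gP) => HD; rewrite msupport0 set0U mdeg0 add0n => GH Hd Iq.
by split=> //; rewrite -Iq.
Qed.

(** If [u] bounds, Koszul exactness moves the bounding chain to the monomial 1. There its value at
    [H] has degree [q] and is killed by [#|H| = d + 1 - q] independent contractions, too many for a
    nonzero form in [d] variables. *)
Lemma zig_uniq G u : zig G 0 u -> forall H I, u H I = 0.
Proof.
move=> zu; have hom0 : is_homog q (0 : {mpoly L[n]}) by move=> m; rewrite mcoeff0 eqxx.
case: zu => g [gP gE].
have gE' H al I : at0 u H al I = DD mu G g H al I.
  by rewrite -gE /epsp mcoeff0 mulr0 if_same subr0.
have [|g' [gP' g'E]] := eliminate_down gD indep gP.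
  by move=> H al I a0; rewrite -gE' /at0 (negbTE a0).
pose s H al I := g H al I - DD mu G g' H al I.
have sP : tchom D G q d.+1 s by apply: homB => //; exact: (hom_DD (e:=e)).
have s0 H al I : al != 0%MM -> s H al I = 0 by move=> a0; rewrite /s g'E // subrr.
have sE H al I : DD mu G s H al I = at0 u H al I by rewrite DDB DDDD subr0 gE'.
have sz H I : s H 0%MM I = 0.
  have [HD|HD] := boolP (H \in D); last first.
    by apply/eqP; apply: contraNT HD => /sP[].
  have [Hq|Hq] := eqVneq (#|H| + q)%N d.+1; last first.
    by apply/eqP; apply: contraNT Hq => /sP[_ _ E]; rewrite mdeg0 add0n => <-; rewrite E.
  have [lam dual] := indep HD.
  apply: (ioV_kill (mu := mu) (lam := lam) (A := H) (m := q)) => //.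
  - by move=> J /sP[_ _ _]; rewrite mdeg0.
  - move=> h hH J; have := sE H U_(h)%MM J.
    rewrite /at0 mnm1_eq0 /DD /bdt bd0 ?if_same ?add0r; last by move=> v vH; rewrite s0 ?mnm1_eq0.
    rewrite /kp (kap_eq _ _ _ (t := at0 (fun H => s H 0%MM) H)).
      rewrite kap_at0U (bigD1 h) //= eqxx mul1r big1 ?addr0.
        by move=> /eqP; rewrite mulf_eq0 signr_eq0 => /eqP.
      by move=> h' /andP[_ h'h]; rewrite eq_mnm1 eq_sym (negbTE h'h) mul0r.
    by move=> a J'; rewrite /at0; case: eqP => [->//|/eqP /s0].
  by rewrite Hq.
move=> H I; have := sE H 0%MM I; rewrite /at0 eqxx => <-.
rewrite /DD /bdt bd0; last by move=> v _; rewrite sz.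
by rewrite if_same add0r /kp kap_at0 mulr0.
Qed.

Lemma mcoeffMU p h al : (p * 'X_h)@_al = if (0 < al h)%N then p@_(al - U_(h)) else 0.
Proof.
case: ifP => ah; first by rewrite -{1}(msubK ah) addmC mcoeffMX.
apply/eqP; rewrite mcoeff_eq0 (perm_mem (msuppMX _ _)); apply/mapP => -[m _ E].
by move: ah; rewrite E mnmDE mnm1E eqxx.
Qed.

(** On each facet [p = \sum_i r i * th i], so the chain [- e * r i] placed at [[set i]] is a Koszul
    preimage of [- e * p]; the sign [(-1) ^+ d] undoes the one of [kp] on facets. *)
Lemma zig_J G p : is_homog q p -> inJ (star_cx D G) th p -> zig G p (fun _ _ => 0).
Proof.
move=> hp [r rP].
pose g H al I : L := if (msupport al :|: G \subset H) && ((mdeg al).+1 == q) then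
   (-1) ^+ d * - e H * \sum_i (I == [set i])%:R * (r i)@_al else 0.
have gE H al : forall i, g H al [set i] = if (msupport al :|: G \subset H) && ((mdeg al).+1 == q) then
   (-1) ^+ d * - e H * (r i)@_al else 0.
  move=> i; rewrite /g; case: ifP => // _; congr (_ * _).
  rewrite (bigD1 i) //= eqxx mul1r big1 ?addr0 // => j ji.
  by rewrite (inj_eq set1_inj) eq_sym (negbTE ji) mul0r.
exists g; split.
  move=> H al I; rewrite /g; case: ifP => [/andP[sH /eqP <-]|_]; last by rewrite eqxx.
  rewrite mulf_eq0 negb_or mulrN oppr_eq0 mulf_eq0 signr_eq0 /= => /andP[].
  rewrite (good_e gD) => /andP[HD /eqP Hd] nz.
  suff -> : #|I| = 1%N by rewrite Hd !addn1.
  apply/eqP/negPn/negP => I1; move: nz; rewrite big1 ?eqxx // => i _.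
  by case: eqP => [E|_]; [move: I1; rewrite E cards1 eqxx | rewrite mul0r].
move=> H al I; rewrite {1}/at0 if_same sub0r.
rewrite /DD [X in X + _](_ : _ = 0) ?add0r; last first.
  rewrite /bdt; case: ifP => // sH.
  rewrite (bd_ext (b := fun X => (if (mdeg al).+1 == q then
     (-1) ^+ d * - (\sum_i (I == [set i])%:R * (r i)@_al) else 0) * e X)).
    by rewrite bdZ (good_cycle gD) mulr0.
  move=> v vH; rewrite /g (subset_trans sH (subsetUr _ _)) /=.
  by case: ifP => _; rewrite ?mul0r // !mulrN !mulNr mulrAC.
rewrite /kp.
have [/eqP I0|I0] := boolP (I == set0); last first.
  rewrite /epsp (negbTE I0) oppr0 /kap big1 ?mulr0 // => h _; rewrite /ioV big1 // => i _.
  rewrite /io; case: ifPn => iI; rewrite ?mulr0 // /xs; case: ifP => _; rewrite ?mulr0 //.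
  rewrite /g; case: ifP => _; rewrite ?mulr0 // big1 ?mulr0 // => j _.
  case: eqP => [E|]; last by rewrite mul0r.
  move: I0; rewrite -cards_eq0; have := cardsU1 i I; rewrite E cards1 iI add1n => -[<-].
  by rewrite eqxx.
have [eH|eH] := eqVneq (e H) 0.
  rewrite /epsp eH mul0r if_same oppr0 kap0 ?mulr0 // => a J.
  by rewrite /g eH oppr0 mulr0 mul0r if_same.
have [HD /eqP Hd] : H \in D /\ #|H| == d by move: eH; rewrite (good_e gD) => /andP.
rewrite Hd.
have xsE h i : h \in H -> xs h (g H) al [set i] =
    if (msupport al :|: G \subset H) && (mdeg al == q) then
      (-1) ^+ d * - e H * (if (0 < al h)%N then (r i)@_(al - U_(h)) else 0) else 0.
  move=> hH; rewrite /xs; case: ifP => ah; last by rewrite mulr0 if_same.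
  rewrite gE mdeg_sub1 // prednK; last by rewrite -(msubK ah) mdegD mdeg1 addn1.
  suff -> : (msupport (al - U_(h)) :|: G \subset H) = (msupport al :|: G \subset H) by [].
  by rewrite -{2}(msubK ah) msupportD msupport1 !subUset sub1set hH andbT.
have kE : kap mu H (g H) al I = if (msupport al :|: G \subset H) && (mdeg al == q) then
    (-1) ^+ d * - e H * \sum_(h in H) \sum_i mu h i *
      (if (0 < al h)%N then (r i)@_(al - U_(h)) else 0) else 0.
  rewrite I0 /kap; case: ifP => c.
    rewrite mulr_sumr; apply: eq_bigr => h hH; rewrite mulr_sumr; apply: eq_bigr => i _.
    by rewrite /io inE setU0 xsE // c /sg setIdE set0I cards0 mul1r mulrCA.
  rewrite big1 // => h hH; rewrite /ioV big1 // => i _.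
  by rewrite /io inE setU0 xsE // c !mulr0.
rewrite kE /epsp I0 eqxx /=; case: ifP => /= [sH|_]; last by rewrite oppr0 mulr0.
case: (mdeg al =P q) => [alq|alq]; last first.
  rewrite mulr0 (_ : p@_al = 0) ?mulr0 ?oppr0 //.
  by apply/eqP; apply: contra_notT alq => /hp.
rewrite mulrA mulrA -expr2 sqrr_sign mul1r mulNr; congr (- (_ * _)).
have -> : p@_al = (\sum_i r i * th i)@_al.
  apply/eqP; rewrite -subr_eq0 -mcoeffB; apply: contraT => /rP.
  by rewrite inE (good_closed gD HD sH).
have aH h : h \notin H -> al h = 0%N.
  move=> hH; apply/eqP; apply: contraNT hH => ah; apply: (subsetP sH).
  by rewrite !inE ah.
rewrite [RHS]exchange_big /= raddf_sum; apply: eq_bigr => i _ /=.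
rewrite /linsys mulr_sumr raddf_sum [RHS]big_mkcond; apply: eq_bigr => h _ /=.
rewrite -scalerAr mcoeffZ mcoeffMU; case: (boolP (h \in H)) => // /aH ->.
by rewrite mulr0.
Qed.

(** Koszul exactness moves [e * p] to the monomial 1. Besides [u], this records the two properties
    that characterize the forms obtained: being a boundary, and being killed at [H] by the vertices
    of [H]. *)
Lemma zig_forward G p : is_homog q p -> exists u, zig G p u /\
  (exists s, (forall H I, s H I != 0 ->
      [/\ H \in D, G \subset H, (#|H| + q)%N = d.+1 & #|I| = q]) /\
    forall H I, G \subset H -> u H I = bd (fun X => s X I) H) /\
  forall H h I, h \in H -> ioV (mu h) (u H) I = 0.
Proof.
move=> hp; have fP := epsp_hom hp (G := G).
have [|g [gP gE]] := eliminate_down gD indep fP; first by move=> *; apply: DD_epsp.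
pose u H I := - DD mu G g H 0%MM I.
have p0 : p@_0%MM = 0.
  by apply/eqP; apply: contraLR q0 => /hp <-; rewrite mdeg0.
have uE H al I : at0 u H al I - epsp G p H al I = - DD mu G g H al I.
  rewrite /at0; case: eqP => [->|/eqP a0]; last by rewrite sub0r gE.
  by rewrite /epsp p0 mulr0 if_same subr0.
exists u; split.
  exists (fun H al I => -1 * g H al I); split; first exact: homZ.
  by move=> H al I; rewrite uE DDZ mulN1r.
split.
  exists (fun H I => - g H 0%MM I); split.
    move=> H I; rewrite oppr_eq0 => /gP[HD]; rewrite msupport0 set0U mdeg0 add0n => GH.
    by move=> Hd Iq; split=> //; rewrite -Iq.
  move=> H I GH; rewrite /u /DD /kp kap_at0 mulr0 addr0 /bdt msupport0 set0U GH.
  rewrite -mulN1r -bdZ; apply: bd_eq => X; exact: mulN1r.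
move=> H h I hH.
have : DD mu G (at0 u) H U_(h)%MM I = 0.
  rewrite -[RHS]oppr0 -(DDDD mu G g H U_(h)%MM I) -[in RHS]mulN1r -DDZ.
  transitivity (DD mu G (fun H al I => at0 u H al I - epsp G p H al I) H U_(h)%MM I).
    by rewrite (DDB mu G (at0 u) (epsp G p)) DD_epsp subr0.
  by apply: DD_eq => X a J; rewrite uE mulN1r.
rewrite /DD /bdt bd0 ?if_same ?add0r; last by move=> v vH; rewrite /at0 mnm1_eq0.
rewrite /kp kap_at0U (bigD1 h) //= eqxx mul1r big1 ?addr0.
  by move=> /eqP; rewrite mulf_eq0 signr_eq0 => /eqP.
by move=> h' /andP[_ h'h]; rewrite eq_mnm1 eq_sym (negbTE h'h) mul0r.
Qed.

(** Converse of [zig_forward]: exactness of the stars moves [u] to the facets. Over each monomial a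
    top cycle of a star remains, hence a multiple of [e], and these multiples are the coefficients
    of [p]. *)
Lemma zig_backward G s u :
  (forall H I, s H I != 0 -> [/\ H \in D, G \subset H, (#|H| + q)%N = d.+1 & #|I| = q]) ->
  (forall H I, u H I = if G \subset H then bd (fun X => s X I) H else 0) ->
  (forall H h I, h \in H -> ioV (mu h) (u H) I = 0) ->
  exists p, is_homog q p /\ zig G p u.
Proof.
move=> sP uE uK.
have sH : tchom D G q d.+1 (at0 s).
  move=> H al I; rewrite /at0; case: (al =P 0%MM) => [->|_]; last by rewrite eqxx.
  by case/sP=> HD GH Hq Iq; rewrite msupport0 set0U mdeg0 Iq.
have uS H al I : bdt G (at0 s) H al I = at0 u H al I.
  rewrite /bdt /at0; case: eqP => [->|_]; last by rewrite bd0 ?if_same.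
  by rewrite msupport0 set0U uE.
pose f H al I := at0 u H al I - DD mu G (at0 s) H al I.
have fE H al I : f H al I = - kp mu (at0 s) H al I.
  by rewrite /f /DD uS opprD addrA subrr sub0r.
have fP : tchom D G q d f.
  move=> H al I; rewrite fE oppr_eq0 /kp mulf_eq0 signr_eq0 /= => nz.
  by have [? ? [?] ?] := kap_hom sH nz.
have uD H al I : DD mu G (at0 u) H al I = 0.
  rewrite /DD /kp kap_at0U big1 => [|h hH]; last by rewrite uK ?mulr0.
  rewrite mulr0 addr0 /bdt; case: ifP => // sub; rewrite /at0; case: eqP => _; last by rewrite bd0.
  rewrite -[RHS](bdbd (fun X => s X I) H); apply: bd_ext => v vH.
  by rewrite uE (subset_trans _ (subsetUr _ _)) //; move: sub; rewrite subUset => /andP[].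
have fD H al I : DD mu G f H al I = 0.
  by rewrite (DDB mu G (at0 u) (DD mu G (at0 s))) DDDD uD subrr.
have f0 H I : f H 0%MM I = 0 by rewrite fE /kp kap_at0 mulr0 oppr0.
have [g [gP gE]] := eliminate_up gD fP f0 fD.
pose f' H al I := f H al I - DD mu G g H al I.
have f'P : tchom D G q d f' by apply: homB => //; apply: (hom_DD (e:=e)).
have f'D H al I : DD mu G f' H al I = 0 by rewrite DDB DDDD fD subrr.
have f'S H al I : f' H al I != 0 -> [/\ #|H| = d, I = set0 & mdeg al = q].
  move=> nz; have [HD _ E1 E2] := f'P _ _ _ nz.
  have Hd : #|H| = d.
    apply/eqP; rewrite eqn_leq (good_dim gD HD) leqNgt; apply: contraNN nz => Hd.
    by rewrite /f' gE // subrr.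
  have I0 : I = set0 by apply/eqP; rewrite -cards_eq0; apply/eqP/(@addnI #|H|); rewrite E1 Hd addn0.
  by split=> //; rewrite -E2 I0 cards0 addn0.
have ex (al : 'X_{1..n < q.+1}) : exists a : L, forall H, msupport al :|: G \subset H ->
    f' H al set0 = a * e H.
  have [TD|TD] := boolP (msupport al :|: G \in D); last first.
    exists 0 => H sub; rewrite mul0r; apply/eqP; apply: contraNT TD => /f'P[HD _ _ _].
    exact: good_closed gD _ _ HD sub.
  have [alq|alq] := eqVneq (mdeg al) q; last first.
    by exists 0 => H sub; rewrite mul0r; apply/eqP; apply: contraNT alq => /f'S[_ _ ->].
  apply: (good_top gD TD).
  - apply/eqP => T0; have := subsetUl (msupport al) G; rewrite T0 subset0 msupport_eq0 => /eqP a0.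
    by move: q0; rewrite -alq a0 mdeg0.
  - by move=> H /[dup] /f'S[-> _ _] /f'P[].
  - move=> H sub; have := f'D H al set0; rewrite /DD /bdt sub /kp.
    rewrite [kap _ _ _ _ _](_ : _ = 0) ?mulr0 ?addr0 //.
    rewrite /kap big1 // => h _; rewrite /ioV big1 // => i _; rewrite /io; case: ifP => _; rewrite ?mulr0 //.
    rewrite /xs; case: ifP => _; rewrite ?mulr0 // (_ : f' _ _ _ = 0) ?mulr0 //.
    by apply/eqP; apply: contraT => /f'S[_ /setP/(_ i)]; rewrite !inE eqxx.
have [a aE] := fin_all_exists ex.
pose p : {mpoly L[n]} := \sum_(m : 'X_{1..n < q.+1} | mdeg m == q) a m *: 'X_[m].
have pE (m : 'X_{1..n < q.+1}) : mdeg m = q -> p@_m = a m.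
  move=> mq; rewrite /p raddf_sum (bigD1 m) /= ?mq // mcoeffZ mcoeffX eqxx mulr1 big1 ?addr0 //.
  by move=> m' /andP[_ m'm]; rewrite mcoeffZ mcoeffX -val_eqE in m'm *; rewrite (negbTE m'm) mulr0.
have hp : is_homog q p.
  move=> m nz; apply/eqP; apply: contraNT nz => mq; rewrite /p raddf_sum big1 // => m' /eqP m'q.
  rewrite /= mcoeffZ mcoeffX; case: eqP => [E|_]; last by rewrite mulr0.
  by move: mq; rewrite -E m'q eqxx.
exists p; split=> //.
exists (fun H al I => at0 s H al I + g H al I); split; first exact: homD.
move=> H al I; rewrite (DDD mu G (at0 s) g).
suff -> : epsp G p H al I = f' H al I by rewrite /f' /f; ring.
rewrite /epsp; case: ifP => [/andP[/eqP -> sub]|no].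
  have [alq|alq] := eqVneq (mdeg al) q; last first.
    transitivity (0 : L); first by apply/eqP; rewrite mulf_eq0; apply/orP; right; apply: contraNT alq => /hp/eqP.
    by apply/esym/eqP; apply: contraNT alq => /f'S[_ _ /eqP].
  have aq : (mdeg al < q.+1)%N by rewrite alq.
  by rewrite (aE (BMultinom aq) H sub) -(pE (BMultinom aq)) // mulrC.
apply/esym/eqP; apply: contraFT no => /[dup] /f'S[_ -> _] /f'P[_ -> _ _].
by rewrite eqxx.
Qed.

End Zigzag.

Section Wedge.
Variables (M : finType) (d : nat) (L : fieldType) (mu lam : M -> 'I_d -> L) (F : {set M}).
Hypothesis dual : forall h h', h \in F -> h' \in F -> \sum_i mu h i * lam h' i = (h == h')%:R.

(* the wedge product of the covectors [lam v], v in s *)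
Lemma dual_wedge (s : seq M) : uniq s -> {subset s <= F} ->
  exists nu : {set 'I_d} -> L, [/\ exists I, nu I != 0,
    forall I, nu I != 0 -> #|I| = size s &
    forall h I, h \in F -> h \notin s -> ioV (mu h) nu I = 0].
Proof.
elim: s => [_ _|v s IH /= /andP[vs us] sF].
  exists (fun I => (I == set0)%:R); split.
  - by exists set0; rewrite eqxx oner_eq0.
  - by move=> I; case: (I =P set0) => [->|]; rewrite ?cards0 ?eqxx.
  - move=> h I _ _; rewrite /ioV big1 // => i _; rewrite /io; case: ifP => _; rewrite ?mulr0 //.
    by rewrite (_ : (i |: I == set0) = false) ?mulr0 //; apply/negbTE/set0Pn; exists i; rewrite setU11.
have vF : v \in F by apply: sF; rewrite inE eqxx.
have [|nu [[I nuI] nuS nuK]] := IH us; first by move=> x xs; apply: sF; rewrite inE xs orbT.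
exists (epV (lam v) nu); split.
- have E : ioV (mu v) (epV (lam v) nu) I = nu I.
    have := ioVepV (mu v) (lam v) nu I; rewrite dual // eqxx mul1r => <-.
    by rewrite [X in _ + X](epV0 _ _ (fun J => nuK v J vF vs)) addr0.
  have /existsP[J nz] : [exists J, epV (lam v) nu J != 0]; last by exists J.
  apply: contraNT nuI; rewrite negb_exists -E => /forallP z; apply/eqP; apply: ioV0 => J.
  by apply/eqP; have := z J; rewrite negbK.
- by move=> J; apply: epV_supp.
move=> h J hF; rewrite inE negb_or => /andP[hv hs].
have := ioVepV (mu h) (lam v) nu J; rewrite dual // (negbTE hv) mul0r.
by rewrite [X in _ + X](epV0 _ _ (fun J => nuK h J hF hs)) addr0.
Qed.
End Wedge.

Section Rank.
Variables (n d : nat) (L : fieldType) (D : {set {set 'I_n}}) (e : {set 'I_n} -> L).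
Hypotheses (gD : good d D e) (d2 : (1 < d)%N).
Variable mu : 'I_n -> 'I_d -> L.
Hypothesis indep : lsop D mu.
Variable dg : 'X_{1..n} -> L.
Hypothesis dgP : degcond D mu dg.
Variable q : nat.
Hypothesis q0 : (0 < q)%N.
Implicit Types (G H T F : {set 'I_n}) (al : 'X_{1..n}) (I : {set 'I_d}) (p r : {mpoly L[n]})
  (u s : {set 'I_n} -> {set 'I_d} -> L).
Local Notation th := (linsys mu).
Local Notation zig := (zig D e mu q).

Lemma zig_restrict G p u : zig set0 p u -> zig G p (fun H I => if G \subset H then u H I else 0).
Proof.
case=> g [gP gE]; exists (fun H al I => if G \subset H then g H al I else 0); split.
  move=> H al I; case: ifP => [GH|_]; last by rewrite eqxx.
  by case/gP => HD; rewrite setU0 subUset GH => -> -> ->.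
move=> H al I; case: (boolP (G \subset H)) => GH.
  transitivity (DD mu set0 g H al I).
    rewrite -gE /at0 /epsp GH setU0 subUset GH andbT //.
  rewrite /DD /bdt setU0 subUset GH andbT; congr (_ + _).
    case: ifP => // _; apply: bd_ext => v vH.
    by rewrite (subset_trans GH (subsetUr _ _)).
  by rewrite /kp; congr (_ * _); apply: kap_eq => a J; rewrite GH.
rewrite /at0 (negbTE GH) if_same /epsp subUset (negbTE GH) !andbF subrr.
rewrite /DD /bdt subUset (negbTE GH) andbF add0r /kp kap0 ?mulr0 // => a J.
by rewrite (negbTE GH).
Qed.

Lemma star_inJ G p : inJ (star_cx D G) th p -> inJ D th ('X_[mset G] * p).
Proof.
case=> s sP; exists (fun i => 'X_[mset G] * s i) => m.
rewrite (eq_bigr (fun i => 'X_[mset G] * (s i * th i))); last by move=> i _; rewrite mulrA.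
rewrite -mulr_sumr -mulrBr -mcoeff_msupp => /msuppM_le /allpairsP[[m1 m2] /= [h1 h2 ->]].
move: h1; rewrite msuppX inE => /eqP ->.
move: h2; rewrite mcoeff_msupp => /sP; rewrite inE; apply: contra.
by rewrite msupportD msupport_mset setUC.
Qed.

Lemma homogB p r j : is_homog j p -> is_homog j r -> is_homog j (p - r).
Proof.
move=> hp hr m; rewrite mcoeffB; have [->|/hp//] := eqVneq p@_m 0.
by rewrite sub0r oppr_eq0; apply: hr.
Qed.
Lemma homogZ c p j : is_homog j p -> is_homog j (c *: p).
Proof. by move=> hp m; rewrite mcoeffZ mulf_eq0 negb_or => /andP[_ /hp]. Qed.
Lemma homogX m : is_homog (mdeg m) ('X_[m] : {mpoly L[n]}).
Proof. by move=> m'; rewrite mcoeffX; case: (m =P m') => [->|_]; rewrite ?eqxx. Qed.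

(** In the star of [G], both [p] and an auxiliary [p1], whose form is a nonzero [nu] at [G] and 0
    elsewhere, are multiples [c * x0] and [c1 * x0] of one monomial. By uniqueness
    [c1 * u G = c * nu] with [c1 != 0], while [c] is the degree of [x_G p] up to that of a facet. *)
Lemma zig_deg G p u : G \in D -> (#|G| + q)%N = d -> is_homog q p -> zig set0 p u ->
  dgp d dg ('X_[mset G] * p) = 0 <-> forall I, u G I = 0.
Proof.
move=> GD Gq hp zu.
have [F0 [F0D F0d GF0]] := pure gD GD.
have dF0 : dg (mset F0) != 0 by have [_ _ ->] := dgP.
pose x0 : {mpoly L[n]} := 'X_[mset (F0 :\: G)].
have c0 : #|F0 :\: G| = q by rewrite cardsD (setIidPr GF0) F0d -Gq addKn.
have hx0 : is_homog q x0 by rewrite -c0 -mdeg_mset; apply: homogX.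
have [lam dual] := indep F0D.
have [||nu [[I0 nu0] nuS nuK]] := dual_wedge dual (s := enum (F0 :\: G)).
- exact: enum_uniq.
- by move=> x; rewrite mem_enum => /setDP[].
rewrite -cardE c0 in nuS.
have [v vFG] : exists v, v \in F0 :\: G by apply/set0Pn; rewrite -card_gt0 c0.
have [vF vG] := setDP vFG.
pose un H I := if H == G then nu I else 0.
(* Among the faces containing [G], the boundary of the single face [v |: G] is [G] up to sign; this
   makes [un] a boundary, as [zig_backward] requires. *)
have unE H I : G \subset H -> un H I =
    bd (fun X => if X == v |: G then (-1) ^+ sg v G * nu I else 0) H.
  move=> GH; rewrite /un; case: (H =P G) => [->|HG].
    rewrite /bd (bigD1 v) //= /io (negbTE vG) eqxx mulrA -expr2 sqrr_sign mul1r.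
    rewrite big1 ?addr0 // => w wv; case: ifPn => // wG; case: eqP => [E|]; rewrite ?mulr0 //.
    by have := setU11 w G; rewrite E !inE (negbTE wv) (negbTE wG).
  rewrite bd0 // => w wH; case: eqP => // E.
  have : (#|w |: H| <= #|v |: G|)%N by rewrite E.
  rewrite !cardsU1 wH vG ltnS leqNgt proper_card //.
  by rewrite properEneq eq_sym GH andbT; apply/eqP.
have [p1 [hp1 zp1]] : exists p, is_homog q p /\ zig G p un.
  apply: (zig_backward gD q0 (s := fun H I => if H == v |: G then (-1) ^+ sg v G * nu I else 0)).
  - move=> H I; case: (H =P _) => [->|_]; last by rewrite eqxx.
    rewrite mulf_eq0 signr_eq0 /= => /nuS ->; rewrite subsetUr cardsU1 vG add1n addSn Gq.
    split=> //; apply: good_closed gD _ _ F0D _; rewrite subUset sub1set vF //.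
  - move=> H I; case: ifPn => GH; first exact: unE.
    by rewrite /un; case: eqP GH => // ->; rewrite subxx.
  - move=> H h I hH; rewrite /un; case: (H =P G) hH => [-> hG|_ _]; last exact: ioV0.
    apply: nuK; first exact: subsetP GF0 _ hG.
    by rewrite mem_enum inE hG.
have [c1 J1] := one_dim gD d2 indep F0D F0d GF0 Gq hp1.
have [c J] := one_dim gD d2 indep F0D F0d GF0 Gq hp.
have z1 := zig_J gD (homogB hp1 (homogZ (c := c1) hx0)) J1.
have z := zig_J gD (homogB hp (homogZ (c := c) hx0)) J.
have {z1} z1 := zig_lin (-1) z1 zp1.
have {z} z := zig_lin (-1) z (zig_restrict G zu).
have E1 r x : -1 *: (r - x) + r = x :> {mpoly L[n]} by rewrite scaleN1r opprB subrK.
rewrite !E1 in z1 z.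
(* The combination that cancels the multiples of [x0]. *)
have : zig G 0 (fun H I => - c * un H I + c1 * (if G \subset H then u H I else 0)).
  have z0 : zig G 0 (fun _ _ => 0).
    by apply: (zig_J gD _ (inJ0 _ _)) => m; rewrite mcoeff0 eqxx.
  have := zig_lin (- c) z1 (zig_lin c1 z z0).
  have -> : - c *: (c1 *: x0) + (c1 *: (c *: x0) + 0) = 0.
    by rewrite addr0 !scalerA mulNr mulrC scaleNr addNr.
  apply: zig_eq => H I /=; by rewrite !mulr0 !add0r addr0.
move/(zig_uniq gD indep) => rel.
have c1n0 : c1 != 0.
  apply/negP => /eqP c10; move: z1; rewrite c10 scale0r => /(zig_uniq gD indep)/(_ G I0).
  by rewrite /un eqxx mulr0 add0r; apply/eqP.
have dE : dgp d dg ('X_[mset G] * p) = c * dg (mset F0).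
  have Jd := dgp_inJ dgP (star_inJ J).
  move: Jd; rewrite mulrBr dgpB -scalerAr dgpZ -mpolyXD => /eqP; rewrite subr_eq0 => /eqP ->.
  have -> : (mset G + mset (F0 :\: G))%MM = mset F0.
    apply/mnmP => i; rewrite mnmDE !msetE !inE; case: (boolP (i \in G)) => //= iG.
    by rewrite (subsetP GF0).
  by rewrite dgpX mdeg_mset F0d eqxx.
rewrite dE; split => [/eqP|u0].
  rewrite mulf_eq0 (negbTE dF0) orbF => /eqP c00 I.
  have := rel G I; rewrite subxx c00 oppr0 mul0r add0r => /eqP.
  by rewrite mulf_eq0 (negbTE c1n0) => /eqP.
have := rel G I0; rewrite subxx u0 mulr0 addr0 /un eqxx => /eqP.
by rewrite mulf_eq0 (negbTE nu0) orbF oppr_eq0 => /eqP ->; rewrite mul0r.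
Qed.

End Rank.

Lemma mxrank_le_ker (K : fieldType) m n p (A : 'M[K]_(m, n)) (B : 'M[K]_(m, p)) :
  (forall w : 'rV_m, w *m A = 0 -> w *m B = 0) -> (\rank B <= \rank A)%N.
Proof.
move=> AB; have sub : (kermx A <= kermx B)%MS.
  apply/sub_kermxP/row_matrixP => i; rewrite row_mul row0; apply: AB.
  by rewrite -row_mul mulmx_ker row0.
have := mxrankS sub; rewrite !mxrank_ker => le.
by rewrite -(subKn (rank_leq_row A)) -(subKn (rank_leq_row B)) leq_sub2l.
Qed.

(** Degree [q] is paired with face monomials only, which suffice by [nullN_squarefree]. Irrelevant
    rows and columns are zero, so the rank is the dimension of the Gorenstein quotient in degree
    [q]. *)
Definition deg_mx n d (L : fieldType) (D : {set {set 'I_n}}) (dg : 'X_{1..n} -> L) (q : nat) :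
  'M[L]_(#|{: 'X_{1..n < q.+1}}|, #|{set 'I_n}|) :=
  \matrix_(i, j) (let m : 'X_{1..n < q.+1} := enum_val i in let G : {set 'I_n} := enum_val j in
    if [&& mdeg m == q, G \in D & (#|G| + q)%N == d] then dg (m + mset G)%MM else 0).

Lemma zig_sum n d (L : fieldType) (D : {set {set 'I_n}}) (e : {set 'I_n} -> L)
  (gD : good d D e) (mu : 'I_n -> 'I_d -> L) q G (J : Type) (s : seq J) (P : pred J)
  (c : J -> L) (p : J -> {mpoly L[n]}) u :
  (forall j, P j -> zig D e mu q G (p j) (u j)) ->
  zig D e mu q G (\sum_(j <- s | P j) c j *: p j)
    (fun H I => \sum_(j <- s | P j) c j * u j H I).
Proof.
move=> zu; elim: s => [|j s IH].
  rewrite big_nil; apply: (zig_eq (u := fun _ _ => 0)) => [H I|]; first by rewrite big_nil.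
  by apply: (zig_J gD _ (inJ0 _ _)) => m; rewrite mcoeff0 eqxx.
rewrite big_cons; case: ifP => Pj; last by apply: zig_eq IH => H I; rewrite big_cons Pj.
by apply: zig_eq (zig_lin (c j) (zu j Pj) IH) => H I; rewrite big_cons Pj.
Qed.

Section RankFormula.
Variables (n d : nat) (L : fieldType) (D : {set {set 'I_n}}) (q : nat).
Local Notation P := ({set 'I_n} * {set 'I_d})%type.
Local Notation Q := ('I_n * P)%type.

(** The source is restricted to faces with [d + 1 - q] vertices and forms of degree [q], the support
    of the chains [s] in [zig_forward]. The entries involve no parameter. *)
Definition bd_mx : 'M[L]_(#|{: P}|) :=
  \matrix_(i, j) (let x : P := enum_val i in let y : P := enum_val j in
    if [&& x.1 \in D, (#|x.1| + q == d.+1)%N, #|x.2| == q & x.2 == y.2]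
    then bd (fun X => (X == x.1)%:R) y.1 else 0).

Definition contr_mx (mu : 'I_n -> 'I_d -> L) : 'M[L]_(#|{: P}|, #|{: Q}|) :=
  \matrix_(i, j) (let x : P := enum_val i in let y : Q := enum_val j in
    if (x.1 == y.2.1) && (y.1 \in x.1) then ioV (mu y.1) (fun I => (I == x.2)%:R) y.2.2 else 0).

Definition fun_rV (w : 'rV[L]_#|{: P}|) H I : L := w 0 (enum_rank (H, I)).
Definition rV_fun (u : {set 'I_n} -> {set 'I_d} -> L) : 'rV[L]_#|{: P}| :=
  \row_i u (enum_val i).1 (enum_val i).2.

Lemma fun_rVK w : rV_fun (fun_rV w) = w.
Proof. by apply/rowP => i; rewrite mxE /fun_rV -surjective_pairing enum_valK. Qed.
Lemma rV_funE u H I : (rV_fun u) 0 (enum_rank (H, I)) = u H I.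
Proof. by rewrite mxE enum_rankK. Qed.

Lemma mul_bd_mx w H I : fun_rV (w *m bd_mx) H I =
  bd (fun X => if [&& X \in D, (#|X| + q == d.+1)%N & #|I| == q] then fun_rV w X I else 0) H.
Proof.
rewrite /fun_rV mxE (reindex (@enum_rank {: P})) /=; last first.
  by exists enum_val => x _; rewrite ?enum_rankK ?enum_valK.
transitivity (\sum_X \sum_J w 0 (enum_rank (X, J)) * (if [&& X \in D, (#|X| + q == d.+1)%N, #|J| == q & J == I]
    then bd (fun Y => (Y == X)%:R) H else 0)).
  by rewrite pair_bigA; apply: eq_bigr => -[X J] _; rewrite mxE !enum_rankK.
transitivity (bd (fun Y => \sum_X (if [&& X \in D, (#|X| + q == d.+1)%N & #|I| == q] then
  w 0 (enum_rank (X, I)) else 0) * (Y == X)%:R) H).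
  rewrite bd_sum; apply: eq_bigr => X _; rewrite bdZ (bigD1 I) //= eqxx andbT big1 ?addr0.
    by case: ifP => _; rewrite ?mulr0 ?mul0r.
  by move=> J /negbTE ->; rewrite !andbF mulr0.
apply: bd_eq => Y; rewrite (bigD1 Y) //= eqxx mulr1 big1 ?addr0 // => X /negbTE.
by rewrite eq_sym => ->; rewrite mulr0.
Qed.

Lemma mul_contr_mx mu w h H I : (w *m contr_mx mu) 0 (enum_rank (h, (H, I))) =
  if h \in H then ioV (mu h) (fun_rV w H) I else 0.
Proof.
rewrite mxE (reindex (@enum_rank {: P})) /=; last first.
  by exists enum_val => x _; rewrite ?enum_rankK ?enum_valK.
transitivity (\sum_X \sum_J w 0 (enum_rank (X, J)) * (if (X == H) && (h \in X)
    then ioV (mu h) (fun Y => (Y == J)%:R) I else 0)).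
  by rewrite pair_bigA; apply: eq_bigr => -[X J] _; rewrite mxE !enum_rankK.
rewrite (bigD1 H) //= eqxx [X in _ + X]big1 ?addr0 /=; last first.
    by move=> X /negbTE ->; rewrite big1 // => J _; rewrite mulr0.
case: ifP => hH; last by rewrite big1 // => J _; rewrite mulr0.
under eq_bigr => J _ do rewrite -ioVZ.
rewrite -ioV_sum; apply: ioV_eq => Y; rewrite (bigD1 Y) //= eqxx mulr1 big1 ?addr0 // => X /negbTE.
by rewrite eq_sym => ->; rewrite mulr0.
Qed.

Lemma contr_mxP mu w : w *m contr_mx mu = 0 <->
  forall (H : {set 'I_n}) h I, h \in H -> ioV (mu h) (fun_rV w H) I = 0.
Proof.
split => [w0 H h I hH|w0].
  have := mul_contr_mx mu w h H I; by rewrite w0 mxE hH => <-.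
apply/rowP => i; rewrite -(enum_valK i); case: (enum_val i) => h [H I].
by rewrite mul_contr_mx mxE; case: ifP => // hH; apply: w0.
Qed.

Variable e : {set 'I_n} -> L.
Hypotheses (gD : good d D e) (d2 : (1 < d)%N).
Variable mu : 'I_n -> 'I_d -> L.
Hypothesis indep : lsop D mu.
Variable dg : 'X_{1..n} -> L.
Hypothesis dgP : degcond D mu dg.
Hypotheses (q0 : (0 < q)%N) (qd : (q < d)%N).

Lemma mul_deg_mx (w : 'rV[L]_#|{: 'X_{1..n < q.+1}}|) G : G \in D -> (#|G| + q)%N = d ->
  (w *m deg_mx d D dg q) 0 (enum_rank G) =
  dgp d dg ('X_[mset G] * \sum_(m : 'X_{1..n < q.+1} | mdeg m == q) w 0 (enum_rank m) *: 'X_[m]).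
Proof.
move=> GD Gq; rewrite mxE (reindex (@enum_rank {: 'X_{1..n < q.+1}})) /=; last first.
  by exists enum_val => x _; rewrite ?enum_rankK ?enum_valK.
rewrite mulr_sumr dgp_sum [RHS]big_mkcond; apply: eq_bigr => m _.
rewrite mxE /= !enum_rankK GD Gq eqxx !andbT; case: eqP => mq; last by rewrite mulr0.
by rewrite -scalerAr dgpZ -mpolyXD dgpX mdegD mdeg_mset mq Gq eqxx addmC.
Qed.

(* Only the second term depends on mu, and it cannot grow under specialization:
   this is why specialization does not lower the rank of the degree pairing. *)
Lemma rank_deg_mx : \rank (deg_mx d D dg q) = (\rank bd_mx - \rank (bd_mx *m contr_mx mu))%N.
Proof.
have -> : (\rank bd_mx - \rank (bd_mx *m contr_mx mu))%N =
    \rank (bd_mx :&: kermx (contr_mx mu))%MS.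
  by rewrite -(mxrank_mul_ker bd_mx (contr_mx mu)) addKn.
set W := (_ :&: _)%MS.
apply/eqP; rewrite eqn_leq; apply/andP; split.
  (* Upper bound: the forms of the monomials lie in [W], and a combination of monomials whose form
     is 0 pairs to 0 with every face. *)
  have ex (m : 'X_{1..n < q.+1}) : exists u : 'rV[L]_#|{: P}|, (u <= W)%MS /\
      (mdeg m = q -> zig D e mu q set0 'X_[m] (fun_rV u)).
    case: (mdeg m =P q) => mq; last by exists 0; rewrite sub0mx.
    have hm : is_homog q ('X_[m] : {mpoly L[n]}) by have := @homogX n L m; rewrite mq.
    have [u [zu [[s [sP sE]] uK]]] := zig_forward gD indep q0 set0 hm.
    exists (rV_fun u); have uf H I : fun_rV (rV_fun u) H I = u H I by exact: rV_funE.
    split=> [|_]; last by apply: zig_eq zu.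
    rewrite sub_capmx; apply/andP; split.
      apply/submxP; exists (rV_fun s).
      rewrite -[rV_fun s *m _]fun_rVK; apply/rowP => i; rewrite !mxE mul_bd_mx sE ?sub0set //.
      apply: bd_eq => X; rewrite /fun_rV rV_funE.
      by have [->|/sP[-> _ -> ->]] := eqVneq (s X (enum_val i).2) 0; rewrite ?if_same ?eqxx.
    apply/sub_kermxP/contr_mxP => H h I hH; rewrite -[RHS](uK H h I hH).
    by apply: ioV_eq => J; rewrite uf.
  have [u uP] := fin_all_exists ex.
  pose U : 'M[L]_(#|{: 'X_{1..n < q.+1}}|, #|{: P}|) :=
    \matrix_i (let m : 'X_{1..n < q.+1} := enum_val i in if mdeg m == q then u m else 0).
  have UW : (U <= W)%MS.
    apply/row_subP => i; rewrite rowK /=; case: ifP => _; last exact: sub0mx.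
    exact: (uP _).1.
  apply: leq_trans (mxrankS UW); apply: mxrank_le_ker => w wU.
  pose p : {mpoly L[n]} := \sum_(m : 'X_{1..n < q.+1} | mdeg m == q) w 0 (enum_rank m) *: 'X_[m].
  have hp : is_homog q p.
    move=> m nz; apply/eqP; apply: contraNT nz => mq; rewrite /p raddf_sum big1 // => m' /eqP m'q /=.
    rewrite mcoeffZ mcoeffX; case: eqP => [E|_]; last by rewrite mulr0.
    by move: mq; rewrite -E m'q eqxx.
  have zp : zig D e mu q set0 p (fun _ _ => 0).
    have z0 : zig D e mu q set0 0 (fun _ _ => 0).
      by apply: (zig_J gD _ (inJ0 _ _)) => m; rewrite mcoeff0 eqxx.
    apply: (zig_eq (u := fun H I => \sum_(m : 'X_{1..n < q.+1} | mdeg m == q)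
        w 0 (enum_rank m) * fun_rV (u m) H I)) => [H I|].
      transitivity ((w *m U) 0 (enum_rank (H, I))); last by rewrite wU mxE.
      rewrite mxE.
      rewrite [RHS](reindex (@enum_rank {: 'X_{1..n < q.+1}})) /=; last first.
        by exists enum_val => x _; rewrite ?enum_rankK ?enum_valK.
      rewrite [LHS]big_mkcond; apply: eq_bigr => m _; rewrite mxE /= enum_rankK.
      by case: ifP => _; rewrite ?mxE ?mulr0.
    by apply: (zig_sum gD) => m /eqP mq; apply: (uP m).2.
  apply/rowP => i; rewrite -(enum_valK i) [RHS]mxE; set G := enum_val i.
  have [/andP[GD /eqP Gq]|no] := boolP ((G \in D) && (#|G| + q == d)%N).
    by rewrite mul_deg_mx //; apply/(zig_deg gD d2 indep dgP q0 GD Gq hp zp).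
  rewrite mxE big1 // => j _; rewrite mxE /= enum_rankK (negbTE no) andbF mulr0 //.
(* Lower bound: a basis of [W] lifts to polynomials, and a combination of these that pairs to 0 with
   every face has form 0. *)
pose r := \rank W; pose R := row_base W.
have RW i : (row i R <= W)%MS by apply: submx_trans (row_sub _ _) _; rewrite eq_row_base.
have ex i : exists p, is_homog q p /\ zig D e mu q set0 p (fun_rV (row i R)).
  have := RW i; rewrite sub_capmx => /andP[/submxP[s sE] /sub_kermxP/contr_mxP uK].
  apply: (zig_backward gD q0 (s := fun X I => if [&& X \in D, (#|X| + q == d.+1)%N & #|I| == q]
     then fun_rV s X I else 0)) => [H I|H I|H h I hH].
  - by case: ifP => [/and3P[-> /eqP -> /eqP ->] _|_]; rewrite ?sub0set // eqxx.
  - by rewrite sub0set -mul_bd_mx -sE.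
  - exact: uK.
have [p pP] := fin_all_exists ex.
pose C : 'M[L]_(\rank W, #|{: 'X_{1..n < q.+1}}|) :=
  \matrix_(i, j) (let m : 'X_{1..n < q.+1} := enum_val j in (p i)@_m).
have CE (v : 'rV_(\rank W)) : \sum_(m : 'X_{1..n < q.+1} | mdeg m == q) (v *m C) 0 (enum_rank m) *: 'X_[m] =
    \sum_i v 0 i *: p i :> {mpoly L[n]}.
  apply/mpolyP => m; rewrite !raddf_sum /=.
  have [mq|mq] := ltnP (mdeg m) q.+1; last first.
    rewrite !big1 // => [i _|m' _]; rewrite mcoeffZ.
      have [->|/(pP i).1 E] := eqVneq (p i)@_m 0; rewrite ?mulr0 //.
      by move: mq; rewrite E ltnn.
    rewrite mcoeffX; case: eqP => [E|_]; rewrite ?mulr0 //.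
    by have := bmdeg m'; rewrite E ltnNge mq.
  have [mqq|mqq] := eqVneq (mdeg m) q; last first.
    rewrite !big1 // => [i _|m' /eqP m'q]; rewrite mcoeffZ.
      have [->|/(pP i).1 E] := eqVneq (p i)@_m 0; rewrite ?mulr0 //.
      by move: mqq; rewrite E eqxx.
    rewrite mcoeffX; case: eqP => [E|_]; rewrite ?mulr0 //.
    by move: mqq; rewrite -E m'q eqxx.
  rewrite (bigD1 (BMultinom mq)) /= ?mqq // mcoeffZ mcoeffX eqxx mulr1 [X in _ + X]big1 ?addr0.
    by rewrite mxE; apply: eq_bigr => i _; rewrite mcoeffZ mxE enum_rankK.
  move=> m' /andP[_ m'm]; rewrite mcoeffZ mcoeffX.
  by move: m'm; rewrite -val_eqE /= => /negbTE ->; rewrite mulr0.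
suff : row_free (C *m deg_mx d D dg q).
  by rewrite /row_free => /eqP <-; apply: mxrankM_maxr.
apply/row_freeP/row_freeP; rewrite -kermx_eq0; apply/eqP/row_matrixP => i0; rewrite row0.
set v := row i0 _.
have v0 : v *m C *m deg_mx d D dg q = 0 by rewrite -mulmxA -row_mul mulmx_ker row0.
pose pv : {mpoly L[n]} := \sum_i v 0 i *: p i.
have hpv : is_homog q pv.
  move=> m; rewrite /pv raddf_sum /= => nz; apply/eqP; apply: contraNT nz => mq; rewrite big1 // => i _.
  rewrite mcoeffZ; have [->|/(pP i).1 E] := eqVneq (p i)@_m 0; rewrite ?mulr0 //.
  by move: mq; rewrite E eqxx.
have zpv : zig D e mu q set0 pv (fun_rV (v *m R)).
  apply: (zig_eq (u := fun H I => \sum_i v 0 i * fun_rV (row i R) H I)) => [H I|].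
    by rewrite /fun_rV mxE; apply: eq_bigr => i _; rewrite [row i R _ _]mxE.
  apply: (zig_sum gD) => i _; exact: (pP i).2.
have vR : v *m R = 0.
  apply/rowP => i; rewrite -(enum_valK i) [RHS]mxE; case: (enum_val i) => G I.
  rewrite -/(fun_rV (v *m R) G I); apply/eqP; apply: contraT => nz.
  have [GD _ Gq _] := zig_supp gD q0 hpv zpv nz.
  move: nz; rewrite (_ : fun_rV (v *m R) G I = 0) ?eqxx //.
  apply: (zig_deg gD d2 indep dgP q0 GD Gq hpv zpv).1.
  by rewrite -[pv]CE -mul_deg_mx // v0 mxE.
by apply: (row_free_inj (row_base_free W)); rewrite vR mul0mx.
Qed.

End RankFormula.

(** * Generic parameters *)

Definition face_mx (R : comNzRingType) n d (mu : 'I_n -> 'I_d -> R) (F : {set 'I_n}) : 'M[R]_d :=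
  \matrix_(i, m) nth 0 [seq mu j i | j <- enum F] m.

Lemma face_mxE (R : comNzRingType) n d (mu : 'I_n -> 'I_d -> R) (F : {set 'I_n}) (Fd : #|F| = d) i m :
  face_mx mu F i m = mu (enum_val (cast_ord (esym Fd) m)) i.
Proof.
rewrite mxE (nth_map (enum_val (cast_ord (esym Fd) m))); last by rewrite -cardE Fd.
by rewrite -(enum_val_nth _ (cast_ord (esym Fd) m)).
Qed.

Lemma map_face_mx (R R' : comNzRingType) (f : {rmorphism R -> R'}) n d (mu : 'I_n -> 'I_d -> R) F :
  map_mx f (face_mx mu F) = face_mx (fun j i => f (mu j i)) F.
Proof.
apply/matrixP => i m; rewrite !mxE.
have [lt|ge] := ltnP m (size (enum F)); last by rewrite !nth_default ?rmorph0 // size_map.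
rewrite -(nth_map 0 0) ?size_map // -map_comp //.
Qed.

(* Cramer: row m of the adjugate is a covector dual to the m-th vertex of F. *)
Lemma face_dual (R : comNzRingType) n d (mu : 'I_n -> 'I_d -> R) (F : {set 'I_n}) v :
  #|F| = d -> v \in F -> exists c : 'I_d -> R,
    forall h, h \in F -> \sum_i mu h i * c i = (h == v)%:R * \det (face_mx mu F).
Proof.
move=> Fd vF; pose pos h (hF : h \in F) := cast_ord Fd (enum_rank_in hF h).
have posE h (hF : h \in F) i : face_mx mu F i (pos h hF) = mu h i.
  by rewrite (face_mxE _ Fd) /pos cast_ordK enum_rankK_in.
exists (fun i => \adj (face_mx mu F) (pos v vF) i) => h hF.
have /matrixP/(_ (pos v vF) (pos h hF)) := mul_adj_mx (face_mx mu F).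
rewrite !mxE => E.
transitivity (\det (face_mx mu F) *+ (pos v vF == pos h hF)).
  by rewrite -E; apply: eq_bigr => i _; rewrite posE mulrC.
rewrite mulr_natl; congr (_ *+ nat_of_bool _).
apply/eqP/eqP => [E'|hv]; last by subst h; rewrite /pos (bool_irrelevance hF vF).
move: E' => /(congr1 (fun x => enum_val (cast_ord (esym Fd) x))).
by rewrite /pos !cast_ordK !enum_rankK_in.
Qed.

Section Eval.
Variables (k : fieldType) (d n : nat) (D : {set {set 'I_n}}).
Local Notation S := {mpoly k[d * n]}.
Implicit Types (F G H : {set 'I_n}) (be ga al : 'X_{1..n}).

Definition xvar (j : 'I_n) (i : 'I_d) : S := 'X_(mxvec_index i j).

Lemma bracketE F : bracket k d F = \det (face_mx xvar F).
Proof. by []. Qed.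

(** Both a denominator for the degree map, up to powers, and the locus to avoid: where it does not
    vanish, the specialized parameters are still a system of parameters. *)
Definition allbr : S := \prod_(F in D | #|F| == d) bracket k d F.

Section Ev.
Variables (L : fieldType) (ev : {rmorphism S -> L}).

Definition evpar (j : 'I_n) (i : 'I_d) : L := ev (xvar j i).

Lemma ev_bracket F : ev (bracket k d F) = \det (face_mx evpar F).
Proof. by rewrite bracketE -det_map_mx map_face_mx. Qed.

Lemma ev_allbr_neq0 : (ev allbr != 0) = [forall F in D, (#|F| == d) ==> (ev (bracket k d F) != 0)].
Proof.
rewrite /allbr rmorph_prod; apply/prodf_neq0/forall_inP => [nz F FD|nz F /andP[FD Fd]].
  by apply/implyP => Fd; apply: nz; rewrite FD Fd.
by have := nz F FD; rewrite Fd.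
Qed.

Lemma ev_lsop (e : {set 'I_n} -> L) : good d D e -> ev allbr != 0 -> lsop D evpar.
Proof.
move=> gD; rewrite ev_allbr_neq0 => /forall_inP nz H HD.
have [F [FD Fd HF]] := pure gD HD.
have dF : \det (face_mx evpar F) != 0 by rewrite -ev_bracket; have := nz F FD; rewrite Fd eqxx.
have ex (v : 'I_n) : exists c : 'I_d -> L, v \in F ->
    forall h, h \in F -> \sum_i evpar h i * c i = (h == v)%:R * \det (face_mx evpar F).
  case: (boolP (v \in F)) => [vF|_]; last by exists (fun=> 0).
  by have [c cP] := face_dual evpar Fd vF; exists c.
have [c cP] := fin_all_exists ex.
exists (fun v i => c v i / \det (face_mx evpar F)) => h h' hH h'H.
have [hF h'F] := (subsetP HF h hH, subsetP HF h' h'H).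
under eq_bigr => i _ do rewrite mulrA.
by rewrite -mulr_suml cP // mulfK.
Qed.
End Ev.

(** Facet values are fixed up to sign only: signs are units and invisible to orders, so the
    orientation of a subdivision need not be followed. *)
Record gendeg (dg : 'X_{1..n} -> Kf k (d * n)) : Prop := Gendeg {
  gendeg_th : forall be i, (mdeg be).+1 = d ->
     \sum_j avar k i j * dg (be + U_(j))%MM = 0;
  gendeg_nonface : forall al, mdeg al = d -> msupport al \notin D -> dg al = 0;
  gendeg_facet : forall F, F \in D -> #|F| = d ->
     exists b : bool, dg (mset F) * FracField.tofrac (bracket k d F) = (-1) ^+ b }.

Variables (e : {set 'I_n} -> Kf k (d * n)) (gD : good d D e) (d2 : (1 < d)%N).
Variables (dg : 'X_{1..n} -> Kf k (d * n)) (gdg : gendeg dg).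
Local Notation "x %:K" := (FracField.tofrac (x : S) : Kf k (d * n)) (at level 2).

(** Trading a repeated vertex by Cramer's rule on a facet costs one bracket and enlarges the
    support, which can happen at most [n - #|msupport be|] times; the squarefree case costs the last
    bracket. *)
Lemma deg_denominator (N : nat) be : mdeg be = d -> (n - #|msupport be| < N)%N ->
  exists p : S, dg be * allbr%:K ^+ N = p%:K.
Proof.
elim: N be => // N IH be bd.
set T := msupport be => TN.
have [TD|TD] := boolP (T \in D); last first.
  by exists 0; rewrite (gendeg_nonface gdg) // mul0r tofrac0.
have [F [FD Fd TF]] := pure gD TD.
pose rest := \prod_(F' in D | (#|F'| == d) && (F' != F)) bracket k d F'.
have allE : allbr = bracket k d F * rest.
  rewrite /allbr (bigD1 F) ?FD ?Fd ?eqxx //=; congr (_ * _); apply: eq_bigl => x.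
  by rewrite andbA.
have [/existsP[v vb]|] := boolP [exists v, (1 < be v)%N]; last first.
  rewrite negb_exists => /forallP sqf.
  have b1 i : (be i <= 1)%N by have := sqf i; rewrite -leqNgt.
  have Td : #|T| = d by rewrite -bd -(mset_supp b1) mdeg_mset.
  have -> : be = mset F.
    rewrite -(mset_supp b1); congr mset; apply/eqP; rewrite eqEcard TF Fd -Td leqnn //.
  have [b bE] := gendeg_facet gdg FD Fd.
  exists ((-1) ^+ b * rest * allbr ^+ N).
  rewrite exprS {1}allE !tofracM !mulrA bE.
  by rewrite !tofracXn tofracN tofrac1.
have vT : v \in T by rewrite inE -lt0n (ltn_trans _ vb).
have [c cP] := face_dual xvar Fd (subsetP TF v vT).
pose cc j : S := \sum_i xvar j i * c i.
pose ga := (be - U_(v))%MM.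
have beE : be = (ga + U_(v))%MM by rewrite /ga msubK // (ltn_trans _ vb).
have gd : (mdeg ga).+1 = d by rewrite -bd beE mdegD mdeg1 addn1.
have rel : (bracket k d F)%:K * dg be = - \sum_(j | j \notin F) (cc j)%:K * dg (ga + U_(j))%MM.
  apply/eqP; rewrite -subr_eq0 opprK.
  have : \sum_j (cc j)%:K * dg (ga + U_(j))%MM = 0.
    rewrite (eq_bigr (fun j => \sum_i (c i)%:K * (avar k i j * dg (ga + U_(j))%MM))).
      rewrite exchange_big big1 // => i _; rewrite -mulr_sumr (gendeg_th gdg) // mulr0 //.
    move=> j _; rewrite /cc rmorph_sum mulr_suml; apply: eq_bigr => i _.
    by rewrite rmorphM mulrA; congr (_ * _); rewrite mulrC.
  rewrite (bigID (fun j => j \in F)) /= (bigD1 v) ?(subsetP TF) //= big1 ?addr0.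
    by rewrite /cc cP ?(subsetP TF) // eqxx mul1r -beE => ->.
  by move=> j /andP[jF jv]; rewrite /cc cP // (negbTE jv) mul0r tofrac0 mul0r.
have ex (j : 'I_n) : exists p : S, j \notin F -> dg (ga + U_(j))%MM * allbr%:K ^+ N = p%:K.
  case: (boolP (j \in F)) => jF; first by exists 0.
  have [||p pE] := IH (ga + U_(j))%MM; last by exists p.
    by rewrite mdegD mdeg1 addn1.
  rewrite msupportD msupport1 (_ : msupport ga = T).
    have jT : j \notin T by apply: contraNN jF; apply: subsetP.
    rewrite setUC cardsU1 jT add1n.
    have : (#|T| < n)%N.
      by rewrite -[X in (_ < X)%N](card_ord n) -cardsT proper_card // properT; apply: contraNneq jT => ->; rewrite inE.
    move: TN; rewrite ltnS; move: #|T| => t Hk tn; apply: leq_trans Hk; rewrite subnS prednK ?subn_gt0 //.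
  apply/setP => x; rewrite !inE /ga mnmBE mnm1E; case: (v =P x) => [<-|]; last by rewrite subn0.
  by rewrite subn_eq0 -ltnNge vb -lt0n (ltn_trans _ vb).
have [p pE] := fin_all_exists ex.
exists (- (rest * \sum_(j | j \notin F) cc j * p j)).
rewrite exprS {1}allE tofracM (mulrC (dg be)) -!mulrA.
transitivity (rest%:K * ((bracket k d F)%:K * dg be) * allbr%:K ^+ N); first by ring.
rewrite rel tofracN tofracM rmorph_sum mulrN mulNr -mulrA mulr_suml.
congr (- (_ * _)); apply: eq_bigr => j jF.
by rewrite -mulrA pE // rmorphM.
Qed.

Lemma deg_num : exists P : 'X_{1..n} -> S, forall be, mdeg be = d ->
  dg be * allbr%:K ^+ n.+1 = (P be)%:K.
Proof.
have ex be : exists p : S, (mdeg be == d) ==> (dg be * allbr%:K ^+ n.+1 == p%:K).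
  case: (mdeg be =P d) => bd; last by exists 0.
  have [|p pE] := deg_denominator (N := n.+1) bd; last by exists p; apply/eqP.
  by rewrite ltnS leq_subr.
exists (fun be => xchoose (ex be)) => be bd.
by apply/eqP; have /implyP := xchooseP (ex be); apply; apply/eqP.
Qed.

End Eval.

(** * Gram matrices *)

(** A nonzero minor of maximal size of [map_mx g M] comes from a minor of [M] that is nonzero, and
    stays so under the injective [f]. *)
Lemma mxrank_specialize (S : comNzRingType) (K1 K2 : fieldType) (f : {rmorphism S -> K1})
  (g : {rmorphism S -> K2}) m n (A : 'M[K1]_(m, n)) (B : 'M[K2]_(m, n)) :
  injective f -> (forall i j, exists p, A i j = f p /\ B i j = g p) -> (\rank B <= \rank A)%N.
Proof.
move=> fI AB; have [M MP] : exists M : 'M[S]_(m, n), A = map_mx f M /\ B = map_mx g M.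
  have [p pP] := fin_all_exists (fun x : 'I_m * 'I_n => AB x.1 x.2).
  exists (\matrix_(i, j) p (i, j)); split; apply/matrixP => i j; rewrite !mxE.
    by have [] := pP (i, j).
  by have [] := pP (i, j).
case: MP => -> ->; set r := \rank _.
pose f1 := maxrankfun (map_mx g M); pose B1 := rowsub f1 (map_mx g M).
have B1f : row_full B1^T by rewrite /row_full mxrank_tr; apply: maxrowsub_free.
pose f2 := fullrankfun B1f.
have : rowsub f2 B1^T \in unitmx by apply: fullrowsub_unit.
have -> : rowsub f2 B1^T = map_mx g (mxsub f1 f2 M)^T by apply/matrixP => i j; rewrite !mxE.
rewrite unitmxE det_map_mx unitfE => nz.
have : \det (map_mx f (mxsub f1 f2 M)^T) != 0.
  rewrite det_map_mx; apply: contraNneq nz => E.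
  have/fI -> : f (\det (mxsub f1 f2 M)^T) = f 0 by rewrite rmorph0.
  by rewrite rmorph0.
rewrite -unitfE -unitmxE -row_free_unit => /eqP E; rewrite -[X in (X <= _)%N]E.
have -> : map_mx f (mxsub f1 f2 M)^T = rowsub f2 (rowsub f1 (map_mx f M))^T.
  by apply/matrixP => i j; rewrite !mxE.
by apply: leq_trans (mxrankS (rowsub_sub _ _)) _; rewrite mxrank_tr; apply: mxrankS; apply: rowsub_sub.
Qed.

Section Homog.
Variables (n : nat) (L : fieldType).
Implicit Types (p r : {mpoly L[n]}).

Lemma is_homogP j p : is_homog j p <-> p \is j.-homog.
Proof.
split=> [hp|/dhomogP hp m]; last by rewrite -mcoeff_msupp => /hp.
by apply/dhomogP => m; rewrite mcoeff_msupp => /hp.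
Qed.
Lemma homogM i j p r : is_homog i p -> is_homog j r -> is_homog (i + j) (p * r).
Proof. by move=> /is_homogP hp /is_homogP hr; apply/is_homogP; apply: dhomogM. Qed.
Lemma homog_exp i j p : is_homog i p -> is_homog (i * j) (p ^+ j).
Proof. by move=> /is_homogP hp; apply/is_homogP; apply: dhomogMn. Qed.
Lemma homog0 i : is_homog i (0 : {mpoly L[n]}).
Proof. by move=> m; rewrite mcoeff0 eqxx. Qed.
Lemma homogDn i p r : is_homog i p -> is_homog i r -> is_homog i (p + r).
Proof. by move=> /is_homogP hp /is_homogP hr; apply/is_homogP; apply: rpredD. Qed.
Lemma homog_sum (J : Type) (s : seq J) (P : pred J) (F : J -> {mpoly L[n]}) i :
  (forall j, P j -> is_homog i (F j)) -> is_homog i (\sum_(j <- s | P j) F j).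
Proof. by move=> hF; elim/big_ind: _ => //; [apply: homog0 | apply: homogDn]. Qed.
Lemma homog_ell : is_homog 1 (ell L n).
Proof. by apply: homog_sum => j _; have := @homogX n L U_(j)%MM; rewrite mdeg1. Qed.
End Homog.

Section Gram.
Variables (n d : nat) (L : fieldType) (dg : 'X_{1..n} -> L) (q : nat).
Hypothesis qd : (2 * q <= d)%N.
Implicit Types (a b y : {mpoly L[n]}).
Local Notation deg := (dgp d dg).

Definition nullN a := forall b, is_homog (d - q) b -> deg (a * b) = 0.

Definition indepN m (V : 'I_m -> {mpoly L[n]}) :=
  forall c : 'I_m -> L, nullN (\sum_i c i *: V i) -> forall i, c i = 0.
Definition spanN m (V : 'I_m -> {mpoly L[n]}) :=
  forall a, is_homog q a -> exists c : 'I_m -> L, nullN (a - \sum_i c i *: V i).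

Definition gram y m (V : 'I_m -> {mpoly L[n]}) : 'M[L]_m :=
  \matrix_(i, j) deg (y ^+ (d - 2 * q) * V i * V j).

Lemma gram_entry_homog y b : is_homog 1 y -> is_homog q b -> is_homog (d - q) (y ^+ (d - 2 * q) * b).
Proof.
move=> hy hb; have -> : (d - q = 1 * (d - 2 * q) + q)%N.
  by rewrite mul1n addnBAC // mul2n -addnn subnDr.
by apply: homogM => //; apply: homog_exp.
Qed.

Lemma gram_change y m V m' (W : 'I_m' -> {mpoly L[n]}) (T : 'M[L]_(m', m)) :
  is_homog 1 y -> (forall i, is_homog q (V i)) -> (forall i, is_homog q (W i)) ->
  (forall i, nullN (W i - \sum_j T i j *: V j)) ->
  gram y W = T *m gram y V *m T^T.
Proof.
move=> hy hV hW TE; apply/matrixP => i j; rewrite !mxE.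
have h1 := gram_entry_homog hy (hW i).
have h2 l : is_homog (d - q) (y ^+ (d - 2 * q) * V l) by apply: gram_entry_homog.
transitivity (deg (y ^+ (d - 2 * q) * W i * \sum_l T j l *: V l)).
  apply/eqP; rewrite -subr_eq0 -dgpB -mulrBr mulrC; apply/eqP; exact: TE.
rewrite mulr_sumr dgp_sum; apply: eq_bigr => l _; rewrite -scalerAr dgpZ mulrC !mxE.
congr (_ * _); transitivity (deg ((\sum_s T i s *: V s) * (y ^+ (d - 2 * q) * V l))).
  apply/eqP; rewrite -subr_eq0 -dgpB; apply/eqP; rewrite -(TE i _ (h2 l)); congr deg.
  by rewrite mulrBl; congr (_ - _); ring.
rewrite mulr_suml dgp_sum; apply: eq_bigr => s _; rewrite mxE -scalerAl dgpZ.
by congr (_ * deg _); ring.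
Qed.

Lemma span_coef m V m' (W : 'I_m' -> {mpoly L[n]}) : spanN V -> (forall i, is_homog q (W i)) ->
  exists T : 'M[L]_(m', m), forall i, nullN (W i - \sum_j T i j *: V j).
Proof.
move=> sV hW; have [T TP] := fin_all_exists (fun i => sV _ (hW i)).
exists (\matrix_(i, j) T i j) => i; under eq_bigr => j _ do rewrite mxE.
exact: TP.
Qed.

(** Nothing is asked of [W] beyond its degree: a nonzero determinant on the left forces both [t] and
    the determinant for [V] to be nonzero. *)
Lemma gram_det y m (V W : 'I_m -> {mpoly L[n]}) : is_homog 1 y -> spanN V ->
  (forall i, is_homog q (V i)) -> (forall i, is_homog q (W i)) ->
  exists t, \det (gram y W) = t ^+ 2 * \det (gram y V).
Proof.
move=> hy sV hV hW; have [T TE] := span_coef sV hW.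
exists (\det T); rewrite (gram_change hy hV hW TE) !det_mulmx det_tr; ring.
Qed.

End Gram.

Section GramGood.
Variables (n d : nat) (L : fieldType) (D : {set {set 'I_n}}) (e : {set 'I_n} -> L).
Hypotheses (gD : good d D e) (d2 : (1 < d)%N).
Variable mu : 'I_n -> 'I_d -> L.
Hypothesis indep : lsop D mu.
Variable dg : 'X_{1..n} -> L.
Hypothesis dgP : degcond D mu dg.
Variable q : nat.
Hypothesis qd : (2 * q <= d)%N.
Implicit Types (G H T F : {set 'I_n}) (be ga : 'X_{1..n}) (a b y p r : {mpoly L[n]}).
Local Notation deg := (dgp d dg).
Local Notation M := (deg_mx d D dg q).

Let qled : (q <= d)%N.
Proof. by apply: leq_trans qd; rewrite leq_pmull. Qed.

(** Repeated vertices are traded for vertices outside the support as in [one_dim_X], so the face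
    monomials span the complementary degree modulo the ideal. *)
Lemma nullN_squarefree a :
  (forall G, G \in D -> (#|G| + q)%N = d -> deg ('X_[mset G] * a) = 0) -> nullN d dg q a.
Proof.
move=> a0; suff X be : mdeg be = (d - q)%N -> deg ('X_[be] * a) = 0.
  move=> b hb; rewrite mulrC (mpolyE b) mulr_suml dgp_sum big_seq big1 // => m.
  by rewrite mcoeff_msupp => /hb mb; rewrite -scalerAl dgpZ X // mulr0.
elim: {be}_.+1 {-2}be (ltnSn (n - #|msupport be|)) => // k IH be Hk bq.
set T := msupport be in Hk.
have cl := good_closed gD.
have [TD|TD] := boolP (T \in D); last first.
  by apply: (dgp_inJ dgP); rewrite mulrC; apply: (inJM cl); apply: inJ_X.
have [/existsP[v vb]|] := boolP [exists v, (1 < be v)%N]; last first.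
  rewrite negb_exists => /forallP sqf.
  have b1 i : (be i <= 1)%N by have := sqf i; rewrite -leqNgt.
  rewrite -(mset_supp b1); apply: a0 => //.
  by rewrite -mdeg_mset (mset_supp b1) bq subnK.
have vT : v \in T by rewrite inE -lt0n (ltn_trans _ vb).
pose ga := (be - U_(v))%MM.
have beE : be = (ga + U_(v))%MM by rewrite /ga msubK // (ltn_trans _ vb).
have [c cP] := rewrite_vertex gD indep set0 ga TD vT.
rewrite star_cx0 -beE in cP.
have := dgp_inJ dgP (inJM cl a cP); rewrite mulrDr dgpD mulrC => /eqP.
rewrite addr_eq0 => /eqP ->; rewrite mulr_sumr dgp_sum big1 ?oppr0 // => j jT.
rewrite -scalerAr dgpZ mulrC [a * _]mulrC IH ?mul0r //; last first.
  by rewrite mdegD mdeg1 -bq beE mdegD mdeg1.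
have sT : msupport ga = T.
  apply/setP => x; rewrite !inE /ga mnmBE mnm1E; case: (v =P x) => [<-|]; last by rewrite subn0.
  by rewrite subn_eq0 -ltnNge vb -lt0n (ltn_trans _ vb).
rewrite msupportD msupport1 sT setUC cardsU1 jT add1n.
have : (#|T| < n)%N.
  by rewrite -[X in (_ < X)%N](card_ord n) -cardsT proper_card // properT; apply: contraNneq jT => ->; rewrite inE.
by move: Hk; rewrite ltnS; move: #|T| => t Hk tn; apply: leq_trans Hk; rewrite subnS prednK ?subn_gt0.
Qed.

Definition pol (w : 'rV[L]_#|{: 'X_{1..n < q.+1}}|) : {mpoly L[n]} :=
  \sum_(m : 'X_{1..n < q.+1} | mdeg m == q) w 0 (enum_rank m) *: 'X_[m].
Definition coefrow p : 'rV[L]_#|{: 'X_{1..n < q.+1}}| :=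
  \row_i p@_((enum_val i : 'X_{1..n < q.+1})).

Lemma pol_coefrow p : is_homog q p -> pol (coefrow p) = p.
Proof.
move=> hp; apply/mpolyP => m; rewrite raddf_sum /=.
have [mq|mq] := eqVneq (mdeg m) q; last first.
  rewrite big1 => [|m' /eqP m'q]; last first.
    rewrite mcoeffZ mcoeffX; case: eqP => [E|_]; rewrite ?mulr0 //.
    by move: mq; rewrite -E m'q eqxx.
  by apply/esym/eqP; apply: contraNT mq => /hp ->.
have mq' : (mdeg m < q.+1)%N by rewrite mq.
rewrite (bigD1 (BMultinom mq')) /= ?mq // mcoeffZ mcoeffX eqxx mulr1 big1 ?addr0.
  by rewrite mxE enum_rankK.
move=> m' /andP[_ m'm]; rewrite mcoeffZ mcoeffX.
by move: m'm; rewrite -val_eqE /= => /negbTE ->; rewrite mulr0.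
Qed.

Lemma nullN_mx w : nullN d dg q (pol w) <-> w *m M = 0.
Proof.
split=> [nw|w0].
  apply/rowP => i; rewrite -(enum_valK i) [RHS]mxE; set G := enum_val i.
  have [/andP[GD /eqP Gq]|no] := boolP ((G \in D) && (#|G| + q == d)%N).
    rewrite mul_deg_mx // mulrC; apply: nw.
    by rewrite -Gq addnK -mdeg_mset; apply: homogX.
  by rewrite mxE big1 // => j _; rewrite mxE /= enum_rankK (negbTE no) andbF mulr0.
apply: nullN_squarefree => G GD Gq.
by rewrite -(mul_deg_mx (D := D)) // w0 mxE.
Qed.

Lemma coefrow_sum m (c : 'I_m -> L) (V : 'I_m -> {mpoly L[n]}) :
  coefrow (\sum_i c i *: V i) = (\row_i c i) *m \matrix_i coefrow (V i).
Proof.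
apply/rowP => j; rewrite !mxE raddf_sum; apply: eq_bigr => i _ /=.
by rewrite mcoeffZ !mxE.
Qed.

Lemma indep_rank m (V : 'I_m -> {mpoly L[n]}) : (forall i, is_homog q (V i)) ->
  indepN d dg q V -> (m <= \rank M)%N.
Proof.
move=> hV iV; suff : row_free ((\matrix_i coefrow (V i)) *m M).
  by rewrite /row_free => /eqP <-; apply: mxrankM_maxr.
rewrite -kermx_eq0; apply/eqP/row_matrixP => i0; rewrite row0; set v := row i0 _.
have v0 : v *m ((\matrix_i coefrow (V i)) *m M) = 0 by rewrite -row_mul mulmx_ker row0.
apply/rowP => i; rewrite [RHS]mxE; apply: (iV (fun i => v 0 i)).
rewrite -(pol_coefrow (homog_sum (fun j _ => homogZ (hV j)))); apply/nullN_mx.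
rewrite coefrow_sum -mulmxA -[RHS]v0; congr (_ *m _).
by apply/rowP => j; rewrite mxE.
Qed.

Lemma span_rank m (V : 'I_m -> {mpoly L[n]}) : (forall i, is_homog q (V i)) ->
  spanN d dg q V -> (\rank M <= m)%N.
Proof.
move=> hV sV; suff sub : (M <= (\matrix_i coefrow (V i)) *m M)%MS.
  exact: leq_trans (mxrankS sub) (leq_trans (mxrankM_maxl _ _) (rank_leq_row _)).
apply/row_subP => i; set x : 'X_{1..n < q.+1} := enum_val i.
have [xq|xq] := eqVneq (mdeg x) q; last first.
  by rewrite (_ : row i M = 0) ?sub0mx //; apply/rowP => j; rewrite !mxE /= (negbTE xq).
have hx : is_homog q ('X_[x] : {mpoly L[n]}) by have := @homogX n L x; rewrite xq.
have [c] := sV _ hx; rewrite -(pol_coefrow (homogB hx (homog_sum (fun j _ => homogZ (hV j))))).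
rewrite nullN_mx (_ : coefrow _ = coefrow 'X_[x] - coefrow (\sum_j c j *: V j)).
  rewrite coefrow_sum mulmxBl => /eqP; rewrite subr_eq0 => /eqP E.
  rewrite rowE (_ : delta_mx 0 i = coefrow 'X_[x]) ?E -?mulmxA ?submxMl //.
  apply/rowP => j; rewrite !mxE eqxx /= mcoeffX /x val_eqE (inj_eq enum_val_inj) eq_sym //.
by apply/rowP => j; rewrite !mxE mcoeffB.
Qed.

(** Rows of the pairing matrix are indexed by monomials, so a maximal free set of rows is a monomial
    basis. Monomials, unlike a general basis, have a meaning for all parameters at once. *)
Lemma rank_basis : exists al : 'I_(\rank M) -> 'X_{1..n}, [/\ forall i, mdeg (al i) = q,
  indepN d dg q (fun i => 'X_[al i]) & spanN d dg q (fun i => 'X_[al i])].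
Proof.
pose x i : 'X_{1..n < q.+1} := enum_val (maxrankfun M i).
have xE i : coefrow 'X_[x i] = delta_mx 0 (maxrankfun M i).
  by apply/rowP => j; rewrite !mxE eqxx /= mcoeffX /x val_eqE (inj_eq enum_val_inj) eq_sym.
have CE : (\matrix_i coefrow 'X_[x i]) *m M = rowsub (maxrankfun M) M.
  by apply/row_matrixP => i; rewrite row_mul rowK xE -rowE row_rowsub.
have xq i : mdeg (x i) = q.
  apply/eqP; apply: contraT => xq.
  have r0 : row i (rowsub (maxrankfun M) M) = 0.
    by apply/rowP => j; rewrite !mxE /= -/(x i) (negbTE xq).
  have E : (delta_mx 0 i : 'rV_(\rank M)) *m rowsub (maxrankfun M) M = 0 *m rowsub (maxrankfun M) M.
    by rewrite -rowE r0 mul0mx.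
  have /rowP/(_ i) := row_free_inj (maxrowsub_free M) E; rewrite !mxE !eqxx /= => /eqP.
  by rewrite oner_eq0.
have hx i : is_homog q ('X_[x i] : {mpoly L[n]}) by have := @homogX n L (x i); rewrite xq.
exists (fun i => x i); split=> //.
  move=> c; rewrite -(pol_coefrow (homog_sum (fun j _ => homogZ (hx j)))) nullN_mx.
  rewrite coefrow_sum -mulmxA CE -[RHS](mul0mx _ (rowsub (maxrankfun M) M)).
  by move/(row_free_inj (maxrowsub_free M))/rowP => E i; have := E i; rewrite !mxE.
move=> a ha.
have : (coefrow a *m M <= rowsub (maxrankfun M) M)%MS by rewrite eq_maxrowsub submxMl.
case/submxP => c E; exists (fun i => c 0 i).
rewrite -(pol_coefrow (homogB ha (homog_sum (fun j _ => homogZ (hx j))))) nullN_mx.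
rewrite (_ : coefrow _ = coefrow a - coefrow (\sum_j c 0 j *: 'X_[x j])).
  rewrite coefrow_sum mulmxBl -mulmxA CE E; apply/eqP; rewrite subr_eq0; apply/eqP.
  by congr (_ *m _); apply/rowP => j; rewrite mxE.
by apply/rowP => j; rewrite !mxE mcoeffB.
Qed.

Lemma nullN_inN a : is_homog q a -> inN D (linsys mu) q a <-> nullN d dg q a.
Proof.
move=> ha; have hab b : is_homog (d - q) b -> is_homog d (a * b).
  by move=> hb; rewrite -(subnKC qled); apply: homogM.
split=> [[_ aN] b hb|aN].
  by apply/(inJ_dgp gD d2 indep dgP (hab b hb)); apply: aN.
by split=> // b hb; apply/(inJ_dgp gD d2 indep dgP (hab b hb)); apply: aN.
Qed.

(** If [a] is in the kernel of the Gram matrix, then [y ^+ (d - 2 * q) * a] is null against degree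
    [q], and the injectivity half of the Lefschetz property makes [a] null. *)
Lemma SLP_gram m (V : 'I_m -> {mpoly L[n]}) : SLP D (linsys mu) q ->
  (forall i, is_homog q (V i)) -> indepN d dg q V -> spanN d dg q V ->
  exists y, is_homog 1 y /\ \det (gram d dg q y V) != 0.
Proof.
case=> y [hy [yinj _]] hV iV sV; exists y; split=> //.
rewrite -unitfE -unitmxE -row_free_unit -kermx_eq0; apply/eqP/row_matrixP => i0; rewrite row0.
set v := row i0 _.
have v0 : v *m gram d dg q y V = 0 by rewrite -row_mul mulmx_ker row0.
pose a := \sum_i v 0 i *: V i.
have ha : is_homog q a by apply: homog_sum => j _; apply: homogZ.
have hya := gram_entry_homog qd hy ha.
apply/rowP => i; rewrite [RHS]mxE; apply: (iV (fun i => v 0 i)).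
apply/(nullN_inN ha); apply: yinj => //; split=> // z; rewrite subKn // => hz.
have hyz : is_homog d (y ^+ (d - 2 * q) * a * z) by rewrite -[X in is_homog X](subnK qled); apply: homogM.
apply/(inJ_dgp gD d2 indep dgP hyz).
have [c cN] := sV z hz.
have := cN _ hya; rewrite mulrBl dgpB mulrC => /eqP; rewrite subr_eq0 => /eqP ->.
rewrite mulr_suml dgp_sum big1 // => j _; rewrite -scalerAl dgpZ.
suff -> : deg (V j * (y ^+ (d - 2 * q) * a)) = (v *m gram d dg q y V) 0 j.
  by rewrite v0 mxE mulr0.
rewrite [RHS]mxE /a !mulr_sumr dgp_sum; apply: eq_bigr => l _; rewrite [gram _ _ _ _ _ _ _]mxE.
by rewrite -!scalerAr dgpZ; congr (_ * deg _); ring.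
Qed.

End GramGood.

(** * Specialization *)

Section Substitution.
Variables (k : fieldType) (d n : nat) (R : comNzRingType) (f : {rmorphism k -> R})
  (v : 'I_n -> 'I_d -> R).

Definition substh (x : 'I_(d * n)) : R := mxvec (\matrix_(i < d, j < n) v j i) 0 x.

Definition subst : {rmorphism {mpoly k[d * n]} -> R} := mmap f substh.

Lemma substX j i : subst (xvar k j i) = v j i.
Proof. by rewrite /subst /= /xvar mmapX mmap1U /substh mxvecE mxE. Qed.

Lemma substC c : subst c%:MP = f c.
Proof. exact: mmapC. Qed.
End Substitution.

(** The zigzag requires [q > 0]. In degree 0 only the row of the monomial 1 can be nonzero, and a
    facet shows that it is. *)
Lemma rank_deg_mx0 n d (L : fieldType) (D : {set {set 'I_n}}) (dg dg' : 'X_{1..n} -> L) F :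
  F \in D -> #|F| = d -> dg' (mset F) != 0 -> (\rank (deg_mx d D dg 0) <= \rank (deg_mx d D dg' 0))%N.
Proof.
move=> FD Fd nz.
have rows0 (g : 'X_{1..n} -> L) i : i != enum_rank (@bm0 n 0) -> row i (deg_mx d D g 0) = 0.
  move=> i0; apply/rowP => j; rewrite !mxE /= ifN // negb_and; apply/orP; left.
  apply: contraNneq i0 => /eqP; rewrite mdeg_eq0 => /eqP E.
  by rewrite -(enum_valK i); apply/eqP; congr enum_rank; apply/val_inj.
apply: (@leq_trans 1).
  apply: leq_trans (rank_leq_row (row (enum_rank (@bm0 n 0)) (deg_mx d D dg 0))).
  apply: mxrankS; apply/row_subP => i; have [->|i0] := eqVneq i (enum_rank (@bm0 n 0)).
    exact: submx_refl.
  by rewrite (rows0 _ _ i0) sub0mx.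
rewrite lt0n mxrank_eq0; apply: contraNneq nz => /matrixP/(_ (enum_rank (@bm0 n 0)) (enum_rank F)).
by rewrite !mxE /= !enum_rankK mdeg0 FD Fd addn0 !eqxx add0m => /= ->.
Qed.

Section Specialization.
Variables (k : fieldType) (d n : nat) (D : {set {set 'I_n}}).
Local Notation S := {mpoly k[d * n]}.
Local Notation K := (Kf k (d * n)).
Local Notation "x %:K" := (FracField.tofrac (x : S) : K) (at level 2).
Local Notation E := (allbr k d D).
Variables (e : {set 'I_n} -> K) (gD : good d D e) (d2 : (1 < d)%N).
Variables (dg : 'X_{1..n} -> K) (gdg : gendeg D dg).
Variables (P : 'X_{1..n} -> S).
Hypothesis PE : forall be, mdeg be = d -> dg be * E%:K ^+ n.+1 = (P be)%:K.
Variable q : nat.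
Hypothesis qd : (2 * q <= d)%N.

Lemma tofracI : injective (@FracField.tofrac S).
Proof. by move=> x y /eqP; rewrite tofrac_eq => /eqP. Qed.

Definition tofracm : {rmorphism S -> K} := @FracField.tofrac S.

Lemma degcond_gen : E != 0 -> degcond D (evpar tofracm) dg.
Proof.
move=> E0; split.
- by move=> be i bd; rewrite -[RHS](gendeg_th gdg i bd).
- exact: gendeg_nonface gdg.
move=> F FD Fd; have [b] := gendeg_facet gdg FD Fd.
by apply: contra_eq_neq => ->; rewrite mul0r eq_sym signr_eq0.
Qed.

Lemma P_th be i : (mdeg be).+1 = d -> \sum_j xvar k j i * P (be + U_(j))%MM = 0.
Proof.
move=> bd; apply: tofracI; rewrite rmorph_sum rmorph0 /=.
transitivity ((\sum_j avar k i j * dg (be + U_(j))%MM) * E%:K ^+ n.+1).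
  rewrite mulr_suml; apply: eq_bigr => j _; rewrite rmorphM -mulrA PE //.
  by rewrite mdegD mdeg1 addn1.
by rewrite (gendeg_th gdg) // mul0r.
Qed.

Lemma P_nonface al : mdeg al = d -> msupport al \notin D -> P al = 0.
Proof.
move=> ad aD; apply: tofracI; rewrite -PE // (gendeg_nonface gdg) // mul0r.
by rewrite rmorph0.
Qed.

Lemma P_facet F : F \in D -> #|F| = d ->
  exists b : bool, P (mset F) * bracket k d F = (-1) ^+ b * E ^+ n.+1.
Proof.
move=> FD Fd; have [b bE] := gendeg_facet gdg FD Fd; exists b; apply: tofracI.
by rewrite !rmorphM /= -PE ?mdeg_mset // mulrAC bE !rmorphXn rmorphN rmorph1.
Qed.

Section Ev.
Variables (L : fieldType) (ev : {rmorphism S -> L}).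
Hypothesis evE : ev E != 0.

(** [ev] is not defined on fractions, so the degree map is specialized through the numerators [P]
    over the power of [E] that clears all denominators. *)
Definition dgev be : L := ev (P be) / ev E ^+ n.+1.

Lemma degcond_ev : degcond D (evpar ev) dgev.
Proof.
split.
- move=> be i bd; rewrite /dgev; under eq_bigr => j _ do rewrite mulrA -rmorphM.
  by rewrite -mulr_suml -rmorph_sum P_th // rmorph0 mul0r.
- by move=> al ad aD; rewrite /dgev P_nonface // rmorph0 mul0r.
move=> F FD Fd; have [b bE] := P_facet FD Fd.
rewrite /dgev mulf_neq0 // ?invr_neq0 ?expf_neq0 //.
have : ev (P (mset F) * bracket k d F) != 0.
  by rewrite bE rmorphM rmorphXn rmorphN rmorph1 rmorphXn mulf_neq0 ?signr_eq0 // expf_neq0.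
by rewrite rmorphM mulf_eq0 negb_or => /andP[].
Qed.

(** The Gram matrix for [ell] with denominators cleared. The power of [ell] has coefficients in [k],
    so one polynomial matrix serves all specializations. *)
Definition gram_num m (al : 'I_m -> 'X_{1..n}) : 'M[S]_m :=
  \matrix_(i, j) \sum_(x : 'X_{1..n < d.+1} | mdeg x == d)
     ((ell k n ^+ (d - 2 * q) * 'X_[al i] * 'X_[al j])@_x)%:MP * P x.

Lemma gram_ev m (al : 'I_m -> 'X_{1..n}) :
  gram d dgev q (ell L n) (fun i => 'X_[al i]) = (ev E ^+ n.+1)^-1 *: map_mx ev (gram_num al).
Proof.
apply/matrixP => i j; rewrite !mxE rmorph_sum mulr_sumr /dgp; apply: eq_bigr => x _.
pose fC : {rmorphism k -> L} := ev \o @mpolyC (d * n) k.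
have -> : ell L n ^+ (d - 2 * q) * 'X_[al i] * 'X_[al j] =
    map_mpoly fC (ell k n ^+ (d - 2 * q) * 'X_[al i] * 'X_[al j]).
  rewrite !rmorphM rmorphXn /= !map_mpolyX /ell rmorph_sum /=.
  by under [in RHS]eq_bigr => l _ do rewrite map_mpolyX.
rewrite mcoeff_map_mpoly rmorphM /= /dgev mulrA mulrC //.
Qed.

Lemma gram_ev_neq0 m (al : 'I_m -> 'X_{1..n}) :
  (\det (gram d dgev q (ell L n) (fun i => 'X_[al i])) != 0) = (ev (\det (gram_num al)) != 0).
Proof.
rewrite gram_ev detZ det_map_mx mulf_eq0 negb_or.
by rewrite expf_neq0 // invr_neq0 // expf_neq0.
Qed.
End Ev.

Lemma rank_deg_ev (L : fieldType) (ev : {rmorphism S -> L}) : E != 0 -> ev E != 0 ->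
  (\rank (deg_mx d D (dgev ev) q) <= \rank (deg_mx d D dg q))%N.
Proof.
move=> E0 evE.
have E1 : E%:K ^+ n.+1 != 0 by rewrite expf_neq0 // tofrac_eq0.
have -> : \rank (deg_mx d D dg q) = \rank (E%:K ^+ n.+1 *: deg_mx d D dg q).
  by rewrite eqmx_scale.
have -> : \rank (deg_mx d D (dgev ev) q) = \rank (ev E ^+ n.+1 *: deg_mx d D (dgev ev) q).
  by rewrite eqmx_scale // expf_neq0.
apply: (mxrank_specialize (f := tofracm) (g := ev)); first exact: tofracI.
move=> i j; rewrite !mxE /=; case: ifP => [/and3P[/eqP iq _ /eqP jq]|_].
  eexists (P _); rewrite mulrC PE; last by rewrite mdegD mdeg_mset iq addnC.
  by rewrite /dgev mulrC divfK // expf_neq0.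
by exists 0; rewrite !mulr0 !rmorph0.
Qed.

(** The target of [ev] is [K] itself, so the same [bd_mx] occurs in both rank formulas and only the
    subtracted ranks have to be compared. Together with [rank_deg_ev] this gives equality. *)
Lemma rank_const (ev : {rmorphism S -> K}) : E != 0 -> ev E != 0 ->
  (\rank (deg_mx d D dg q) <= \rank (deg_mx d D (dgev ev) q))%N.
Proof.
move=> E0 evE; have [q0|q0] := posnP q.
  have [F [FD Fd]] := good_facet gD.
  rewrite q0; apply: (rank_deg_mx0 _ FD Fd).
  by have [_ _ ->] := degcond_ev evE.
have tE : tofracm E != 0 by rewrite tofrac_eq0.
rewrite (rank_deg_mx gD d2 (ev_lsop gD tE) (degcond_gen E0) q0).
rewrite (rank_deg_mx gD d2 (ev_lsop gD evE) (degcond_ev evE) q0).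
apply: leq_sub2l; apply: (mxrank_specialize (f := tofracm) (g := ev)); first exact: tofracI.
pose rel (x y : K) := exists p : S, x = tofracm p /\ y = ev p.
have rel0 : rel 0 0 by exists 0; rewrite !rmorph0.
have relD x y x' y' : rel x y -> rel x' y' -> rel (x + x') (y + y').
  by move=> [p [-> ->]] [p' [-> ->]]; exists (p + p'); rewrite !rmorphD.
have relM x y x' y' : rel x y -> rel x' y' -> rel (x * x') (y * y').
  by move=> [p [-> ->]] [p' [-> ->]]; exists (p * p'); rewrite !rmorphM.
have rel_sum (J : finType) (A B : J -> K) : (forall j, rel (A j) (B j)) ->
    rel (\sum_j A j) (\sum_j B j).
  by move=> AB; elim/big_ind2: _ => // x y x' y'; apply: relD.
have relS m : rel ((-1) ^+ m) ((-1) ^+ m).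
  by exists ((-1) ^+ m); rewrite !rmorphXn !rmorphN !rmorph1.
have relb (b : bool) : rel b%:R b%:R by exists b%:R; rewrite !rmorph_nat.
move=> i j; rewrite !mxE; apply: (rel_sum _ _ _) => l; apply: (relM _ _ _ _).
  rewrite !mxE /=; case: ifP => // _; rewrite /bd; apply: (rel_sum _ _ _) => x; rewrite /io.
  by case: ifP => // _; apply: relM.
rewrite !mxE /=; case: ifP => // _; rewrite /ioV; apply: (rel_sum _ _ _) => x; apply: (relM _ _ _ _).
  by exists (xvar k (enum_val j).1 x).
by rewrite /io; case: ifP => // _; apply: relM.
Qed.

End Specialization.

Section MonomialValue.
Variables (n : nat) (L : fieldType) (c : 'I_n -> L).

Definition monom_at (m : 'X_{1..n}) : L := \prod_(j < n) c j ^+ m j.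

Lemma monom_atD m m' : monom_at (m + m') = monom_at m * monom_at m'.
Proof. by rewrite -big_split; apply: eq_bigr => j _; rewrite mnmDE exprD. Qed.

Lemma monom_atU j : monom_at U_(j) = c j.
Proof.
rewrite /monom_at (bigD1 j) //= mnm1E eqxx expr1 big1 ?mulr1 // => i ij.
by rewrite mnm1E eq_sym (negbTE ij) expr0.
Qed.
End MonomialValue.

(** * Rescaling of the variables *)

Section Scaling.
Variables (n d : nat) (L : fieldType) (D : {set {set 'I_n}}) (e : {set 'I_n} -> L).
Hypotheses (gD : good d D e) (d2 : (1 < d)%N).
Variable mu : 'I_n -> 'I_d -> L.
Hypothesis indep : lsop D mu.

Lemma deg_unique dg dg' : degcond D mu dg -> degcond D mu dg' ->
  exists l, l != 0 /\ forall al, mdeg al = d -> dg' al = l * dg al.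
Proof.
move=> cd cd'; have [F0 [F0D F0d]] := good_facet gD.
have [[_ _ /(_ _ F0D F0d) nz] [_ _ /(_ _ F0D F0d) nz']] := (cd, cd').
exists (dg' (mset F0) / dg (mset F0)); split; first by rewrite mulf_neq0 ?invr_eq0.
move=> al ad; have hal : is_homog d ('X_[al] : {mpoly L[n]}) by have := @homogX n L al; rewrite ad.
have [|c] := one_dim gD d2 indep F0D F0d (sub0set _) _ hal; first by rewrite cards0.
rewrite star_cx0 setD0 => J.
have E g : degcond D mu g -> g al = c * g (mset F0).
  move=> cg; have := dgp_inJ cg J.
  by rewrite dgpB dgpZ !dgpX mdeg_mset ad F0d eqxx => /eqP; rewrite subr_eq0 => /eqP.
by rewrite (E _ cd) (E _ cd') mulrCA divfK // mulrC.
Qed.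

Section Rescale.
Variable c : 'I_n -> L.
Hypothesis c0 : forall j, c j != 0.
Variables (dg1 dg2 : 'X_{1..n} -> L).
Hypotheses (dg1P : degcond D mu dg1) (dg2P : degcond D (fun j i => mu j i / c j) dg2).

Lemma monom_at_neq0 m : monom_at c m != 0.
Proof. by apply/prodf_neq0 => j _; rewrite expf_neq0. Qed.

Definition rescale : {rmorphism {mpoly L[n]} -> {mpoly L[n]}} :=
  mmap (@mpolyC n L) (fun j => c j *: 'X_j).

Lemma rescaleX m : rescale 'X_[m] = monom_at c m *: 'X_[m].
Proof.
rewrite /rescale /= mmapX /mmap1 (eq_bigr (fun j => c j ^+ m j *: 'X_j ^+ m j)).
  by rewrite scaler_prod -mpolyXE_id.
by move=> j _; rewrite exprZn.
Qed.

Lemma rescaleZ a p : rescale (a *: p) = a *: rescale p.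
Proof. by rewrite -mul_mpolyC rmorphM /= mmapC mul_mpolyC. Qed.

Lemma deg_rescale : exists l, l != 0 /\ forall p, dgp d dg2 p = l * dgp d dg1 (rescale p).
Proof.
have cd : degcond D mu (fun al => dg2 al / monom_at c al).
  have [t1 t2 t3] := dg2P; split.
  - move=> be i bd.
    transitivity ((\sum_j mu j i / c j * dg2 (be + U_(j))%MM) / monom_at c be); last first.
      by rewrite t1 ?mul0r.
    rewrite mulr_suml; apply: eq_bigr => j _; rewrite monom_atD monom_atU.
    by rewrite invfM; ring.
  - by move=> al ad aD; rewrite t2 // mul0r.
  - by move=> F FD Fd; rewrite mulf_neq0 ?t3 // invr_eq0 monom_at_neq0.
have [l [l0 lE]] := deg_unique dg1P cd.
exists l; split=> // p.
rewrite (mpolyE p) rmorph_sum !dgp_sum mulr_sumr; apply: eq_bigr => m _.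
rewrite /= rescaleZ rescaleX !dgpZ !dgpX; case: eqP => [md|_]; last by rewrite !mulr0.
rewrite -[dg2 m](divfK (monom_at_neq0 m)) lE //; ring.
Qed.

(** Substituting [c j *: 'X_j] for ['X_j] turns the parameters [mu j i / c j] into [mu j i], turns
    [ell] into the form with coefficients [c], and multiplies each monomial of the basis by a
    nonzero scalar. *)
Lemma gram_rescale q m (al : 'I_m -> 'X_{1..n}) :
  \det (gram d dg2 q (ell L n) (fun i => 'X_[al i])) = 0 ->
  \det (gram d dg1 q (\sum_j c j *: 'X_j) (fun i => 'X_[al i])) = 0.
Proof.
have [l [l0 lE]] := deg_rescale.
pose Dg := diag_mx (\row_i monom_at c (al i)).
have -> : gram d dg2 q (ell L n) (fun i => 'X_[al i]) =
    l *: (Dg *m gram d dg1 q (\sum_j c j *: 'X_j) (fun i => 'X_[al i]) *m Dg).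
  apply/matrixP => i j; rewrite mxE [RHS]mxE mul_mx_diag mxE mul_diag_mx !mxE lE.
  congr (_ * _); rewrite !rmorphM !rmorphXn /= !rescaleX.
  have -> : rescale (ell L n) = \sum_j c j *: 'X_j.
    by rewrite rmorph_sum; apply: eq_bigr => x _; rewrite /= rescaleX monom_atU.
  by rewrite -!scalerAr -!scalerAl !dgpZ; ring.
rewrite detZ !det_mulmx det_diag => /eqP.
rewrite !mulf_eq0 expf_eq0 (negbTE l0) andbF /=.
have /negbTE -> : \prod_i (\row_i monom_at c (al i)) 0 i != 0.
  by apply/prodf_neq0 => i _; rewrite mxE monom_at_neq0.
by rewrite orbF => /eqP.
Qed.
End Rescale.
End Scaling.

Lemma gram_pencil n d (L : fieldType) (dg : 'X_{1..n} -> L) q m (V : 'I_m -> {mpoly L[n]}) y z :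
  exists Q : {poly L}, forall s, \det (gram d dg q (y + s *: z) V) = Q.[s].
Proof.
set r := (d - 2 * q)%N.
pose M : 'M[{poly L}]_m := \matrix_(i, j) \sum_(l < r.+1)
  (dgp d dg (y ^+ (r - l) * z ^+ l * V i * V j) *+ 'C(r, l)) *: 'X^l.
exists (\det M) => s; rewrite -/(horner_eval s (\det M)) -det_map_mx.
congr (\det _); apply/matrixP => i j; rewrite !mxE exprDn !mulr_suml dgp_sum rmorph_sum.
apply: eq_bigr => l _; rewrite /= /horner_eval hornerZ hornerXn.
have -> : y ^+ (r - l) * (s *: z) ^+ l *+ 'C(r, l) * V i * V j =
   ('C(r, l)%:R * s ^+ l) *: (y ^+ (r - l) * z ^+ l * V i * V j).
  rewrite -!mul_mpolyC exprMn -mulr_natl rmorphM rmorph_nat rmorphXn /=.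
  by move: (y ^+ _) (s%:MP_[n] ^+ _) (z ^+ _) => a b c; ring.
by rewrite dgpZ -mulr_natl; ring.
Qed.

Lemma Kf_infinite (k : fieldType) N (s : seq (Kf k N)) : (0 < N)%N -> exists x, x \notin s.
Proof.
move=> N0; pose i0 := Ordinal N0.
pose t := [seq FracField.tofrac ('X_i0 ^+ j : {mpoly k[N]}) | j <- iota 0 (size s).+1].
have /allPn[x xt xs] : ~~ all (mem s) t; last by exists x.
apply/negP => /allP ts; have := uniq_leq_size (s1 := t) _ ts.
rewrite size_map size_iota ltnn => H; suff /H : uniq t by [].
rewrite map_inj_uniq ?iota_uniq // => i j /eqP; rewrite tofrac_eq => /eqP/mpolyP/(_ (U_(i0) *+ i)%MM).
rewrite !mcoeffXn eqxx; case: eqP => [/mnmP/(_ i0)|_ /eqP]; last by rewrite oner_eq0.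
by rewrite !mulmnE !mnm1E eqxx !mul1n.
Qed.

Lemma rmorph_bracket (k : fieldType) d n (R : comNzRingType) (f : {rmorphism {mpoly k[d * n]} -> R}) (F : {set 'I_n}) :
  f (bracket k d F) = \det (face_mx (fun (j : 'I_n) i => f (xvar k j i)) F).
Proof. by rewrite bracketE -det_map_mx map_face_mx. Qed.

Lemma subst_bracket (k : fieldType) d n (R : comNzRingType) (f : {rmorphism k -> R})
  (v : 'I_n -> 'I_d -> R) (F : {set 'I_n}) :
  subst f v (bracket k d F) = \det (face_mx v F : 'M[R]_d) :> R.
Proof.
rewrite rmorph_bracket; congr (\det _); apply/matrixP => i m; rewrite !mxE.
by congr nth; apply: eq_map => j; apply: substX.
Qed.

Lemma face_mx_scale_neq0 (L : fieldType) n d (mu : 'I_n -> 'I_d -> L) (c : 'I_n -> L) (F : {set 'I_n}) :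
  #|F| = d -> (forall j, c j != 0) -> \det (face_mx mu F) != 0 ->
  \det (face_mx (fun j i => mu j i / c j) F) != 0.
Proof.
move=> Fd c0; apply: contraNneq => E.
have -> : face_mx mu F = face_mx (fun j i => mu j i / c j) F *m
    diag_mx (\row_m c (enum_val (cast_ord (esym Fd) m))).
  apply/matrixP => i m; rewrite mul_mx_diag (face_mxE _ Fd) [RHS]mxE (face_mxE _ Fd) mxE.
  by rewrite divfK.
by rewrite det_mulmx E mul0r.
Qed.

(** * Parameters whose first row vanishes on a non-face *)

Section Hyperplane.
Variables (k : fieldType) (d n : nat) (d0 : (0 < d)%N).
Local Notation S := {mpoly k[d * n]}.
Implicit Types F H : {set 'I_n}.

(* Turns the generic parameters theta into theta_F, and kills the bracket of F. *)
Definition zeroF (F : {set 'I_n}) : {rmorphism S -> S} :=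
  subst (@mpolyC (d * n) k) (fun j i => if (val i == 0%N) && (j \in F) then 0 else xvar k j i).

Lemma zeroFX F j i : zeroF F (xvar k j i) = if (val i == 0%N) && (j \in F) then 0 else xvar k j i.
Proof. exact: substX. Qed.

Lemma zeroF_bracket F : #|F| = d -> zeroF F (bracket k d F) = 0.
Proof.
move=> Fd; rewrite subst_bracket (expand_det_row _ (Ordinal d0)) big1 // => m _.
by rewrite (face_mxE _ Fd) /= enum_valP mul0r.
Qed.

(** A vertex [h] of [H] outside [F] can carry the nonzero entry of the first row: evaluating at the
    matrix of a transposition that puts it there gives a sign. *)
Lemma zeroF_bracket_neq0 F H : #|F| = d -> #|H| = d -> H != F -> zeroF F (bracket k d H) != 0.
Proof.
move=> Fd Hd HF.
have [h hH hF] : exists2 h, h \in H & h \notin F.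
  by apply/subsetPn; apply: contraNN HF => sHF; rewrite eqEcard sHF Fd Hd leqnn.
pose i0 : 'I_d := Ordinal d0.
pose pos j := cast_ord Hd (enum_rank_in hH j).
pose s := tperm i0 (pos h).
have sK m : pos (enum_val (cast_ord (esym Hd) m)) = m.
  by rewrite /pos enum_valK_in cast_ordKV.
pose pt (j : 'I_n) (i : 'I_d) : k := ((j \in H) && (i == s (pos j)))%:R.
have ptF (i : 'I_d) j : val i == 0%N -> j \in F -> pt j i = 0.
  move=> /eqP iz jF; rewrite /pt; case: (boolP (j \in H)) => //= jH.
  have -> : i = i0 by apply: val_inj.
  rewrite -(inj_eq (@perm_inj _ s)) /s tpermK tpermL; case: eqP => // E.
  have : j = h.
    have := congr1 (fun x => enum_val (cast_ord (esym Hd) x)) E.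
    by rewrite /pos !cast_ordK !enum_rankK_in.
  by move=> jh; rewrite -jh jF in hF.
have : subst (idfun : {rmorphism k -> k}) pt (zeroF F (bracket k d H)) != 0.
  rewrite (rmorph_bracket (zeroF F)) -det_map_mx map_face_mx.
  have -> : face_mx (fun j i => subst (idfun : {rmorphism k -> k}) pt (zeroF F (xvar k j i))) H =
      (perm_mx s)^T.
    apply/matrixP => i m; rewrite (face_mxE _ Hd) !mxE zeroFX.
    set j := enum_val _; have -> : (s m == i)%:R = pt j i :> k.
      by rewrite /pt /j enum_valP sK eq_sym.
    case: ifP => [/andP[iz jF]|_]; last exact: substX.
    by rewrite rmorph0 ptF.
  by rewrite det_tr det_perm signr_eq0.
by apply: contraNneq => ->; rewrite rmorph0.
Qed.

Lemma zeroF_allbr (D : {set {set 'I_n}}) F : #|F| = d -> F \notin D -> zeroF F (allbr k d D) != 0.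
Proof.
move=> Fd FD; rewrite /allbr rmorph_prod; apply/prodf_neq0 => H /andP[HD /eqP Hd].
by apply: zeroF_bracket_neq0 => //; apply: contraNneq FD => <-.
Qed.
End Hyperplane.

Lemma many_elements (k : fieldType) N (N0 : (0 < N)%N) (s : seq (Kf k N)) m :
  exists t, [/\ uniq t, size t = m & {in t, forall x, x \notin s}].
Proof.
elim: m => [|m [t [ut st ts]]]; first by exists [::].
have [x] := Kf_infinite (s ++ t) N0; rewrite mem_cat negb_or => /andP[xs xt].
exists (x :: t); split; rewrite /= ?xt ?st //.
by move=> y; rewrite inE => /predU1P[->|/ts].
Qed.

Lemma homog1E n (L : fieldType) (y : {mpoly L[n]}) : is_homog 1 y -> y = \sum_j y@_U_(j) *: 'X_j.
Proof.
move=> hy; apply/mpolyP => m; rewrite raddf_sum /=.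
have [/eqP/mdeg1P[j /eqP ->]|m1] := eqVneq (mdeg m) 1%N.
  rewrite (bigD1 j) //= mcoeffZ mcoeffX eqxx mulr1 big1 ?addr0 // => i ij.
  by rewrite mcoeffZ mcoeffX eq_mnm1 (negbTE ij) mulr0.
rewrite big1 => [|j _]; first by apply/eqP; apply: contraNT m1 => /hy ->.
rewrite mcoeffZ mcoeffX; case: eqP => [E|_]; last by rewrite mulr0.
by move: m1; rewrite -E mdeg1.
Qed.

Section Specialize.
Variables (k : fieldType) (d n : nat) (D : {set {set 'I_n}}).
Local Notation S := {mpoly k[d * n]}.
Implicit Types F H : {set 'I_n}.
Local Notation K := (Kf k (d * n)).
Local Notation "x %:K" := (FracField.tofrac (x : S) : K) (at level 2).
Local Notation E := (allbr k d D).
Variables (e : {set 'I_n} -> K) (gD : good d D e) (d2 : (1 < d)%N).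
Variables (dg : 'X_{1..n} -> K) (gdg : gendeg D dg).
Variables (P : 'X_{1..n} -> S).
Hypothesis PE : forall be, mdeg be = d -> dg be * E%:K ^+ n.+1 = (P be)%:K.
Variable q : nat.
Hypothesis qd : (2 * q <= d)%N.
Variable F : {set 'I_n}.
Hypotheses (Fd : #|F| = d) (FD : F \notin D).
Hypothesis slp : SLP D (@thetaF k d n F) q.

Let d0 : (0 < d)%N := ltnW d2.
Definition ev_zeroF : {rmorphism S -> K} := tofracm k d n \o zeroF k d F.
Definition ev_scaled (c : 'I_n -> K) : {rmorphism S -> K} :=
  subst (tofracm k d n \o @mpolyC (d * n) k) (fun j i => (xvar k j i)%:K / c j) \o zeroF k d F.

Let E0 : E != 0.
Proof. by have := zeroF_allbr k d0 Fd FD; apply: contraNneq => ->; rewrite rmorph0. Qed.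

Let ev_zeroF_E : ev_zeroF E != 0.
Proof. by rewrite /ev_zeroF /= tofrac_eq0; apply: zeroF_allbr. Qed.

Lemma evpar_scaled c : evpar (ev_scaled c) = fun j i => evpar ev_zeroF j i / c j.
Proof.
apply: functional_extensionality => j; apply: functional_extensionality => i.
rewrite /evpar /ev_scaled /ev_zeroF /= zeroFX; case: ifP => _; last by rewrite substX.
by rewrite !rmorph0 mul0r.
Qed.

Lemma ev_scaled_E c : (forall j, c j != 0) -> ev_scaled c E != 0.
Proof.
move=> c0; rewrite ev_allbr_neq0; apply/forall_inP => H HD; apply/implyP => /eqP Hd.
have nz : ev_zeroF (bracket k d H) != 0.
  have z := ev_zeroF_E.
  rewrite (ev_allbr_neq0 D ev_zeroF) in z.
  move: (forall_inP z H HD).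
  by rewrite Hd (eqxx d).
rewrite ev_bracket in nz; rewrite ev_bracket evpar_scaled.
exact: (face_mx_scale_neq0 Hd c0 nz).
Qed.

Lemma linsys_zeroF : linsys (evpar ev_zeroF) = @thetaF k d n F.
Proof.
apply: functional_extensionality => i; rewrite /linsys /thetaF /theta /evpar.
case: ifPn => i0; last first.
  by apply: eq_bigr => j _; rewrite /= zeroFX (negbTE i0).
rewrite [RHS]big_mkcond; apply: eq_bigr => j _; rewrite /= zeroFX i0 /=.
by case: (j \in F); rewrite ?tofrac0 ?scale0r.
Qed.

(* Rescaling the variables turns ell into an arbitrary linear form with nonzero
   coefficients, so ell works as soon as some linear form does. *)
Lemma gram_ell_zeroF : exists r (al : 'I_r -> 'X_{1..n}), [/\ r = \rank (deg_mx d D dg q),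
  forall i, mdeg (al i) = q & zeroF k d F (\det (gram_num P q al)) != 0].
Proof.
have dgF := degcond_ev gdg PE ev_zeroF_E.
have lF := ev_lsop gD ev_zeroF_E.
have [al [alq alI alS]] := rank_basis gD lF dgF qd.
have hal i : is_homog q ('X_[al i] : {mpoly K[n]}) by have := @homogX n K (al i); rewrite alq.
exists _, al; split=> //.
  apply/eqP; rewrite eqn_leq (rank_deg_ev PE) //=.
  exact: (rank_const gD d2 gdg PE).
have [y [hy nz]] : exists y, is_homog 1 y /\ \det (gram d (dgev D P ev_zeroF) q y (fun i => 'X_[al i])) != 0.
  by apply: (SLP_gram gD d2 lF dgF qd _ hal alI alS); rewrite linsys_zeroF; exact: slp.
apply: contraNneq nz => g0.
(* If the numerator vanished under [zeroF], it would vanish after every further scaling, hence the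
   Gram determinant would be 0 for every linear form with nonzero coefficients. *)
have vanish c : (forall j, c j != 0) ->
    \det (gram d (dgev D P ev_zeroF) q (\sum_j c j *: 'X_j) (fun i => 'X_[al i])) = 0.
  move=> c0; have dgc := degcond_ev gdg PE (ev_scaled_E c0).
  rewrite evpar_scaled in dgc.
  apply: (gram_rescale gD d2 lF c0 dgF dgc).
  apply/eqP; apply: contraT; rewrite (gram_ev_neq0 P q (ev_scaled_E c0)).
  by rewrite /ev_scaled /= g0 rmorph0 eqxx.
(* On the line [y + s *: ell] only the values [- y@_U_(j)] of [s] give a zero coefficient; the
   determinant is polynomial in [s] and [K] is infinite, so it would vanish at [s = 0] too. *)
have [Q QE] := gram_pencil d (dgev D P ev_zeroF) q (fun i => 'X_[al i]) y (ell K n).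
have n0 : (0 < n)%N.
  have [F0 [_ F0d]] := good_facet gD; rewrite -(card_ord n).
  by apply: leq_trans (max_card (mem F0)); rewrite F0d.
have dn0 : (0 < d * n)%N by rewrite muln_gt0 d0.
suff Q0 : Q = 0.
  by have := QE 0; rewrite scale0r addr0 Q0 horner0 => ->.
apply/eqP; apply: contraT => Qn0.
have [t [ut st ts]] := many_elements dn0 [seq - y@_U_(j) | j : 'I_n] (size Q).
have : all (root Q) t.
  apply/allP => s /ts sn; rewrite /root -QE; apply/eqP.
  have -> : y + s *: ell K n = \sum_j (y@_U_(j) + s) *: 'X_j.
    by rewrite {1}(homog1E hy) /ell scaler_sumr -big_split; apply: eq_bigr => j _; rewrite scalerDl.
  apply: vanish => j; apply: contraNneq sn => /eqP; rewrite addrC addr_eq0 => /eqP ->.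
  by apply/imageP; exists j.
by move/(max_poly_roots Qn0)/(_ ut); rewrite st ltnn.
Qed.

End Specialize.

(** * Primality of the bracket and parity of orders *)

Section Prime.
Variable R : idomainType.
Implicit Types (P A B f g h : R).

Definition divides P f := exists r, f = P * r.
Definition prime_elt P := forall f g, divides P (f * g) -> divides P f \/ divides P g.

Lemma dividesD P f g : divides P f -> divides P g -> divides P (f + g).
Proof. by move=> [r ->] [s ->]; exists (r + s); rewrite mulrDr. Qed.
Lemma dividesN P f : divides P f -> divides P (- f).
Proof. by move=> [r ->]; exists (- r); rewrite mulrN. Qed.
Lemma pseudo_rem A B (f : {poly R}) :
  exists N q c, A%:P ^+ N * f = (A%:P * 'X + B%:P) * q + c%:P.
Proof.
elim/poly_ind: f => [|f a [N [q [c E]]]].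
  by exists 0%N, 0, 0; rewrite !mulr0 addr0.
exists N.+1, (A%:P * 'X * q + c%:P), (A ^+ N.+1 * a - c * B).
rewrite polyCB !polyCM rmorphXn /= exprS mulrDr.
transitivity (A%:P * 'X * (A%:P ^+ N * f) + A%:P * A%:P ^+ N * a%:P); first by ring.
by rewrite E; ring.
Qed.

(** A form of Gauss's lemma. Pseudo-division leaves constants [c] and [c'] whose product is a
    multiple of a polynomial of degree 1, hence 0. So one factor is divisible after multiplication
    by a power of [A], and this power cancels because [A] is prime and does not divide [B], or is a
    unit. *)
Lemma linear_poly_prime A B : prime_elt A -> A != 0 -> divides A 1 \/ ~ divides A B ->
  forall f g : {poly R}, (exists h : {poly R}, f * g = (A%:P * 'X + B%:P) * h) ->
  (exists h : {poly R}, f = (A%:P * 'X + B%:P) * h) \/ (exists h : {poly R}, g = (A%:P * 'X + B%:P) * h).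
Proof.
move=> pA A0 AB; set P := A%:P * 'X + B%:P.
have A0' : A%:P != 0 by rewrite polyC_eq0.
have sP : size P = 2%N.
  rewrite /P size_addl size_mulX ?size_polyC ?A0 //.
  by case: (B != 0).
have down N (f q : {poly R}) : A%:P ^+ N * f = P * q -> exists h : {poly R}, f = P * h.
  elim: N q => [|N IH] q; first by rewrite expr0 mul1r => ->; exists q.
  move=> E; suff [q' qE] : exists q', q = A%:P * q'.
    apply: (IH q'); apply: (mulfI A0').
    by rewrite mulrA -exprS E qE; ring.
  have dq i : divides A q`_i.
    case: AB => [[u u1]|nAB]; first by exists (u * q`_i); rewrite mulrA -u1 mul1r.
    have : divides A (B * q`_i).
      have -> : B * q`_i = (P * q)`_i - (A * (if i is j.+1 then q`_j else 0)).
        rewrite /P mulrDl coefD coefCM -mulrA coefCM coefXM.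
        by case: i => [|i] /=; ring.
      apply: dividesD; last by apply/dividesN; exists (if i is j.+1 then q`_j else 0).
      by rewrite -E exprS -mulrA coefCM; exists (A%:P ^+ N * f)`_i.
    by case/pA.
  have [r rE] := fin_all_exists (fun i : 'I_(size q) => dq i).
  exists (\poly_(i < size q) (if insub i is Some j then r j else 0)).
  apply/polyP => i; rewrite coefCM coef_poly; case: ltnP => [lt|ge].
    by rewrite insubT /= -rE.
  by rewrite mulr0 nth_default.
move=> f g [h E].
have [N [q [c fE]]] := pseudo_rem A B f.
have [M [q' [c' gE]]] := pseudo_rem A B g.
have : (c * c')%:P = P * (A%:P ^+ N * A%:P ^+ M * h - q * (P * q' + c'%:P) - c%:P * q').
  have : (P * q + c%:P) * (P * q' + c'%:P) = A%:P ^+ N * A%:P ^+ M * (P * h).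
    by rewrite -fE -gE -E; ring.
  move=> X; rewrite polyCM; apply/eqP; rewrite -subr_eq0.
  have -> : c%:P * c'%:P - P * (A%:P ^+ N * A%:P ^+ M * h - q * (P * q' + c'%:P) - c%:P * q') =
    (P * q + c%:P) * (P * q' + c'%:P) - A%:P ^+ N * A%:P ^+ M * (P * h) by ring.
  by rewrite X subrr.
set w := (_ - _ - _) => cc.
have w0 : w = 0.
  apply/eqP; apply: contraT => wn; have := congr1 (fun p : {poly R} => size p) cc.
  have Pn : P != 0 by rewrite -size_poly_eq0 sP.
  rewrite size_mul // sP add2n /= size_polyC => E'.
  have : (0 < size w)%N by rewrite lt0n size_poly_eq0.
  by move: E'; case: (c * c' != 0) => // -[<-].
move/eqP: cc; rewrite w0 mulr0 polyC_eq0 mulf_eq0 => /orP[]/eqP z.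
  by left; apply: (down N f q); rewrite fE z polyC0 addr0.
by right; apply: (down M g q'); rewrite gE z polyC0 addr0.
Qed.

Lemma ord_unique P m m' f f' : P != 0 -> ~ divides P f -> ~ divides P f' ->
  P ^+ m * f = P ^+ m' * f' -> m = m'.
Proof.
move=> P0; wlog le : m m' f f' / (m <= m')%N => [W nf nf' E|nf _].
  by case: (leqP m m') => [/W|/ltnW/W] H; [apply: (H f f') | apply/esym/(H f' f)].
rewrite -{1}(subnKC le) exprD -mulrA => /(mulfI (expf_neq0 _ P0)) E.
case: (posnP (m' - m)) => [z|p]; first by apply/eqP; rewrite eqn_leq le -subn_eq0 z.
by case: nf; rewrite E -(prednK p) exprS -mulrA; eexists.
Qed.

Lemma prime_elt_prod P f g : prime_elt P -> ~ divides P f -> ~ divides P g -> ~ divides P (f * g).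
Proof. by move=> pP nf ng /pP[]. Qed.

(** The total exponents of [P] on both sides agree, and those coming from the squares of [s] and [t]
    are even. *)
Lemma ord_parity P : prime_elt P -> P != 0 ->
  (forall f, f != 0 -> exists e f', f = P ^+ e * f' /\ ~ divides P f') ->
  forall a b f g s t e1 e2 c, ~ divides P a -> ~ divides P b -> ~ divides P f -> ~ divides P g ->
  s != 0 -> t != 0 -> (P ^+ e1 * a) * g * t ^+ 2 = (P ^+ e2 * b) * (P ^+ c * f) * s ^+ 2 ->
  odd (e1 + e2) = odd c.
Proof.
move=> pP P0 ordP a b f g s t e1 e2 c na nb nf ng s0 t0 E.
have [i [s' [sE ns]]] := ordP s s0; have [j [t' [tE nt]]] := ordP t t0.
have : (e1 + j * 2 = e2 + c + i * 2)%N.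
  apply: (ord_unique (f := a * g * (t' * t')) (f' := b * f * (s' * s')) P0).
  - by do !apply: prime_elt_prod => //.
  - by do !apply: prime_elt_prod => //.
  rewrite !exprD !exprM; move: E; rewrite sE tE => E.
  transitivity (P ^+ e1 * a * g * (P ^+ j * t') ^+ 2); first by ring.
  by rewrite E; ring.
move/(congr1 odd); rewrite !oddD !oddM !andbF !addbF => ->.
by rewrite addbAC addbb.
Qed.
End Prime.

Lemma rmorph_ext (k : fieldType) N (R : comNzRingType) (f g : {rmorphism {mpoly k[N]} -> R}) :
  (forall c, f c%:MP = g c%:MP) -> (forall i, f 'X_i = g 'X_i) -> f =1 g.
Proof.
move=> fgC fgX p; rewrite (mpolyE p) !rmorph_sum; apply: eq_bigr => m _.
rewrite -!mul_mpolyC !rmorphM fgC; congr (_ * _).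
by rewrite mpolyXE_id !rmorph_prod; apply: eq_bigr => i _; rewrite !rmorphXn fgX.
Qed.

Section GenericDet.
Variables (k : fieldType) (N : nat).
Local Notation S := {mpoly k[N]}.

Definition vars_mx r (phi : 'I_r -> 'I_r -> 'I_N) : 'M[S]_r := \matrix_(i, j) 'X_(phi i j).

Definition inj2 r (phi : 'I_r -> 'I_r -> 'I_N) :=
  forall i j i' j', phi i j = phi i' j' -> i = i' /\ j = j'.

Definition point r (phi : 'I_r -> 'I_r -> 'I_N) (T : 'M[k]_r) : {rmorphism S -> k} :=
  mmap (idfun : {rmorphism k -> k}) (fun x => \sum_i \sum_j (x == phi i j)%:R * T i j).

Lemma pointX r phi (T : 'M[k]_r) i j : inj2 phi -> point phi T 'X_(phi i j) = T i j.
Proof.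
move=> phiI; rewrite /point /= mmapX mmap1U (bigD1 i) //= (bigD1 j) //= eqxx mul1r.
rewrite !big1 ?addr0 // => [i' i'i|j' j'j].
  rewrite big1 // => j' _; case: eqP => [/phiI[E _]|_]; rewrite ?mul0r //.
  by move: i'i; rewrite E eqxx.
case: eqP => [/phiI[_ E]|_]; rewrite ?mul0r //.
by move: j'j; rewrite E eqxx.
Qed.

Lemma point_det r phi (T : 'M[k]_r) : inj2 phi -> point phi T (\det (vars_mx phi)) = \det T.
Proof.
move=> phiI; rewrite -det_map_mx; congr (\det _); apply/matrixP => i j.
by rewrite !mxE pointX.
Qed.

Lemma det_vars_neq0 r (phi : 'I_r -> 'I_r -> 'I_N) : inj2 phi -> \det (vars_mx phi) != 0.
Proof.
move=> phiI; apply: contraTneq (oner_neq0 k) => E.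
by rewrite -(det1 k r) -(point_det 1%:M phiI) E rmorph0 eqxx.
Qed.

Lemma det_size0 (R : comNzRingType) r (A : 'M[R]_r) : r = 0%N -> \det A = 1.
Proof. by move=> r0; move: A; rewrite r0 => A; rewrite det_mx00. Qed.

(** Swapping the first two coordinates empties a row of the complementary minor but keeps the
    determinant invertible. *)
Lemma minor_point r (phi : 'I_r.+1 -> 'I_r.+1 -> 'I_N) : inj2 phi -> (0 < r)%N ->
  exists2 T : 'M[k]_r.+1,
    point phi T (\det (vars_mx (fun i j => phi (lift ord0 i) (lift ord0 j)))) = 0 & \det T = -1.
Proof.
case: r phi => // r phi phiI _.
exists (perm_mx (tperm ord0 (lift ord0 ord0))); last by rewrite det_perm odd_tperm.
rewrite -det_map_mx (expand_det_row _ ord0) big1 // => j _.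
by rewrite !mxE pointX // !mxE tpermR (negbTE (neq_lift _ _)) mul0r.
Qed.

(* The determinant is X * A + B, with X its first entry and A the complementary minor. *)
Lemma det_vars_prime r (phi : 'I_r -> 'I_r -> 'I_N) : inj2 phi -> prime_elt (\det (vars_mx phi)).
Proof.
elim: r phi => [|r IH] phi phiI.
  by rewrite det_mx00 => f g _; left; exists f; rewrite mul1r.
pose psi i j := phi (lift ord0 i) (lift ord0 j).
have psiI : inj2 psi by move=> i j i' j' /phiI[/lift_inj -> /lift_inj ->].
set M := vars_mx phi; pose x0 := phi ord0 ord0.
pose A := \det (vars_mx psi).
pose B := \sum_(j < r) M ord0 (lift ord0 j) * cofactor M ord0 (lift ord0 j).
have cof0 : cofactor M ord0 ord0 = A.
  rewrite /cofactor addn0 expr0 mul1r; congr (\det _); apply/matrixP => i j; rewrite !mxE //.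
have ME : \det M = 'X_x0 * A + B.
  by rewrite (expand_det_row _ ord0) big_ord_recl cof0 mxE.
(* [U] makes [x0] the indeterminate of a polynomial ring over the same [S], and evaluation at
   ['X_x0] undoes it, so divisibility can be tested in [{poly S}]. *)
pose U : {rmorphism S -> {poly S}} := mmap (polyC \o @mpolyC N k)
  (fun x => if x == x0 then 'X else ('X_x)%:P).
have UX x : U 'X_x = if x == x0 then 'X else ('X_x)%:P by rewrite /U /= mmapX mmap1U.
have UM : U (\det M) = A%:P * 'X + B%:P.
  rewrite -det_map_mx (expand_det_row _ ord0) big_ord_recl.
  have cofU j : cofactor (map_mx U M) ord0 j = (cofactor M ord0 j)%:P.
    rewrite /cofactor rmorphM rmorphXn rmorphN rmorph1 -det_map_mx; congr (_ * \det _).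
    apply/matrixP => i l; rewrite !mxE UX; case: eqP => // /phiI[E _].
    by have := neq_lift ord0 i; rewrite E eqxx.
  rewrite cofU cof0 !mxE UX eqxx mulrC; congr (_ + _).
  rewrite rmorph_sum; apply: eq_bigr => j _; rewrite cofU [RHS]rmorphM; congr (_ * _).
  rewrite !mxE UX; case: eqP => // /phiI[_ E].
  by have := neq_lift ord0 j; rewrite E eqxx.
have UK f : (U f).['X_x0] = f.
  pose g : {rmorphism S -> S} := horner_eval ('X_x0 : S) \o U.
  have /(_ f) // : g =1 (idfun : {rmorphism S -> S}).
  apply: rmorph_ext => [c|i] /=.
    by rewrite /g /= /U /= mmapC /= /horner_eval hornerC.
  by rewrite /g /= UX /horner_eval; case: eqP => [->|_]; rewrite ?hornerX ?hornerC.
have AB : divides A 1 \/ ~ divides A B.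
  have [r0|r_gt0] := posnP r; first by left; exists 1; rewrite mulr1 /A det_size0.
  (* If [B = A * w], the determinant [A * ('X_x0 + w)] vanishes wherever [A] does, against
     [minor_point]. *)
  right=> -[w wE]; have [T zA TE] := minor_point phiI r_gt0.
  have := point_det T phiI; rewrite -/M ME wE rmorphD !rmorphM zA !(mulr0, mul0r) addr0 TE.
  by move/eqP; rewrite eq_sym oppr_eq0 oner_eq0.
move=> f g [h E].
have [] := linear_poly_prime (IH _ psiI) (det_vars_neq0 psiI) AB (f := U f) (g := U g).
- by exists (U h); rewrite -rmorphM E rmorphM UM.
- by move=> [w wE]; left; exists w.['X_x0]; rewrite -{1}(UK f) wE -UM hornerM UK.
- by move=> [w wE]; right; exists w.['X_x0]; rewrite -{1}(UK g) wE -UM hornerM UK.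
Qed.

Lemma ord_exists (P : S) : (1 < msize P)%N ->
  forall f, f != 0 -> exists e f', f = P ^+ e * f' /\ ~ divides P f'.
Proof.
move=> P1 f; elim: {f}_.+1 {-2}f (ltnSn (msize f)) => // m IH f fm f0.
have [[r rE]|nd] := classic (divides P f); last by exists 0%N, f; rewrite expr0 mul1r.
have r0 : r != 0 by apply: contraNneq f0 => r0; rewrite rE r0 mulr0.
have P0 : P != 0 by rewrite -msize_poly_eq0; case: (msize P) P1.
have [|e [f' [E nf]]] := IH r _ r0.
  move: fm; rewrite rE msizeM // => fm; rewrite -ltnS; apply: leq_trans fm.
  by rewrite ltnS; case: (msize P) P1 => [|[|p]] //= _; rewrite addSn /= ltnS leq_addl.
by exists e.+1, f'; rewrite rE E exprS mulrA.
Qed.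
End GenericDet.

Lemma mxvec_index_inj d n (i i' : 'I_d) (j j' : 'I_n) :
  mxvec_index i j = mxvec_index i' j' -> i = i' /\ j = j'.
Proof.
case: (curry_mxvec_bij d n) => g gK _ E.
have := gK (i, j) isT; rewrite /uncurry E; have := gK (i', j') isT; rewrite /uncurry => ->.
by case=> -> ->.
Qed.

Section Bracket.
Variables (k : fieldType) (d n : nat) (d0 : (0 < d)%N) (F : {set 'I_n}) (Fd : #|F| = d).
Local Notation S := {mpoly k[d * n]}.
Local Notation P := (bracket k d F).

Let phi i m := mxvec_index i (enum_val (cast_ord (esym Fd) m)) : 'I_(d * n).

Let phiI : inj2 phi.
Proof.
move=> i m i' m' /mxvec_index_inj [-> E].
by split=> //; apply: cast_ord_inj (enum_val_inj E).
Qed.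

Let PE : P = \det (vars_mx k phi).
Proof.
congr (\det _); apply/matrixP => i m; rewrite !mxE.
rewrite (nth_map (enum_val (cast_ord (esym Fd) m))); last by rewrite -cardE Fd.
by rewrite -(enum_val_nth _ (cast_ord (esym Fd) m)).
Qed.

Lemma bracket_prime : prime_elt P.
Proof. by rewrite PE; apply: det_vars_prime. Qed.

Lemma bracket_neq0 : P != 0.
Proof. by rewrite PE; apply: det_vars_neq0. Qed.

Lemma bracket_size : (1 < msize P)%N.
Proof.
rewrite ltnNge; apply/negP => /msize1_polyC E.
have := point_det (0 : 'M[k]_d) phiI; have := point_det (1%:M : 'M[k]_d) phiI.
rewrite -PE E /point /= !mmapC det1 => ->.
have -> : \det (0 : 'M[k]_d) = 0 by rewrite -(prednK d0) det0.
by move/eqP; rewrite oner_eq0.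
Qed.
End Bracket.

(** Brings an order to the shape used by [ord_parity]; the parity of a difference of exponents is
    that of their sum. *)
Lemma has_ordP (k : fieldType) N (P : {mpoly k[N]}) x e : has_ord P x e ->
  exists a b e1 e2, [/\ x * FracField.tofrac (P ^+ e2 * b) = FracField.tofrac (P ^+ e1 * a),
    ~ divides P a, ~ divides P b, P ^+ e2 * b != 0 & odd `|e|%N = odd (e1 + e2)].
Proof.
case=> a [b [e1 [e2 [/andP[a0 b0] -> [[a' aE] na] [[b' bE] nb] ->]]]].
exists a', b', e1, e2; rewrite -aE -bE; split=> //.
- by rewrite divfK // tofrac_eq0.
- by move=> [r rE]; apply: na; exists r; rewrite aE rE exprS; ring.
- by move=> [r rE]; apply: nb; exists r; rewrite bE rE exprS; ring.
case: (leqP e2 e1) => le.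
  by rewrite subzn // absz_nat oddB // oddD.
by rewrite -abszN opprB subzn ?(ltnW le) // absz_nat oddB ?(ltnW le) // oddD addbC.
Qed.

(** * Degree map of the stellar subdivision *)

Notation wd := (widen_ord (leqnSn _)).

Section Lift.
Variable n : nat.
Implicit Types (A B T : {set 'I_n}) (X : {set 'I_n.+1}) (x : 'I_n).
Local Notation om := (@ord_max n).

Lemma wd_inj : injective (wd : 'I_n -> 'I_n.+1).
Proof. by move=> x y /(congr1 val) /= /val_inj. Qed.

Lemma wd_om x : (wd x == om) = false.
Proof. by apply/eqP => /(congr1 val) /= E; have := ltn_ord x; rewrite E ltnn. Qed.

Variant ordS_spec : 'I_n.+1 -> Type :=
  | OrdMax : ordS_spec om
  | OrdWd x : ordS_spec (wd x).

Lemma ordSP y : ordS_spec y.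
Proof.
case: (unliftP ord_max y) => [x ->|->]; last exact: OrdMax.
suff -> : lift ord_max x = wd x by exact: OrdWd.
by apply: val_inj; rewrite /= /bump leqNgt ltn_ord.
Qed.

Lemma mem_liftS A x : (wd x \in liftS A) = (x \in A).
Proof. by rewrite mem_imset //; exact: wd_inj. Qed.

Lemma om_liftS A : (om \in liftS A) = false.
Proof. by apply/imsetP => -[x _ /eqP]; rewrite eq_sym wd_om. Qed.

Definition unliftS X := [set x | wd x \in X].

Lemma liftSK A : unliftS (liftS A) = A.
Proof. by apply/setP => x; rewrite inE mem_liftS. Qed.

Lemma liftS_dn X : om \notin X -> liftS (unliftS X) = X.
Proof.
move=> oA; apply/setP => y; case: (ordSP y) => [|x]; last by rewrite mem_liftS inE.
by rewrite om_liftS (negbTE oA).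
Qed.

Lemma liftS_dn_om X : om \in X -> om |: liftS (unliftS X) = X.
Proof.
move=> oA; apply/setP => y; rewrite in_setU1; case: (ordSP y) => [|x]; first by rewrite eqxx oA.
by rewrite wd_om mem_liftS inE.
Qed.

Lemma card_liftS A : #|liftS A| = #|A|.
Proof. exact: card_imset wd_inj. Qed.

Lemma liftS_sub A B : (liftS A \subset liftS B) = (A \subset B).
Proof.
apply/subsetP/subsetP => AB x; first by rewrite -!mem_liftS; apply: AB.
by case: (ordSP x) => [|y]; rewrite ?om_liftS ?mem_liftS //; apply: AB.
Qed.

(** The embedding of the old vertices is increasing, so brackets of old faces are carried over
    without a sign. *)
Lemma enum_liftS A : enum (liftS A) = map wd (enum A).
Proof.
have enumE m (X : {set 'I_m}) : enum X = filter (mem X) (enum 'I_m).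
  by rewrite /enum_mem; congr filter; rewrite filter_predT.
rewrite !enumE enum_ordSr filter_rcons /= om_liftS filter_map; congr map.
by apply: eq_filter => x /=; rewrite mem_liftS.
Qed.

Lemma wd_sub_setU A j : j \in A -> forall T,
  (liftS T \subset (om |: liftS A) :\ wd j) = (T \subset A :\ j).
Proof.
move=> jA T; apply/subsetP/subsetP => TA x.
  by rewrite -mem_liftS => /TA; rewrite !inE wd_om mem_liftS /= (inj_eq wd_inj).
case: (ordSP x) => [|y]; first by rewrite om_liftS.
by rewrite mem_liftS => /TA; rewrite !inE wd_om mem_liftS (inj_eq wd_inj).
Qed.
End Lift.

Section Stellar.
Variables (n d : nat) (L : fieldType) (D : {set {set 'I_n}}) (e : {set 'I_n} -> L).
Hypotheses (gD : good d D e) (d2 : (1 < d)%N).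
Variable G : {set 'I_n}.
Hypotheses (GD : G \in D) (Gd : #|G| = d).
Implicit Types (T F : {set 'I_n}).
Local Notation om := (@ord_max n).

Lemma facetE F : facet D F = (F \in D) && (#|F| == d).
Proof.
rewrite /facet; have [FD|//] := boolP (F \in D); rewrite /=.
apply/forallP/eqP => [max|Fd H].
  have [F' [F'D F'd FF']] := pure gD FD; have := max F'; rewrite F'D properEneq FF' andbT negbK.
  by move/eqP => ->.
apply/implyP => HD; apply/negP => /proper_card; rewrite Fd ltnNge.
by rewrite (good_dim gD).
Qed.

Lemma stellar_lift T : (liftS T \in stellar D G) = (T \in D) && (T != G).
Proof.
rewrite inE; apply/orP/andP => [[/existsP[F /andP[/andP[]]]|/exists_inP[j jG]]|[TD TG]].
- rewrite facetE liftS_sub => /andP[FD /eqP Fd] FG TF; split; first exact: (good_closed gD) TF.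
  by apply: contraNneq FG => TG; rewrite eq_sym eqEcard -TG TF TG Fd Gd leqnn.
- rewrite wd_sub_setU // subsetD1 => /andP[TG jT]; split; first exact: (good_closed gD) TG.
  by apply: contraNneq jT => ->.
have [F [FD Fd TF]] := pure gD TD; have [FG|FG] := eqVneq F G; last first.
  by left; apply/existsP; exists F; rewrite facetE FD Fd eqxx FG liftS_sub TF.
right; have /properP[_ [j jG jT]] : T \proper G by rewrite properEneq TG -FG TF.
by apply/exists_inP; exists j; rewrite // wd_sub_setU // subsetD1 -FG TF.
Qed.

Lemma stellar_om T : (om |: liftS T \in stellar D G) = (T \proper G).
Proof.
rewrite inE; apply/orP/properP => [[/existsP[F /andP[_]]|/exists_inP[j jG]]|[TG [j jG jT]]].
- by rewrite subUset sub1set om_liftS.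
- rewrite subUset wd_sub_setU // subsetD1 => /andP[_ /andP[TG jT]].
  by split=> //; exists j.
right; apply/exists_inP; exists j; rewrite // subUset wd_sub_setU // subsetD1 TG jT.
by rewrite sub1set !inE eq_sym wd_om eqxx.
Qed.
End Stellar.

Lemma face_mx_lift (R : comNzRingType) n d (mu : 'I_n.+1 -> 'I_d -> R) (F : {set 'I_n}) :
  face_mx mu (liftS F) = face_mx (fun j => mu (wd j)) F.
Proof. by apply/matrixP => i m; rewrite !mxE enum_liftS -map_comp. Qed.

Lemma det_perm_tuple (R : comNzRingType) (I : eqType) d (mu : I -> 'I_d -> R) (s t : d.-tuple I) :
  perm_eq s t -> exists b : bool,
  \det (\matrix_(i < d, m < d) mu (tnth s m) i) = (-1) ^+ b * \det (\matrix_(i < d, m < d) mu (tnth t m) i).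
Proof.
move=> /tuple_permP[p pE]; exists p.
have -> : \matrix_(i < d, m < d) mu (tnth s m) i = col_perm p (\matrix_(i < d, m < d) mu (tnth t m) i).
  apply/matrixP => i m; rewrite !mxE; congr (mu _ i).
  have x0 := tnth s m; rewrite (tnth_nth x0) pE -tnth_nth tnth_mktuple //.
by rewrite col_permE det_mulmx det_perm mulrC odd_permV.
Qed.

Section Cramer.
Variables (d n : nat).
Local Notation om := (@ord_max n).

Section Ring.
Variables (R : comNzRingType) (mu : 'I_n.+1 -> 'I_d -> R) (G : {set 'I_n}).

(* Cramer's rule for the linear relation between the d + 1 parameter vectors of G and om. *)
Definition cram (j : 'I_n.+1) : R :=
  if j == om then - \det (face_mx mu (liftS G))
  else if j \in liftS G then \det (face_mx (fun v => if v == j then mu om else mu v) (liftS G))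
  else 0.

Hypothesis Gd : #|G| = d.
Let Sd : #|liftS G| = d. Proof. by rewrite card_liftS. Qed.

(** With [A] the matrix of [G], the coordinates at the vertices of [G] are the entries of the
    adjugate applied to [mu om], and the relation is [A *m \adj A = (\det A)%:M]. *)
Lemma cram_rel i : \sum_j cram j * mu j i = 0.
Proof.
pose A := face_mx mu (liftS G); pose pt m := enum_val (cast_ord (esym Sd) m).
have ptI : injective pt by move=> x y /enum_val_inj/cast_ord_inj.
have AE i' m : A i' m = mu (pt m) i' by rewrite /A (face_mxE _ Sd).
have cE m : cram (pt m) = \sum_l mu om l * \adj A m l.
  have Gm : pt m \in liftS G by apply: enum_valP.
  rewrite /cram Gm; case: eqP => [E|_]; first by move: Gm; rewrite E om_liftS.
  rewrite (expand_det_col _ m); apply: eq_bigr => l _; congr (_ * _).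
    by rewrite (face_mxE _ Sd) -/(pt m) eqxx.
  rewrite [RHS]mxE /cofactor; congr (_ * \det _); apply/matrixP => x y; rewrite ![row' _ _ _ _]mxE ![col' _ _ _ _]mxE !(face_mxE _ Sd) -/(pt _).
  by rewrite (inj_eq ptI) eq_sym (negbTE (neq_lift _ _)).
rewrite (bigD1 om) //= {1}/cram eqxx.
rewrite (bigID (mem (liftS G))) /= [X in _ + (_ + X)]big1 ?addr0; last first.
  by move=> j /andP[/negbTE jo /negbTE jG]; rewrite /cram jo jG mul0r.
transitivity (- \det A * mu om i + \sum_m cram (pt m) * mu (pt m) i).
  congr (_ + _); rewrite (eq_bigl (mem (liftS G))); last first.
    by move=> j /=; case: eqP => // ->; rewrite om_liftS.
  rewrite (reindex pt) /=; last first.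
    exists (fun j => cast_ord Sd (enum_rank_in (enum_valP (cast_ord (esym Sd) i)) j)) => [m _|j jG].
      by rewrite /pt enum_valK_in cast_ordKV.
    by rewrite /pt cast_ordK enum_rankK_in.
  by apply: eq_bigl => m; apply: enum_valP.
under eq_bigr => m _ do rewrite cE mulr_suml.
rewrite exchange_big /=.
transitivity (- \det A * mu om i + \sum_l mu om l * (A *m \adj A) i l).
  congr (_ + _); apply: eq_bigr => l _; rewrite mxE mulr_sumr; apply: eq_bigr => m _.
  by rewrite AE; ring.
rewrite mul_mx_adj (bigD1 i) //= !mxE eqxx big1 ?addr0 => [|l li]; first by rewrite mulr1n; ring.
by rewrite !mxE eq_sym (negbTE li) mulr0n mulr0.
Qed.

(** The determinant in [cram] has the column of [om] in the place of [j] rather than last, hence the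
    sign of a reordering. *)
Lemma cram_facet j : j \in G ->
  exists b : bool, cram (wd j) = (-1) ^+ b * \det (face_mx mu ((om |: liftS G) :\ wd j)).
Proof.
move=> jG; set F := _ :\ _.
have Fd : #|F| = d.
  have := cardsD1 (wd j) (om |: liftS G); rewrite !inE mem_liftS jG orbT.
  by rewrite cardsU1 om_liftS Sd => -[].
rewrite /cram wd_om mem_liftS jG.
pose f v := if v == wd j then om else v.
have fI : {in enum (liftS G) &, injective f}.
  move=> x y; rewrite !mem_enum => xG yG; rewrite /f.
  case: eqP => [->|_]; case: eqP => [->|_] // E.
    by move: yG; rewrite -E om_liftS.
  by move: xG; rewrite E om_liftS.
have ss : size (map f (enum (liftS G))) == d by rewrite size_map -cardE Sd.
have ts : size (enum F) == d by rewrite -cardE Fd.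
have [|b] := @det_perm_tuple R _ d mu (Tuple ss) (Tuple ts).
  apply: uniq_perm; rewrite ?enum_uniq ?map_inj_in_uniq ?enum_uniq //= => y.
  rewrite mem_enum !inE; apply/mapP/andP => [[x]|[yj /orP[/eqP ->|yG]]].
  - rewrite mem_enum /f => xG ->; case: (x =P wd j) => [_|/eqP xj]; last by rewrite xj xG orbT.
    by rewrite eq_sym wd_om eqxx.
  - by exists (wd j); rewrite ?mem_enum ?mem_liftS // /f eqxx.
  by exists y; rewrite ?mem_enum // /f (negbTE yj).
move=> E; exists b; move: E.
set M1 := (\matrix_(_, _) _); set M2 := (\matrix_(_, _) _).
have -> : M2 = face_mx mu F.
  by apply/matrixP => i m; rewrite !mxE (tnth_nth om) (nth_map om) // (eqP ts).
have -> // : M1 = face_mx (fun v => if v == wd j then mu om else mu v) (liftS G).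
apply/matrixP => i m; rewrite !mxE (tnth_nth om) /= (nth_map om) ?(nth_map om) -?cardE ?Sd //.
by rewrite /f; case: eqP.
Qed.
End Ring.

Lemma map_cram (R R' : comNzRingType) (f : {rmorphism R -> R'}) mu G j :
  f (cram mu G j) = cram (fun v i => f (mu v i)) G j.
Proof.
rewrite /cram; case: eqP => _; first by rewrite rmorphN -det_map_mx map_face_mx.
case: ifP => _; last by rewrite rmorph0.
rewrite -det_map_mx map_face_mx; congr (\det _); apply/matrixP => i m; rewrite !mxE.
by congr (nth _ _ _); apply: eq_map => v; case: eqP.
Qed.
End Cramer.

Section AddVertex.
Variables (n : nat) (L : fieldType).
Local Notation om := (@ord_max n).
Implicit Types (al : 'X_{1..n.+1}) (ga : 'X_{1..n}).

Definition mres al : 'X_{1..n} := [multinom al (wd x) | x < n].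

Lemma mdeg_mres al : mdeg al = (mdeg (mres al) + al om)%N.
Proof. by rewrite !mdegE big_ord_recr; congr (_ + _)%N; apply: eq_bigr => x _; rewrite mnmE. Qed.

Lemma unlift_wd (x : 'I_n) : unlift om (wd x) = Some x.
Proof.
case: (unliftP om (wd x)) => [y E|/eqP]; last by rewrite wd_om.
by congr Some; apply: val_inj; have := congr1 val E; rewrite /= /bump leqNgt ltn_ord /= => ->.
Qed.

Lemma unlift_om : unlift om om = None. Proof. exact: unlift_none. Qed.

(* setting the last variable to 0 *)
Definition pres : {rmorphism {mpoly L[n.+1]} -> {mpoly L[n]}} :=
  mmap (@mpolyC n L) (fun j => if unlift om j is Some x then 'X_x else 0).
Definition pemb : {rmorphism {mpoly L[n]} -> {mpoly L[n.+1]}} :=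
  mmap (@mpolyC n.+1 L) (fun x => 'X_(wd x)).

Lemma presX al : pres 'X_[al] = if al om == 0%N then 'X_[mres al] else 0.
Proof.
rewrite /pres /= mmapX /mmap1 big_ord_recr /= unlift_om.
case: (al om =P 0%N) => [->|/eqP nz]; last by rewrite expr0n (negbTE nz) mulr0.
rewrite expr0 mulr1 (mpolyXE_id _ (mres al)); apply: eq_bigr => x _.
by rewrite unlift_wd mnmE.
Qed.

Lemma pres_wd x : pres 'X_(wd x) = 'X_x.
Proof. by rewrite /pres /= mmapX mmap1U unlift_wd. Qed.
Lemma pres_om : pres 'X_om = 0.
Proof. by rewrite /pres /= mmapX mmap1U unlift_om. Qed.
Lemma pemb_X x : pemb 'X_x = 'X_(wd x).
Proof. by rewrite /pemb /= mmapX mmap1U. Qed.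

Lemma presZ a p : pres (a *: p) = a *: pres p.
Proof. by rewrite -!mul_mpolyC rmorphM /= mmapC. Qed.
Lemma pembZ a p : pemb (a *: p) = a *: pemb p.
Proof. by rewrite -!mul_mpolyC rmorphM /= mmapC. Qed.

Lemma pembK p : pres (pemb p) = p.
Proof.
pose g : {rmorphism {mpoly L[n]} -> {mpoly L[n]}} := pres \o pemb.
have /(_ p) // : g =1 (idfun : {rmorphism {mpoly L[n]} -> {mpoly L[n]}}).
apply: rmorph_ext => [a|i]; last by rewrite /g /= [pemb _]pemb_X pres_wd.
by rewrite /g /= !mmapC.
Qed.

Lemma homog_pres j p : is_homog j p -> is_homog j (pres p).
Proof.
move=> hp; rewrite (mpolyE p) rmorph_sum big_seq; apply: homog_sum => m.
rewrite mcoeff_msupp => /hp md; rewrite presZ; apply: homogZ; rewrite presX.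
case: eqP => m0; last exact: homog0.
by rewrite -md mdeg_mres m0 addn0; apply: homogX.
Qed.

Lemma homog_pemb j p : is_homog j p -> is_homog j (pemb p).
Proof.
move=> hp; rewrite (mpolyE p) rmorph_sum big_seq; apply: homog_sum => m.
rewrite mcoeff_msupp => /hp <-; rewrite pembZ; apply: homogZ.
rewrite mpolyXE_id rmorph_prod mdegE.
apply: (big_rec2 (fun i p => is_homog i p)) => [|x i r _ hr].
  by have := @homogX n.+1 L 0%MM; rewrite mdeg0 mpolyX0.
apply: homogM => //; rewrite rmorphXn pemb_X -[X in is_homog X _]mul1n.
by apply: homog_exp; have := @homogX n.+1 L U_(wd x)%MM; rewrite mdeg1.
Qed.

Lemma pres_ell : pres (ell L n.+1) = ell L n.
Proof.
rewrite /ell rmorph_sum big_ord_recr /= pres_om addr0.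
by apply: eq_bigr => x _; rewrite pres_wd.
Qed.

Variables (d : nat) (dg : 'X_{1..n} -> L) (c : 'I_n.+1 -> L) (w : L).

(* The shape of the degree map of a stellar subdivision: the old one, plus a multiple
   of the evaluation at the point c, the degree map of the boundary of a simplex. *)
Definition adddg al : L := (if al om == 0%N then dg (mres al) else 0) + w * monom_at c al.

Lemma mevalX_monom_at al : 'X_[al].@[c] = monom_at c al.
Proof. by rewrite mevalX. Qed.

Lemma dgp_split p : is_homog d p -> dgp d adddg p = dgp d dg (pres p) + w * p.@[c].
Proof.
move=> hp; rewrite (mpolyE p) (raddf_sum (meval c)) rmorph_sum !dgp_sum mulr_sumr -big_split.
rewrite big_seq [RHS]big_seq; apply: eq_bigr => m; rewrite mcoeff_msupp => /hp md.
rewrite /= presZ !dgpZ mevalZ mevalX_monom_at dgpX md eqxx presX mulrDr mulrCA; congr (_ + _).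
case: eqP => [m0|_]; last by rewrite dgp0.
by rewrite dgpX -[X in _ == X]md mdeg_mres m0 addn0 eqxx.
Qed.

Hypotheses (c0 : c om != 0) (w0 : w != 0).
Variable q : nat.
Hypotheses (q0 : (0 < q)%N) (qd : (2 * q <= d)%N).
Variables (m : nat) (V : 'I_m -> {mpoly L[n]}).
Hypothesis hV : forall i, is_homog q (V i).

Let qled : (q <= d)%N. Proof. by apply: leq_trans qd; rewrite leq_pmull. Qed.
Let dq0 : (0 < d - q)%N. Proof. by rewrite subn_gt0 (leq_trans _ qd) // ltn_Pmull. Qed.

(* Vanishes at the point c, so that the new basis is orthogonal to x_om^q. *)
Definition corr (p : {mpoly L[n.+1]}) := p - (p.@[c] / c om ^+ q) *: 'X_om ^+ q.
Definition addV (i : 'I_(m + 1)) : {mpoly L[n.+1]} :=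
  match split i with inl j => corr (pemb (V j)) | inr _ => 'X_om ^+ q end.

Let homXom i : is_homog i ('X_om ^+ i : {mpoly L[n.+1]}).
Proof.
rewrite -[X in is_homog X]mul1n; apply: homog_exp.
by have := @homogX n.+1 L U_(om)%MM; rewrite mdeg1.
Qed.

Lemma corr_at p : (corr p).@[c] = 0.
Proof. by rewrite /corr mevalB mevalZ rmorphXn /= mevalXU divfK ?subrr // expf_neq0. Qed.
Lemma at_mul_corr a p : (a * corr p).@[c] = 0.
Proof. by rewrite mevalM corr_at mulr0. Qed.
Lemma pres_corr p : pres (corr p) = pres p.
Proof. by rewrite /corr rmorphB presZ rmorphXn pres_om expr0n (gtn_eqF q0) scaler0 subr0. Qed.
Lemma pres_mul_corr a p : pres (a * corr (pemb p)) = pres a * p.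
Proof. by rewrite rmorphM pres_corr pembK. Qed.
Lemma homog_corr p : is_homog q p -> is_homog q (corr p).
Proof. by move=> hp; apply: homogB => //; apply: homogZ. Qed.

Lemma homog_addV i : is_homog q (addV i).
Proof.
by rewrite /addV; case: split => j //; apply: homog_corr; apply: homog_pemb.
Qed.

Lemma sum_addV (a : 'I_(m + 1) -> L) : \sum_i a i *: addV i =
  \sum_i a (lshift 1 i) *: corr (pemb (V i)) + a (rshift m ord0) *: 'X_om ^+ q.
Proof.
rewrite big_split_ord big_ord1 /addV; congr (_ + _).
  by apply: eq_bigr => i _; rewrite (unsplitK (inl i)).
by rewrite (unsplitK (inr ord0)).
Qed.

Lemma pres_sum_addV a : pres (\sum_i a i *: addV i) = \sum_i a (lshift 1 i) *: V i.
Proof.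
rewrite sum_addV rmorphD rmorph_sum presZ rmorphXn pres_om expr0n (gtn_eqF q0) scaler0 addr0.
by apply: eq_bigr => i _; rewrite presZ pres_corr pembK.
Qed.

Lemma at_sum_addV a : (\sum_i a i *: addV i).@[c] = a (rshift m ord0) * c om ^+ q.
Proof.
rewrite sum_addV mevalD mevalZ rmorphXn /= mevalXU (raddf_sum (meval c)) big1 ?add0r // => i _.
by rewrite /= mevalZ corr_at mulr0.
Qed.

Lemma span_addV : spanN d dg q V -> spanN d adddg q addV.
Proof.
move=> sV a ha; have [x xP] := sV _ (homog_pres ha).
pose z (i : 'I_(m + 1)) : L := match split i with inl j => x j | inr _ => a.@[c] / c om ^+ q end.
have zl i : z (lshift 1 i) = x i by rewrite /z (unsplitK (inl i)).
have zr : z (rshift m ord0) = a.@[c] / c om ^+ q by rewrite /z (unsplitK (inr ord0)).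
have hS : is_homog q (\sum_i z i *: addV i).
  by apply: homog_sum => i _; apply: homogZ; apply: homog_addV.
exists z => b hb; rewrite dgp_split; last first.
  by rewrite -(subnKC qled); apply: homogM => //; apply: homogB.
rewrite rmorphM mevalM mevalB at_sum_addV zr divfK ?expf_neq0 // subrr mul0r mulr0 addr0.
rewrite rmorphB pres_sum_addV; under eq_bigr => i _ do rewrite zl.
by apply: xP; apply: homog_pres.
Qed.

Lemma indep_addV : indepN d dg q V -> indepN d adddg q addV.
Proof.
move=> iV a na; have hS : is_homog q (\sum_i a i *: addV i).
  by apply: homog_sum => i _; apply: homogZ; apply: homog_addV.
(* Multiplication by a power of the new variable kills the old summand of the degree; what remains
   is the value at [c], which isolates the last coefficient. *)
have ar : a (rshift m ord0) = 0.
  have := na _ (@homXom (d - q)%N); rewrite dgp_split; last first.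
    by rewrite -{1}(subnKC qled); apply: homogM.
  rewrite rmorphM rmorphXn pres_om expr0n (gtn_eqF dq0) mulr0 dgp0 add0r.
  rewrite mevalM at_sum_addV rmorphXn /= mevalXU -mulrA -exprD => /eqP.
  by rewrite !mulf_eq0 (negbTE w0) expf_eq0 (negbTE c0) andbF orbF /= => /eqP.
have al : forall i, a (lshift 1 i) = 0.
  apply: iV => b hb; have := na _ (homog_pemb hb); rewrite dgp_split; last first.
    by rewrite -{1}(subnKC qled); apply: homogM => //; apply: homog_pemb.
  by rewrite rmorphM mevalM at_sum_addV ar !mul0r mulr0 addr0 pembK pres_sum_addV.
move=> i; rewrite -(splitK i); case: (split i) => j //=.
by rewrite (ord1 j).
Qed.

(** Corrected vectors vanish at [c], and ['X_om ^+ q] restricts to 0, so mixed products have degree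
    0. The blocks are the old Gram matrix and the value of the new summand on ['X_om ^+ q]. *)
Lemma det_gram_addV : \det (gram d adddg q (ell L n.+1) addV) =
  \det (gram d dg q (ell L n) V) * (w * (\sum_j c j) ^+ (d - 2 * q) * c om ^+ (2 * q)).
Proof.
have hell := @homog_ell n.+1 L.
have hE i j : is_homog d (ell L n.+1 ^+ (d - 2 * q) * addV i * addV j).
  rewrite -{1}(subnK qled); apply: homogM; last exact: homog_addV.
  exact: (gram_entry_homog qd hell (@homog_addV i)).
have ellc : (ell L n.+1).@[c] = \sum_j c j.
  by rewrite /ell (raddf_sum (meval c)); apply: eq_bigr => j _; rewrite /= mevalXU.
have Vl i : addV (lshift 1 i) = corr (pemb (V i)) by rewrite /addV (unsplitK (inl i)).
have Vr i : addV (rshift m i) = 'X_om ^+ q by rewrite /addV (unsplitK (inr i)).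
have X0 : pres ('X_om ^+ q) = 0 by rewrite rmorphXn pres_om expr0n (gtn_eqF q0).
rewrite -[gram d adddg q (ell L n.+1) addV]submxK.
set A := ulsubmx _; set B := ursubmx _; set C := dlsubmx _; set E := drsubmx _.
have -> : B = 0.
  apply/matrixP => i j; rewrite !mxE dgp_split // Vl Vr !(rmorphM pres) X0 mulr0 dgp0 add0r.
  by rewrite mulrAC at_mul_corr mulr0.
rewrite det_lblock; congr (_ * _).
  congr (\det _); apply/matrixP => i j; rewrite !mxE dgp_split // !Vl at_mul_corr mulr0 addr0.
  by rewrite 2!pres_mul_corr (rmorphXn pres) pres_ell.
rewrite det_mx11 !mxE dgp_split // !Vr !(rmorphM pres) X0 mulr0 dgp0 add0r.
rewrite !mevalM !rmorphXn /= ellc mevalXU.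
by rewrite mul2n -addnn exprD !mulrA.
Qed.
End AddVertex.

Lemma mset_card n (al : 'X_{1..n}) : #|msupport al| = mdeg al -> al = mset (msupport al).
Proof.
move=> E; apply/esym/mset_supp => v; rewrite leqNgt; apply/negP => v1.
have U : (U_(v) <= al)%MM by rewrite lep1mP -lt0n ltnW.
have := card_msupport (al - U_(v))%MM.
have -> : msupport (al - U_(v))%MM = msupport al.
  apply/setP => j; rewrite !inE mnmBE mnm1E; case: (v =P j) => [<-|_]; last by rewrite subn0.
  by rewrite -!lt0n subn_gt0 v1 ltnW.
have := mdegD (al - U_(v))%MM U_(v); rewrite (submK U) mdeg1 E => ->.
by rewrite addn1 ltnn.
Qed.

Section Iota.
Variables (k : fieldType) (d n : nat).
Local Notation S := {mpoly k[d * n]}.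
Local Notation S1 := {mpoly k[d * n.+1]}.
Local Notation om := (@ord_max n).

Definition iota_S : {rmorphism S -> S1} :=
  subst (@mpolyC (d * n.+1) k) (fun j i => xvar k (wd j) i).
(** Setting the coordinates of the new vertex to 0 is a retraction of [iota_S]; it transfers
    injectivity and non-divisibility to the larger ring. *)
Definition ret_S : {rmorphism S1 -> S} :=
  subst (@mpolyC (d * n) k) (fun j i => if unlift om j is Some x then xvar k x i else 0).

Lemma iotaX j i : iota_S (xvar k j i) = xvar k (wd j) i. Proof. exact: substX. Qed.
Lemma retX j i : ret_S (xvar k (wd j) i) = xvar k j i.
Proof. by rewrite /ret_S substX unlift_wd. Qed.

Lemma mxvec_index_ex (x : 'I_(d * n)) : exists i j, x = mxvec_index i j :> 'I_(d * n).
Proof. by case/mxvec_indexP: x => i j; exists i, j. Qed.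

Lemma ret_iota p : ret_S (iota_S p) = p.
Proof.
pose g : {rmorphism S -> S} := ret_S \o iota_S.
have /(_ p) // : g =1 (idfun : {rmorphism S -> S}).
apply: rmorph_ext => [a|x]; first by rewrite /g /= [iota_S _]substC [LHS]substC.
by have [i [j ->]] := mxvec_index_ex x; rewrite /g /= -!/(xvar k j i) iotaX retX.
Qed.

Lemma iota_neq0 p : (iota_S p != 0) = (p != 0).
Proof.
by congr (~~ _); apply/eqP/eqP => [E|->]; rewrite ?rmorph0 // -(ret_iota p) E rmorph0.
Qed.

Lemma iota_bracket (F : {set 'I_n}) : iota_S (bracket k d F) = bracket k d (liftS F).
Proof.
rewrite (rmorph_bracket iota_S) bracketE face_mx_lift; congr (\det _).
by apply/matrixP => i m; rewrite !mxE; congr nth; apply: eq_map => j; apply: iotaX.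
Qed.

Lemma iota_ndivides (F : {set 'I_n}) p : ~ divides (bracket k d F) p -> ~ divides (bracket k d (liftS F)) (iota_S p).
Proof.
move=> np [r rE]; apply: np; exists (ret_S r).
by rewrite -[LHS]ret_iota rE rmorphM -iota_bracket ret_iota.
Qed.

Definition ev_iota : {rmorphism S -> Kf k (d * n.+1)} := tofracm k d n.+1 \o iota_S.

Lemma evpar_iota j i : evpar ev_iota j i = avar k i (wd j).
Proof. by rewrite /evpar /ev_iota /= iotaX. Qed.
End Iota.

Section StellarDegree.
Variables (k : fieldType) (d n : nat) (D : {set {set 'I_n}}).
Local Notation S := {mpoly k[d * n]}.
Local Notation S1 := {mpoly k[d * n.+1]}.
Local Notation K := (Kf k (d * n)).
Local Notation K1 := (Kf k (d * n.+1)).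
Local Notation E := (allbr k d D).
Local Notation om := (@ord_max n).
Implicit Types (F T G : {set 'I_n}) (X : {set 'I_n.+1}).
Variables (e : {set 'I_n} -> K1) (gD : good d D e) (d2 : (1 < d)%N).
Variables (dg : 'X_{1..n} -> K) (gdg : gendeg D dg).
Variables (P : 'X_{1..n} -> S).
Hypothesis PE : forall be, mdeg be = d ->
  dg be * FracField.tofrac E ^+ n.+1 = FracField.tofrac (P be).
Variable G : {set 'I_n}.
Hypotheses (GD : G \in D) (Gd : #|G| = d).

Lemma E_neq0 : E != 0.
Proof. by apply/prodf_neq0 => H /andP[_ /eqP Hd]; apply: bracket_neq0. Qed.

Let evE : ev_iota k d n E != 0.
Proof. by rewrite /ev_iota /= tofrac_eq0 iota_neq0 E_neq0. Qed.

Definition dg_iota := dgev D P (ev_iota k d n).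

Definition cS (j : 'I_n.+1) : S1 := cram (fun v i => xvar k v i) G j.
Definition cK (j : 'I_n.+1) : K1 := FracField.tofrac (cS j).
Definition csig : K1 := \prod_(j in om |: liftS G) cK j.

Lemma cS_om : cS om = - bracket k d (liftS G).
Proof. by rewrite /cS /cram eqxx bracketE. Qed.

Lemma cS_facet j : j \in G -> exists b : bool,
  cS (wd j) = (-1) ^+ b * bracket k d ((om |: liftS G) :\ wd j).
Proof.
move=> jG; have [b E'] := cram_facet (fun v i => xvar k v i) Gd jG.
by exists b; rewrite bracketE -E'.
Qed.

Lemma cS0 j : j \notin om |: liftS G -> cS j = 0.
Proof. by rewrite in_setU1 negb_or /cS /cram => /andP[/negbTE -> /negbTE ->]. Qed.

Lemma card_sigD1 j : j \in G -> #|(om |: liftS G) :\ wd j| = d.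
Proof.
move=> jG; have := cardsD1 (wd j) (om |: liftS G); rewrite !inE mem_liftS jG orbT.
by rewrite cardsU1 om_liftS card_liftS Gd => -[].
Qed.

Lemma cK_neq0 j : j \in om |: liftS G -> cK j != 0.
Proof.
rewrite in_setU1 tofrac_eq0; case: (ordSP j) => [_|x].
  by rewrite cS_om oppr_eq0 bracket_neq0 // card_liftS.
rewrite wd_om mem_liftS /= => xG; have [b ->] := cS_facet xG.
by rewrite mulf_neq0 ?signr_eq0 // bracket_neq0 // card_sigD1.
Qed.

Lemma csig_neq0 : csig != 0.
Proof. by apply/prodf_neq0 => j; apply: cK_neq0. Qed.

Lemma cK_rel i : \sum_j avar k i j * cK j = 0.
Proof.
have := cram_rel (fun v i => xvar k v i) Gd i => /(congr1 (tofracm k d n.+1)).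
rewrite rmorph0 rmorph_sum /= => cE; apply: etrans cE; apply: eq_bigr => j _.
by rewrite -/(cS j) tofracM mulrC.
Qed.

Lemma monom_at_cK0 (al : 'X_{1..n.+1}) j : j \in msupport al -> j \notin om |: liftS G -> monom_at cK al = 0.
Proof.
rewrite inE => aj jG; rewrite /monom_at (bigD1 j) //= /cK cS0 // tofrac0 expr0n (negbTE aj).
by rewrite mul0r.
Qed.

Lemma monom_at_mset (X : {set 'I_n.+1}) : monom_at cK (mset X) = \prod_(j in X) cK j.
Proof.
rewrite /monom_at [RHS]big_mkcond; apply: eq_bigr => j _; rewrite msetE.
by case: (j \in X); rewrite ?expr1 ?expr0.
Qed.

Lemma mres_mset T : mres (mset (liftS T)) = mset T.
Proof. by apply/mnmP => x; rewrite mnmE !msetE mem_liftS. Qed.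

Lemma dg_iota_facet F : F \in D -> #|F| = d -> exists b : bool,
  dg_iota (mset F) * FracField.tofrac (bracket k d (liftS F)) = (-1) ^+ b.
Proof.
move=> FD Fd; have [b bE] := P_facet gdg PE FD Fd; exists b.
rewrite /dg_iota /dgev -iota_bracket mulrAC; apply: (canLR (mulfK _)).
  by rewrite expf_neq0.
by rewrite -[FracField.tofrac _]/(ev_iota k d n (bracket k d F)) -rmorphM bE rmorphM !rmorphXn rmorphN rmorph1.
Qed.

Variable b0 : bool.
Hypothesis b0E : dg_iota (mset G) * FracField.tofrac (bracket k d (liftS G)) = (-1) ^+ b0.
(* The sign makes the degree of the monomial of G, no longer a face, vanish. *)
Definition wS : K1 := (-1) ^+ b0 / csig.
Definition dgS := adddg dg_iota cK wS.

(** The relation between the [cK j] makes evaluation at that point kill the parameters, and the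
    point is supported on [om |: liftS G]. On the facet opposite to [j] every factor of [csig]
    except [cK j] cancels, which leaves a sign over the bracket of this facet. *)
Lemma gendeg_stellar : gendeg (stellar D G) dgS.
Proof.
have dgP := degcond_ev gdg PE evE; have [th nf _] := dgP.
split.
- move=> be i bd; under eq_bigr => j _ do rewrite mulrDr.
  rewrite big_split /= [X in _ + X](_ : _ = 0) ?addr0; last first.
    transitivity (wS * monom_at cK be * \sum_j avar k i j * cK j); last by rewrite cK_rel mulr0.
    by rewrite mulr_sumr; apply: eq_bigr => j _; rewrite monom_atD monom_atU; ring.
  rewrite big_ord_recr /= mnmDE mnm1E eqxx addn1 mulr0 addr0.
  case: (be om =P 0%N) => [b0'|/eqP bn]; last first.
    rewrite big1 // => x _; rewrite mnmDE mnm1E wd_om addn0.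
    by rewrite (negbTE bn) mulr0.
  have md : (mdeg (mres be)).+1 = d by rewrite -bd mdeg_mres b0' addn0.
  rewrite -[RHS](th _ i md); apply: eq_bigr => x _; rewrite evpar_iota mnmDE mnm1E wd_om addn0 b0' eqxx.
  congr (_ * dg_iota _); apply/mnmP => y; rewrite !(mnmE, mnmDE, mnm1E).
  by rewrite (inj_eq (@wd_inj n)).
- move=> al ad; rewrite /dgS /adddg; case: (al om =P 0%N) => [a0|/eqP an].
    have mr : mdeg (mres al) = d by rewrite -ad mdeg_mres a0 addn0.
    have sE : msupport al = liftS (msupport (mres al)).
      apply/setP => j; case: (ordSP j) => [|x]; first by rewrite om_liftS inE a0.
      by rewrite mem_liftS !inE mnmE.
    rewrite sE (stellar_lift gD GD Gd) negb_and negbK => /orP[TD|/eqP TG].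
      rewrite [dg_iota _]nf // add0r.
      have /subsetPn[x xT xG] : ~~ (msupport (mres al) \subset G).
        by apply: contraNN TD => TG; apply: good_closed gD _ _ GD TG.
      rewrite (@monom_at_cK0 _ (wd x)) ?mulr0 // ?sE ?mem_liftS //.
      by rewrite in_setU1 wd_om mem_liftS.
    have alE : al = mset (liftS G).
      by rewrite [LHS]mset_card ?sE ?TG // card_liftS Gd ad.
    have c1 : cK om = - FracField.tofrac (bracket k d (liftS G)) by rewrite /cK cS_om tofracN.
    have b1 : FracField.tofrac (bracket k d (liftS G)) != 0.
      by rewrite tofrac_eq0 bracket_neq0 // card_liftS.
    rewrite alE mres_mset monom_at_mset /wS /csig big_setU1 ?om_liftS //= c1.
    have Pn : \prod_(j in liftS G) cK j != 0.
      by apply/prodf_neq0 => j jG; apply: cK_neq0; rewrite in_setU1 jG orbT.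
    apply: (mulIf b1); rewrite mul0r mulrDl b0E.
    move: (FracField.tofrac (bracket k d (liftS G))) (\prod_(j in liftS G) cK j) b1 Pn => x y x0 y0.
    by rewrite mulNr invrN mulrN !mulNr -!mulrA [y * x]mulrC (mulVf (mulf_neq0 x0 y0)) mulr1 subrr.
  rewrite add0r; set X := msupport al.
  have oX : om \in X by rewrite inE.
  rewrite -(liftS_dn_om oX) (stellar_om D) // => nP.
  (* The whole set [om |: liftS G] is a non-face where the point does not vanish, but it has [d + 1]
     elements, too many for a monomial of degree [d]. *)
  have TG : ~~ (unliftS X \subset G).
    apply: contraNN nP => TG; rewrite properE TG; apply/negP => GT.
    have := card_msupport al; rewrite -/X -(liftS_dn_om oX) cardsU1 om_liftS card_liftS ad.
    by rewrite add1n ltnNge -Gd subset_leq_card.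
  have /subsetPn[x xT xG] := TG.
  rewrite (@monom_at_cK0 _ (wd x)) ?mulr0 //; first by move: xT; rewrite inE.
  by rewrite in_setU1 wd_om mem_liftS.
move=> X; case: (boolP (om \in X)) => oX; last first.
  rewrite -(liftS_dn oX); move: (unliftS X) => T; rewrite (stellar_lift gD GD Gd) card_liftS.
  move=> /andP[TD TG] Td; rewrite /dgS /adddg msetE om_liftS /= mres_mset.
  have /subsetPn[x xT xG] : ~~ (T \subset G).
    by apply: contraNN TG => TG; rewrite eqEcard TG Td Gd leqnn.
  rewrite (@monom_at_cK0 _ (wd x)) ?mulr0 ?addr0; first exact: dg_iota_facet.
    by rewrite msupport_mset mem_liftS.
  by rewrite in_setU1 wd_om mem_liftS.
rewrite -(liftS_dn_om oX); move: (unliftS X) => T; rewrite (stellar_om D) // => /properP[TG [j jG jT]].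
rewrite cardsU1 om_liftS card_liftS add1n => Td.
have TE : T = G :\ j.
  have := cardsD1 j G; rewrite jG Gd -Td add1n => -[E1].
  by apply/eqP; rewrite eqEcard subsetD1 TG jT -E1 leqnn.
have XE : om |: liftS T = (om |: liftS G) :\ wd j.
  apply/setP => y; rewrite !inE; case: (ordSP y) => [|x]; first by rewrite !eqxx eq_sym wd_om.
  by rewrite !wd_om !mem_liftS TE !inE (inj_eq (@wd_inj n)).
have jS : wd j \in om |: liftS G by rewrite in_setU1 mem_liftS jG orbT.
rewrite /dgS /adddg msetE setU11 /= add0r XE monom_at_mset.
rewrite /wS /csig (big_setD1 _ jS) /=.
have [b bE] := cS_facet jG.
have Pn : \prod_(x in (om |: liftS G) :\ wd j) cK x != 0.
  by apply/prodf_neq0 => x /setD1P[_ xG]; apply: cK_neq0.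
have cjE : cK (wd j) = (-1) ^+ b * FracField.tofrac (bracket k d ((om |: liftS G) :\ wd j)).
  by rewrite /cK bE tofracM tofracXn tofracN tofrac1.
have Bn : FracField.tofrac (bracket k d ((om |: liftS G) :\ wd j)) != 0.
  by rewrite tofrac_eq0 bracket_neq0 // card_sigD1.
exists (b0 (+) b); rewrite cjE signr_addb.
move: (FracField.tofrac _) (\prod_(x in _) _) Bn Pn => x y x0 y0.
by rewrite -(mulrA _ x) invfM invr_sign -!mulrA [y * x]mulrC (mulVf (mulf_neq0 x0 y0)) mulr1.
Qed.
End StellarDegree.

(** * Parity of the orders *)

Lemma frac_rep (R : idomainType) (x : {fraction R}) : exists a b : R,
  b != 0 /\ x = FracField.tofrac a / FracField.tofrac b.
Proof.
suff [a [b [b0 E]]] : exists a b : R, b != 0 /\ x * FracField.tofrac b = FracField.tofrac a.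
  by exists a, b; split=> //; rewrite -E mulfK // tofrac_eq0.
elim/quotW: x => r; exists (frac r).1, (frac r).2; split; first exact: denom_ratioP.
unlock FracField.tofrac; rewrite -[LHS]FracField.pi_mul; apply/eqmodP.
by rewrite /= FracField.equivfE /FracField.mulf !numden_Ratio ?(mulf_neq0, oner_neq0, denom_ratioP) // !mulr1 mulrC.
Qed.

Lemma clear_denoms_pos (F : fieldType) (g E' t1 t2 g0 E s P Q S om : F) :
  E' != 0 -> t2 != 0 -> E != 0 -> P != 0 -> Q != 0 ->
  g / E' = (t1 / t2) ^+ 2 * (g0 / E * (s / (- P * Q) * S * om)) ->
  g0 * (s * S * E') * t1 ^+ 2 * om = E * (P * - (g * Q)) * t2 ^+ 2.
Proof.
move=> E'0 t20 E0 P0 Q0 eq; have -> : g = g / E' * E' by rewrite divfK.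
by rewrite eq; field; rewrite Q0 oppr_eq0 P0 E0 t20.
Qed.

Lemma clear_denoms_0 (F : fieldType) (g E' g0 E s P Q S : F) :
  E' != 0 -> E != 0 -> P != 0 -> Q != 0 ->
  g / E' = g0 / E + s / (- P * Q) * S ->
  g0 * (E' * Q) * P = E * (P * (g * Q) + s * S * E').
Proof.
move=> E'0 E0 P0 Q0 eq; have -> : g = g / E' * E' by rewrite divfK.
by rewrite eq; field; rewrite Q0 oppr_eq0 P0 E0.
Qed.

Lemma dgp_ext n d (L : fieldType) (dg dg' : 'X_{1..n} -> L) p :
  (forall be, mdeg be = d -> dg be = dg' be) -> dgp d dg p = dgp d dg' p.
Proof. by move=> E; apply: eq_bigr => m /eqP md; rewrite E. Qed.

Section GramGen.
Variables (k : fieldType) (d n : nat) (D : {set {set 'I_n}}).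
Local Notation S := {mpoly k[d * n]}.
Local Notation K := (Kf k (d * n)).
Local Notation E := (allbr k d D).
Variables (dg : 'X_{1..n} -> K) (P : 'X_{1..n} -> S).
Hypothesis PE : forall be, mdeg be = d ->
  dg be * FracField.tofrac E ^+ n.+1 = FracField.tofrac (P be).
Variables (q m : nat) (al : 'I_m -> 'X_{1..n}).

Lemma det_gram_ev (L : fieldType) (ev : {rmorphism S -> L}) : ev E != 0 ->
  \det (gram d (dgev D P ev) q (ell L n) (fun i => 'X_[al i])) =
  ev (\det (gram_num P q al)) / ev E ^+ (n.+1 * m).
Proof. by move=> evE; rewrite gram_ev // detZ det_map_mx exprVn -exprM mulrC. Qed.

Lemma det_gram_gen : E != 0 ->
  \det (gram d dg q (ell K n) (fun i => 'X_[al i])) =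
  FracField.tofrac (\det (gram_num P q al)) / FracField.tofrac E ^+ (n.+1 * m).
Proof.
move=> E0; have tE : tofracm k d n E != 0 by rewrite tofrac_eq0.
rewrite -[RHS](det_gram_ev tE); congr (\det _); apply/matrixP => i j; rewrite !mxE.
apply: dgp_ext => be bd; rewrite /dgev; apply: (canRL (mulfK _)); first by rewrite expf_neq0.
exact: PE.
Qed.
End GramGen.

Lemma rank_deg_mx1 n d (L : fieldType) (D : {set {set 'I_n}}) (e : {set 'I_n} -> L)
  (mu : 'I_n -> 'I_d -> L) (dg : 'X_{1..n} -> L) :
  good d D e -> (1 < d)%N -> lsop D mu -> degcond D mu dg -> \rank (deg_mx d D dg 0) = 1%N.
Proof.
move=> gD d2 lD dgP; have qd : (2 * 0 <= d)%N by [].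
have hV (i : 'I_1) : is_homog 0 ((fun=> 1) i : {mpoly L[n]}).
  by have := @homogX n L 0%MM; rewrite mdeg0 mpolyX0.
apply/eqP; rewrite eqn_leq; apply/andP; split.
  apply: (span_rank gD lD dgP qd hV) => a ha; exists (fun=> a@_0) => b _.
  rewrite (_ : _ - _ = 0) ?mul0r ?dgp0 // big_ord1; apply/mpolyP => m.
  rewrite mcoeffB mcoeffZ mcoeff1 mcoeff0; have [->|m0] := eqVneq m 0%MM; first by rewrite mulr1 subrr.
  rewrite mulr0 subr0; apply/eqP; apply: contraNT m0 => /ha/eqP; rewrite mdeg_eq0 //.
apply: (indep_rank gD lD dgP qd hV) => c nc i; have [F [FD Fd]] := good_facet gD.
have [_ _ /(_ F FD Fd) nz] := dgP.
have := nc 'X_[mset F]; rewrite big_ord1 -scalerAl mul1r dgpZ dgpX mdeg_mset Fd eqxx (ord1 i).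
have hF : is_homog (d - 0) ('X_[mset F] : {mpoly L[n]}).
  by have := @homogX n L (mset F); rewrite mdeg_mset Fd subn0.
by move/(_ hF)/eqP; rewrite mulf_eq0 (negbTE nz) orbF => /eqP.
Qed.

Lemma ndivides_morph (R R' : idomainType) (f : {rmorphism R -> R'}) P x :
  f P = 0 -> f x != 0 -> ~ divides P x.
Proof. by move=> fP fx [r E]; move: fx; rewrite E rmorphM fP mul0r eqxx. Qed.

Lemma gram_det_cast n d (L : fieldType) (dg : 'X_{1..n} -> L) q y m m'
  (V : 'I_m -> {mpoly L[n]}) (W : 'I_m' -> {mpoly L[n]}) : (2 * q <= d)%N -> is_homog 1 y -> m' = m ->
  spanN d dg q V -> (forall i, is_homog q (V i)) -> (forall i, is_homog q (W i)) ->
  exists t, \det (gram d dg q y W) = t ^+ 2 * \det (gram d dg q y V).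
Proof. by move=> qd hy mE; move: W; rewrite mE => W; apply: gram_det. Qed.

(** * Order along the bracket of the subdivided facet *)

Section StellarParity.
Variables (k : fieldType) (d n : nat) (D : {set {set 'I_n}}).
Local Notation S := {mpoly k[d * n]}.
Local Notation S1 := {mpoly k[d * n.+1]}.
Local Notation K := (Kf k (d * n)).
Local Notation K1 := (Kf k (d * n.+1)).
Local Notation E := (allbr k d D).
Local Notation om := (@ord_max n).
Implicit Types (F T : {set 'I_n}) (X : {set 'I_n.+1}).
Variables (e : {set 'I_n} -> K) (gD : good d D e) (d2 : (1 < d)%N).
Variables (e1 : {set 'I_n} -> K1) (gD1 : good d D e1).
Variables (dg : 'X_{1..n} -> K) (gdg : gendeg D dg).
Variables (P : 'X_{1..n} -> S).
Hypothesis PE : forall be, mdeg be = d ->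
  dg be * FracField.tofrac E ^+ n.+1 = FracField.tofrac (P be).
Variable q : nat.
Hypothesis qd : (2 * q <= d)%N.
Variable G : {set 'I_n}.
Hypotheses (GD : G \in D) (Gd : #|G| = d).
Variables (e' : {set 'I_n.+1} -> K1) (gD' : good d (stellar D G) e').
Hypothesis slp : SLP (stellar D G) (@thetaF k d n.+1 (liftS G)) q.

Local Notation D' := (stellar D G).
Local Notation E' := (allbr k d D').
Local Notation PG := (bracket k d (liftS G)).
Let d0 : (0 < d)%N := ltnW d2.
Let Sd : #|liftS G| = d. Proof. by rewrite card_liftS. Qed.

(** A point where [PG] is 0 and the sum is 1: one vertex of [G] gets the zero vector, the new vertex
    gets its basis vector, and the other vertices keep theirs. Then only one coordinate of the
    relation survives. *)
Lemma sum_cS_ndivides : ~ divides PG (\sum_j cS k d G j).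
Proof.
pose i0 : 'I_d := Ordinal d0; pose pt m := enum_val (cast_ord (esym Sd) m).
have ptI : injective pt by move=> x y /enum_val_inj/cast_ord_inj.
have ptG m : pt m \in liftS G by apply: enum_valP.
have pto m : (pt m == om) = false by apply/eqP => E1; have := ptG m; rewrite E1 om_liftS.
pose mu (v : 'I_n.+1) (i : 'I_d) : k :=
  if v == om then (i == i0)%:R else if v == pt i0 then 0 else (v == pt i)%:R.
pose f := subst (idfun : {rmorphism k -> k}) mu.
have fX v i : f (xvar k v i) = mu v i by apply: substX.
have mu_pt i m : mu (pt m) i = if m == i0 then 0 else (i == m)%:R.
  by rewrite /mu pto !(inj_eq ptI) [m == i]eq_sym.
have col0 (nu : 'I_n.+1 -> 'I_d -> k) : (forall i, nu (pt i0) i = 0) -> \det (face_mx nu (liftS G)) = 0.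
  move=> nu0; rewrite (expand_det_col _ i0) big1 // => i _.
  by rewrite (face_mxE _ Sd) nu0 mul0r.
have fP : f PG = 0 by rewrite subst_bracket; apply: col0 => i; rewrite mu_pt eqxx.
apply: (ndivides_morph fP); rewrite rmorph_sum (bigD1 (pt i0)) //= big1 => [|j ji].
  rewrite addr0 /cS map_cram /cram pto ptG (_ : face_mx _ _ = 1%:M) ?det1 ?oner_neq0 //.
  apply/matrixP => i m; rewrite (face_mxE _ Sd) -/(pt m) (inj_eq ptI) mxE.
  case: (m =P i0) => [->|/eqP mi]; first by rewrite fX /mu eqxx.
  by rewrite fX mu_pt (negbTE mi).
rewrite /cS map_cram /cram; case: eqP => _.
  by rewrite col0 ?oppr0 // => i; rewrite fX mu_pt eqxx.
by case: ifP => // jG; rewrite col0 // => i; rewrite eq_sym (negbTE ji) fX mu_pt eqxx.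
Qed.

(** Each factor is, up to sign, the bracket of another set of [d] vertices, which survives the
    specialization that kills [PG]. *)
Lemma prod_cS_ndivides : ~ divides PG (\prod_(j in liftS G) cS k d G j).
Proof.
apply: (ndivides_morph (zeroF_bracket k d0 Sd)); rewrite rmorph_prod; apply/prodf_neq0 => y.
case: (ordSP y) => [|j]; first by rewrite om_liftS.
rewrite mem_liftS => jG; have [b ->] := cS_facet k Gd jG.
rewrite rmorphM rmorphXn rmorphN rmorph1 mulf_neq0 ?signr_eq0 //.
apply: zeroF_bracket_neq0 => //; first exact: card_sigD1.
apply/eqP => /setP/(_ om); rewrite om_liftS !inE eqxx eq_sym wd_om //.
Qed.

(** Only the ground field grows: up to nonzero scalars both matrices are images of one over [S]
    under injective maps, so the rank comparison holds in both directions. *)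
Lemma rank_iota : E != 0 -> \rank (deg_mx d D (dg_iota D P) q) = \rank (deg_mx d D dg q).
Proof.
move=> E0; have evE : ev_iota k d n E != 0 by rewrite /ev_iota /= tofrac_eq0 iota_neq0.
apply/eqP; rewrite eqn_leq (rank_deg_ev PE) //=.
set t := FracField.tofrac E ^+ n.+1 : K.
have t0 : t != 0 by rewrite expf_neq0 // tofrac_eq0.
have -> : \rank (deg_mx d D dg q) = \rank (t *: deg_mx d D dg q) by rewrite (eqmx_scale _ t0).
have -> : \rank (deg_mx d D (dg_iota D P) q) = \rank (ev_iota k d n E ^+ n.+1 *: deg_mx d D (dg_iota D P) q).
  by rewrite (eqmx_scale _ (expf_neq0 _ evE)).
apply: (mxrank_specialize (f := ev_iota k d n) (g := tofracm k d n)) => [x y|i j].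
  move/tofracI => /(congr1 (ret_S k d n)).
  by rewrite !ret_iota.
rewrite !mxE /=; case: ifP => [/and3P[/eqP iq _ /eqP jq]|_]; last by exists 0; rewrite !mulr0 !rmorph0.
eexists (P _); split.
  by rewrite mulrC; apply: divfK; apply: expf_neq0.
by rewrite mulrC; apply: PE; rewrite mdegD mdeg_mset iq addnC.
Qed.

(** Free of fractions and placed in the ring with the extra vertex, so that [ord_parity] applies:
    modulo squares and factors not divisible by [PG], the Gram determinant of [D] behaves like
    [PG]. *)
Lemma stellar_parity : exists r (al : 'I_r -> 'X_{1..n}), [/\ r = \rank (deg_mx d D dg q),
  forall i, mdeg (al i) = q & exists f g u1 u2, [/\ ~ divides PG f, ~ divides PG g, u1 != 0, u2 != 0 &
    iota_S k d n (\det (gram_num P q al)) * g * u1 ^+ 2 =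
    iota_S k d n E ^+ (n.+1 * r) * (PG * f) * u2 ^+ 2]].
Proof.
have E0 : E != 0 by exact: E_neq0.
have evE : ev_iota k d n E != 0 by rewrite /ev_iota /= tofrac_eq0 iota_neq0.
have [b0 b0E] := dg_iota_facet gdg PE GD Gd.
have gdg' := gendeg_stellar gD1 gdg PE GD Gd b0E.
have [P' PE'] := deg_num gD' gdg'.
have GD' : liftS G \notin D' by rewrite (stellar_lift gD1 GD Gd) eqxx andbF.
have [r' [al' [r'E al'q nz]]] := gram_ell_zeroF gD' d2 gdg' PE' qd Sd GD' slp.
have E'0 : E' != 0 by exact: E_neq0.
have zP := zeroF_bracket k d0 Sd.
have pP : prime_elt PG by apply: bracket_prime.
have P0 : PG != 0 by apply: bracket_neq0.
have nE' : ~ divides PG E' by apply: (ndivides_morph zP); apply: zeroF_allbr.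
have nX (R : idomainType) (x y : R) m : prime_elt x -> ~ divides x 1 -> ~ divides x y -> ~ divides x (y ^+ m).
  by move=> px n1 ny; elim: m => [|m IH] //; rewrite exprS; apply: prime_elt_prod.
have n1 : ~ divides PG 1 by apply: (ndivides_morph zP); rewrite rmorph1 oner_neq0.
have ns (b : bool) : ~ divides PG ((-1) ^+ b).
  by apply: (ndivides_morph zP); rewrite rmorphXn rmorphN rmorph1 signr_eq0.
set g' := \det (gram_num P' q al') in nz.
have ng' : ~ divides PG g' by apply: (ndivides_morph zP).
set N' := (n.+2 * r')%N.
have nE'N : ~ divides PG (E' ^+ N') by apply: nX.
set Q := \prod_(j in liftS G) cS k d G j.
have nQ : ~ divides PG Q by apply: prod_cS_ndivides.
have Q0 : Q != 0 by apply: contra_not_neq nQ => ->; exists 0; rewrite mulr0.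
have csE : csig k d G = - FracField.tofrac PG * FracField.tofrac Q.
  rewrite /csig big_setU1 ?om_liftS //= /cK cS_om tofracN; congr (_ * _).
  by rewrite (rmorph_prod (tofracm k d n.+1)).
have wE : wS k d G b0 = FracField.tofrac ((-1) ^+ b0) / (- FracField.tofrac PG * FracField.tofrac Q).
  by rewrite /wS csE tofracXn tofracN tofrac1.
have gram' := det_gram_gen PE' q al' E'0; rewrite -/g' -/N' in gram'.
have sE : \sum_j cK k d G j = FracField.tofrac (\sum_j cS k d G j).
  by rewrite (rmorph_sum (tofracm k d n.+1)).
have tE' : FracField.tofrac (E' ^+ N') != 0 by rewrite tofrac_eq0 expf_neq0.
have tP : FracField.tofrac PG != 0 by rewrite tofrac_eq0.
have tQ : FracField.tofrac Q != 0 by rewrite tofrac_eq0.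
have lD' : lsop D' (evpar (tofracm k d n.+1)) by apply: (ev_lsop gD'); rewrite tofrac_eq0.
have dgP' := degcond_gen gdg' E'0.
have dgP := degcond_ev gdg PE evE.
have lD := ev_lsop gD1 evE.
have nS := sum_cS_ndivides.
(* For [q = 0] the new vertex adds no basis vector: 1 spans both quotients. The degree of the [d]-th
   power of [ell] for [D] is that for the subdivision, regular along [PG], minus
   [wS * (\sum_j cK j) ^+ d], which has a simple pole. *)
have [q0|q0] := posnP q.
  have r1 : \rank (deg_mx d D dg q) = 1%N.
    by rewrite -rank_iota // q0; apply: rank_deg_mx1 gD1 d2 lD dgP.
  have r'1 : r' = 1%N by rewrite r'E q0; apply: rank_deg_mx1 gD' d2 lD' dgP'.
  pose al := (fun=> 0%MM) : 'I_1 -> 'X_{1..n}.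
  exists 1%N, al; split; [by rewrite r1|by move=> i; rewrite /al mdeg0|].
  have al'0 i : al' i = 0%MM by apply/eqP; rewrite -mdeg_eq0 al'q q0.
  set x0 := \det _.
  have gi := det_gram_ev P q al evE; rewrite -/x0 in gi.
  have key : FracField.tofrac g' / FracField.tofrac (E' ^+ N') =
    FracField.tofrac (iota_S k d n x0) / FracField.tofrac (iota_S k d n E ^+ (n.+1 * 1)) +
    FracField.tofrac ((-1) ^+ b0) / (- FracField.tofrac PG * FracField.tofrac Q) *
    FracField.tofrac ((\sum_j cS k d G j) ^+ d).
    rewrite (tofracXn N') -gram'.
    transitivity (\det (gram d (dg_iota D P) q (ell K1 n) (fun i => 'X_[al i])) +
      wS k d G b0 * (\sum_j cK k d G j) ^+ d).
      have -> : \det (gram d (dgS D P G b0) q (ell K1 n.+1) (fun i : 'I_r' => 'X_[al' i])) =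
         dgp d (dgS D P G b0) (ell K1 n.+1 ^+ d).
        move: al' al'0 {gram' g' nz ng' al'q N' nE'N tE' r'E}; rewrite r'1 => al' al'0.
        by rewrite det_mx11 mxE !al'0 mpolyX0 !mulr1 q0 subn0.
      rewrite det_mx11 mxE mpolyX0 !mulr1 q0 subn0 dgp_split; last first.
        rewrite -[X in is_homog X]mul1n; apply: homog_exp.
        exact: homog_ell.
      rewrite rmorphXn pres_ell /dg_iota; congr (_ + _ * _).
      rewrite rmorphXn /=; congr (_ ^+ d); rewrite /ell (raddf_sum (meval _)).
      by apply: eq_bigr => j _; rewrite /= mevalXU.
    by rewrite gi wE sE -!(rmorphXn (tofracm k d n.+1)) -(rmorphXn (iota_S k d n)).
  have Ei0 : FracField.tofrac (iota_S k d n E ^+ (n.+1 * 1)) != 0.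
    by rewrite tofrac_eq0 expf_neq0 // iota_neq0.
  have := clear_denoms_0 tE' Ei0 tP tQ key.
  rewrite -!(rmorphM (tofracm k d n.+1)) -(rmorphD (tofracm k d n.+1)) -(rmorphM (tofracm k d n.+1)).
  move/tofracI => {}key.
  (* The simple pole is made a simple zero by the square of [PG], taken as [u1]. *)
  exists (PG * (g' * Q) + (-1) ^+ b0 * (\sum_j cS k d G j) ^+ d * E' ^+ N'), (E' ^+ N' * Q), PG, 1.
  split=> //; rewrite ?oner_neq0 //.
  - move=> [x xE]; have : divides PG ((-1) ^+ b0 * (\sum_j cS k d G j) ^+ d * E' ^+ N').
      by exists (x - g' * Q); rewrite mulrBr -xE; ring.
    by do !apply: prime_elt_prod => //; apply: nX.
  - exact: prime_elt_prod.
  by rewrite expr2 mulrA key expr1n; ring.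
have [al [alq alI alS]] := rank_basis gD1 lD dgP qd.
move: al alq alI alS; rewrite -/(dg_iota D P) rank_iota //; set r := \rank _ => al alq alI alS.
exists r, al; split=> //.
have hal i : is_homog q ('X_[al i] : {mpoly K1[n]}) by have := @homogX n K1 (al i); rewrite alq.
have hal' i : is_homog q ('X_[al' i] : {mpoly K1[n.+1]}) by have := @homogX n.+1 K1 (al' i); rewrite al'q.
have c0 : cK k d G om != 0 by apply: cK_neq0 => //; rewrite setU11.
have w0 : wS k d G b0 != 0.
  apply: mulf_neq0; first by rewrite signr_eq0.
  by rewrite invr_eq0; apply: csig_neq0.
pose W := addV (cK k d G) q (fun i => 'X_[al i] : {mpoly K1[n]}).
have hW i : is_homog q (W i) by apply: homog_addV.
have sW : spanN d (dgS D P G b0) q W by apply: span_addV.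
have iW : indepN d (dgS D P G b0) q W by apply: indep_addV.
have r'1 : r' = (r + 1)%N.
  apply/eqP; rewrite r'E eqn_leq (span_rank gD' lD' dgP' qd hW sW) //=.
  exact: (indep_rank gD' lD' dgP' qd hW iW).
have hell := @homog_ell n.+1 K1.
have [t tE] := gram_det_cast qd hell r'1 sW hW hal'.
have [t1 [t2 [t20 tf]]] := frac_rep t.
set x0 := \det (gram_num P q al).
have gi := det_gram_ev P q al evE; rewrite -/x0 -/(dg_iota D P) in gi.
have Ei0 : FracField.tofrac (iota_S k d n E ^+ (n.+1 * r)) != 0.
  by rewrite tofrac_eq0 expf_neq0 // iota_neq0.
(* The subdivision has order 0 on the left. On the right the odd power of [PG] comes from [wS]: the
   contribution of [om] is the even power [2 * q], and the sum of the [cS j] is not divisible by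
   [PG]. *)
have key : FracField.tofrac g' / FracField.tofrac (E' ^+ N') =
    (FracField.tofrac t1 / FracField.tofrac t2) ^+ 2 *
    (FracField.tofrac (iota_S k d n x0) / FracField.tofrac (iota_S k d n E ^+ (n.+1 * r)) *
    (FracField.tofrac ((-1) ^+ b0) / (- FracField.tofrac PG * FracField.tofrac Q) *
     FracField.tofrac ((\sum_j cS k d G j) ^+ (d - 2 * q)) *
     FracField.tofrac ((- PG) ^+ (2 * q)))).
  rewrite (tofracXn N') -gram' tE tf; congr (_ * _).
  rewrite /W /dgS det_gram_addV // gi wE sE /cK cS_om.
  by rewrite -!(rmorphXn (tofracm k d n.+1)) -(rmorphXn (iota_S k d n)).
have t2' : FracField.tofrac t2 != 0 :> K1 by rewrite tofrac_eq0.
have := clear_denoms_pos tE' t2' Ei0 tP tQ key.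
rewrite -!(rmorphXn (tofracm k d n.+1)) -!(rmorphM (tofracm k d n.+1)).
rewrite -(rmorphN (tofracm k d n.+1)) -!(rmorphM (tofracm k d n.+1)).
move/tofracI => {}key.
have t10 : t1 != 0.
  apply: contra_neq (_ : \det (gram d (dgS D P G b0) q (ell K1 n.+1) (fun i => 'X_[al' i])) != 0).
    by move=> t10; rewrite tE tf t10 tofrac0 mul0r expr0n mul0r.
  rewrite gram'; apply: mulf_neq0; last by rewrite invr_eq0; apply: expf_neq0; rewrite tofrac_eq0.
  by rewrite tofrac_eq0; apply: contra_not_neq ng' => ->; exists 0; rewrite mulr0.
exists (- (g' * Q)), ((-1) ^+ b0 * (\sum_j cS k d G j) ^+ (d - 2 * q) * E' ^+ N'), (t1 * (- PG) ^+ q), t2.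
split=> //.
- by case=> x xE; apply: (prime_elt_prod pP ng' nQ); exists (- x); rewrite mulrN -xE opprK.
- by do !apply: prime_elt_prod => //; apply: nX.
- by rewrite mulf_neq0 // expf_neq0 // oppr_eq0.
by rewrite -key exprMn -exprM (mulnC q 2) !mulrA.
Qed.
End StellarParity.

Lemma clear_denoms_Dq (F : fieldType) (t1 t2 D x E pa pb : F) : t2 != 0 -> E != 0 ->
  x / E = (t1 / t2) ^+ 2 * D -> D * pb = pa -> pa * E * t1 ^+ 2 = pb * x * t2 ^+ 2.
Proof.
move=> t20 E0 eq <-; have -> : x = x / E * E by rewrite divfK.
by rewrite eq; field.
Qed.

Lemma cancel_product (R : idomainType) (pa pb E x t1 t2 g u1 h u2 : R) : x != 0 -> E != 0 ->
  pa * E * t1 ^+ 2 = pb * x * t2 ^+ 2 -> x * g * u1 ^+ 2 = E * h * u2 ^+ 2 ->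
  pa * g * (t1 * u1) ^+ 2 = pb * h * (t2 * u2) ^+ 2.
Proof.
move=> x0 E0 e1 e2; apply: (mulfI (mulf_neq0 x0 E0)).
transitivity ((pa * E * t1 ^+ 2) * (x * g * u1 ^+ 2)); first by ring.
by rewrite e1 e2; ring.
Qed.

Section Parity.
Variables (k : fieldType) (d n : nat) (D : {set {set 'I_n}}).
Local Notation S := {mpoly k[d * n]}.
Local Notation S1 := {mpoly k[d * n.+1]}.
Local Notation K := (Kf k (d * n)).
Local Notation K1 := (Kf k (d * n.+1)).
Local Notation E := (allbr k d D).
Implicit Types (F G : {set 'I_n}).
Variables (e : {set 'I_n} -> K) (gD : good d D e) (d2 : (1 < d)%N).
Variables (dg : 'X_{1..n} -> K) (gdg : gendeg D dg).
Variable q : nat.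
Hypothesis qd : (2 * q <= d)%N.
Variables (m : nat) (V : 'I_m -> {mpoly K[n]}).
Hypotheses (hV : forall i, is_homog q (V i)) (iV : indepN d dg q V) (sV : spanN d dg q V).
Local Notation Dq := (\det (gram d dg q (ell K n) V)).
Let d0 : (0 < d)%N := ltnW d2.

Let E0 : E != 0. Proof. exact: E_neq0. Qed.

(** Compares the given basis with a monomial one, at the cost of a square, and clears denominators
    for every fraction [pa / pb] that represents the determinant. *)
Lemma gram_basis (P : 'X_{1..n} -> S) r (al : 'I_r -> 'X_{1..n}) :
  (forall be, mdeg be = d -> dg be * FracField.tofrac E ^+ n.+1 = FracField.tofrac (P be)) ->
  r = \rank (deg_mx d D dg q) -> (forall i, mdeg (al i) = q) -> \det (gram_num P q al) != 0 ->
  Dq != 0 /\ exists t1 t2 : S, [/\ t1 != 0, t2 != 0 & forall pa pb,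
    Dq * FracField.tofrac pb = FracField.tofrac pa ->
    pa * E ^+ (n.+1 * r) * t1 ^+ 2 = pb * \det (gram_num P q al) * t2 ^+ 2].
Proof.
move=> PE rE alq x0.
have tE : tofracm k d n E != 0 by rewrite tofrac_eq0.
have lD := ev_lsop gD tE; have dgP := degcond_gen gdg E0.
have rm : r = m.
  apply/eqP; rewrite rE eqn_leq (span_rank gD lD dgP qd hV sV).
  exact: (indep_rank gD lD dgP qd hV iV).
have hell := @homog_ell n K.
have hal i : is_homog q ('X_[al i] : {mpoly K[n]}) by have := @homogX n K (al i); rewrite alq.
have [t tD] := gram_det_cast qd hell rm sV hV hal.
have gE := det_gram_gen PE q al E0.
have [t1 [t2 [t20 tf]]] := frac_rep t.
have EN : FracField.tofrac E ^+ (n.+1 * r) != 0 by rewrite expf_neq0 // tofrac_eq0.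
have lhs0 : \det (gram d dg q (ell K n) (fun i => 'X_[al i])) != 0.
  by rewrite gE; apply: mulf_neq0; [rewrite tofrac_eq0 | rewrite invr_eq0].
have [t0 Dn] : t != 0 /\ Dq != 0.
  move: lhs0; rewrite tD; split.
    by apply: contraNneq lhs0 => ->; rewrite expr0n mul0r.
  by apply: contraNneq lhs0 => ->; rewrite mulr0.
split=> //; exists t1, t2; split=> //.
  by apply: contraNneq t0 => t10; rewrite tf t10 tofrac0 mul0r.
move=> pa pb papb.
have t2' : FracField.tofrac t2 != 0 :> K by rewrite tofrac_eq0.
have key : FracField.tofrac (\det (gram_num P q al)) / FracField.tofrac E ^+ (n.+1 * r) =
    (FracField.tofrac t1 / FracField.tofrac t2) ^+ 2 * Dq by rewrite -gE tD tf.
have := clear_denoms_Dq t2' EN key papb.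
rewrite -!(rmorphXn (tofracm k d n)) -!(rmorphM (tofracm k d n)).
by move/tofracI.
Qed.

Lemma facet_parity (e1 : {set 'I_n} -> K1) G (e' : {set 'I_n.+1} -> K1) :
  good d D e1 -> G \in D -> #|G| = d -> good d (stellar D G) e' ->
  SLP (stellar D G) (@thetaF k d n.+1 (liftS G)) q ->
  Dq != 0 /\ forall o, has_ord (bracket k d G) Dq o -> odd `|o|%N.
Proof.
move=> gD1 GD Gd gD' slp; have [P PE] := deg_num gD gdg.
have [r [al [rE alq [f [g [u1 [u2 [nf ng u10 u20 key]]]]]]]] :=
  stellar_parity d2 gD1 gdg PE qd GD Gd gD' slp.
set x := \det _ in key.
have Sd : #|liftS G| = d by rewrite card_liftS.
have P0 : bracket k d (liftS G) != 0 by apply: bracket_neq0.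
have Ei : iota_S k d n E ^+ (n.+1 * r) != 0 by rewrite expf_neq0 // iota_neq0.
have f0 : f != 0 by apply: contra_not_neq nf => ->; exists 0; rewrite mulr0.
have x0 : x != 0.
  rewrite -(iota_neq0 (n := n)); apply: contraTneq (oner_neq0 k) => xz.
  have : iota_S k d n E ^+ (n.+1 * r) * (bracket k d (liftS G) * f) * u2 ^+ 2 != 0.
    by apply: mulf_neq0; [apply: mulf_neq0 => //; apply: mulf_neq0 | apply: expf_neq0].
  by rewrite -key xz !mul0r eqxx.
have [Dn [t1 [t2 [t10 t20 tP]]]] := gram_basis PE rE alq x0.
split=> // o /has_ordP[a [b [o1 [o2 [Dab na nb _ ->]]]]].
(* The relation for [Dq] is sent to the ring with the extra vertex, where the one from
   [stellar_parity] lives. *)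
have /(congr1 (iota_S k d n)) := tP _ _ Dab; rewrite !rmorphM !rmorphXn => E1.
have xi : iota_S k d n x != 0 by rewrite iota_neq0.
have F1 : bracket k d (liftS G) * f = bracket k d (liftS G) ^+ 1 * f by rewrite expr1.
have := cancel_product xi Ei E1 key; rewrite !iota_bracket F1 => E2.
suff -> : odd (o1 + o2) = odd 1 by [].
apply: (ord_parity (c := 1) (P := bracket k d (liftS G)) _ P0 _ (iota_ndivides na) (iota_ndivides nb) nf ng _ _ E2).
- exact: bracket_prime.
- by apply: ord_exists; apply: bracket_size.
- by apply: mulf_neq0; [rewrite iota_neq0; exact: t20 | exact: u20].
by apply: mulf_neq0; [rewrite iota_neq0; exact: t10 | exact: u10].
Qed.

Lemma nonface_parity F : #|F| = d -> F \notin D -> SLP D (@thetaF k d n F) q ->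
  forall o, has_ord (bracket k d F) Dq o -> ~~ odd `|o|%N.
Proof.
move=> Fd FD slp; have [P PE] := deg_num gD gdg.
have [r [al [rE alq nz]]] := gram_ell_zeroF gD d2 gdg PE qd Fd FD slp.
set x := \det _ in nz.
have x0 : x != 0 by apply: contraNneq nz => ->; rewrite rmorph0.
have zP := zeroF_bracket k d0 Fd.
have P0 : bracket k d F != 0 by apply: bracket_neq0.
have [Dn [t1 [t2 [t10 t20 tP]]]] := gram_basis PE rE alq x0.
move=> o /has_ordP[a [b [o1 [o2 [Dab na nb _ ->]]]]].
have E1 := tP _ _ Dab.
have E2 : (bracket k d F ^+ o1 * a) * E ^+ (n.+1 * r) * t1 ^+ 2 =
  (bracket k d F ^+ o2 * b) * (bracket k d F ^+ 0 * x) * t2 ^+ 2 by rewrite expr0 mul1r.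
rewrite (ord_parity (P := bracket k d F) _ P0 _ na nb _ _ _ _ E2) //.
- exact: bracket_prime.
- by apply: ord_exists; apply: bracket_size.
- exact: (ndivides_morph zP).
by apply: (ndivides_morph zP); rewrite rmorphXn; apply: expf_neq0; apply: zeroF_allbr.
Qed.
End Parity.

(** * Homology manifolds *)

Section LinkHomology.
Variables (k L : fieldType) (f : {rmorphism k -> L}) (n : nat).
Implicit Types (A H T : {set 'I_n}) (c b : {set 'I_n} -> L).
Variable C : {set {set 'I_n}}.
Hypothesis C_closed : forall A H, A \in C -> H \subset A -> H \in C.

Local Notation B s := (map_mx f (bdmx k C s)).
Definition chrow c : 'rV[L]_#|{set 'I_n}| := \row_i c (enum_val i).
Definition level s : {set {set 'I_n}} := [set A in C | #|A| == s].

Lemma mul_bdmx c s A : (chrow c *m B s) 0 (enum_rank A) =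
  (A \in C)%:R * bd (fun X => if X \in level s then c X else 0) A.
Proof.
rewrite mxE; transitivity (\sum_(X : {set 'I_n}) \sum_v
    (if [&& v \in X, A == X :\ v, X \in level s & A \in C] then c X * (-1) ^+ sg v X else 0)).
  rewrite (reindex enum_rank) /=; last by exists enum_val => x _; rewrite ?enum_rankK ?enum_valK.
  apply: eq_bigr => X _; rewrite !mxE /= !enum_rankK inE.
  case: (X \in C); last by rewrite /= rmorph0 mulr0 big1 // => v _; rewrite !andbF.
  case: (A \in C); last by rewrite /= rmorph0 mulr0 big1 // => v _; rewrite !andbF.
  case: (#|X| == s); last by rewrite /= rmorph0 mulr0 big1 // => v _; rewrite !andbF.
  rewrite /= rmorph_sum mulr_sumr big_mkcond; apply: eq_bigr => v _; rewrite !andbT.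
  by case: ifP; rewrite // rmorphXn rmorphN rmorph1.
rewrite exchange_big /bd mulr_sumr; apply: eq_bigr => v _; rewrite /io.
case: ifP => vA.
  rewrite mulr0 big1 // => X _; case: ifP => // /and4P[_ /eqP AE _ _].
  by move: vA; rewrite AE !inE eqxx.
rewrite (bigD1 (v |: A)) //= setU11 setU1K ?vA // eqxx /= [X in _ + X]big1 ?addr0.
  rewrite sgU1; case: (_ \in level s); case: (A \in C); rewrite /= ?mulr0 ?mul0r //.
  by rewrite mul1r mulrC.
move=> X XA; case: ifP => // /and4P[vX /eqP AE _ _].
by move: XA; rewrite AE setD1K // eqxx.
Qed.

(** Its row space consists of the chains supported on [level s]; it is needed because the boundary
    matrix has a zero row for every other subset of the vertices, and these rows enlarge the
    kernel. *)
Definition lvmx s : 'M[L]_(#|level s|, #|{set 'I_n}|) :=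
  \matrix_(i, j) ((enum_val i == enum_val j :> {set 'I_n})%:R).
Definition cyc s := (lvmx s :&: kermx (B s))%MS.

Lemma supp_lvmx c s : (forall A, c A != 0 -> A \in level s) -> (chrow c <= lvmx s)%MS.
Proof.
move=> cs; apply/submxP; exists (\row_i c (enum_val i)); apply/rowP => j; rewrite !mxE.
set A := enum_val j; have [AS|AS] := boolP (A \in level s).
  rewrite (bigD1 (enum_rank_in AS A)) //= !mxE enum_rankK_in // eqxx mulr1 big1 ?addr0 // => i iA.
  rewrite !mxE; case: eqP => [E|_]; last by rewrite mulr0.
  by case/eqP: iA; apply: enum_val_inj; rewrite enum_rankK_in.
rewrite big1 => [|i _]; first by apply/eqP; apply: contraNT AS => /cs.
rewrite !mxE -/A; case: eqP => [E|_]; last by rewrite mulr0.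
by case/negP: AS; rewrite -E enum_valP.
Qed.

Lemma cyc_chain c s : (forall A, c A != 0 -> A \in level s) ->
  (forall A, A \in C -> bd c A = 0) -> (chrow c <= cyc s)%MS.
Proof.
move=> cs c0; rewrite sub_capmx supp_lvmx //=; apply/sub_kermxP/rowP => j.
rewrite -(enum_valK j) mul_bdmx mxE; case: (boolP (_ \in C)) => [jC|_]; last by rewrite mul0r.
rewrite mul1r -[RHS](c0 _ jC); apply: bd_eq => X.
by case: ifPn => // Xs; apply/esym/eqP; apply: contraNT Xs => /cs.
Qed.

Lemma lvmx_bd s : (\rank (B s) <= \rank (lvmx s *m B s))%N.
Proof.
apply/mxrankS/row_subP => i; have [iS|iS] := boolP (enum_val i \in level s).
  apply: (submx_trans _ (row_sub (enum_rank_in iS (enum_val i)) _)).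
  rewrite row_mul (_ : row _ (lvmx s) = delta_mx 0 i) -?rowE ?submx_refl //.
  by apply/rowP => j; rewrite !mxE enum_rankK_in // eqxx (inj_eq enum_val_inj) eq_sym.
rewrite (_ : row i _ = 0) ?sub0mx //; apply/rowP => j; rewrite !mxE /=.
by move: iS; rewrite inE; case: (_ \in C) => /= [/negbTE ->|_]; rewrite ?andbF rmorph0.
Qed.

Lemma rank_cyc s : (\rank (cyc s) <= #|level s| - \rank (bdmx k C s))%N.
Proof.
rewrite -(mxrank_map f) -(addKn (\rank (lvmx s *m B s)) (\rank (cyc s))) mxrank_mul_ker.
exact: leq_sub (rank_leq_row _) (lvmx_bd s).
Qed.

Lemma bd_cyc s : (B s.+1 <= cyc s)%MS.
Proof.
apply/row_subP => i; set X := enum_val i.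
have -> : row i (B s.+1) = chrow (fun A => if (X \in level s.+1) && (A \in C) then
    bd (fun Y => (Y == X)%:R) A else 0).
  apply/rowP => j; rewrite rowE -[j]enum_valK.
  have -> : delta_mx 0 i = chrow (fun Y => (Y == X)%:R) :> 'rV[L]_ _.
    by apply/rowP => l; rewrite !mxE eqxx (inj_eq enum_val_inj).
  rewrite mul_bdmx mxE enum_valK; case: (_ \in C); rewrite ?andbF ?mul0r // andbT mul1r.
  case: ifPn => XS; last by apply: bd0 => v _; case: ifP => // vS; case: eqP => // E; rewrite -E vS in XS.
  by apply: bd_eq => Y; case: ifPn => // YS; case: eqP => // E; rewrite E XS in YS.
have [XS|XS] := boolP (X \in level s.+1); last first.
  by rewrite (_ : chrow _ = 0) ?sub0mx //; apply/rowP => j; rewrite !mxE.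
apply: cyc_chain => [A|A aC].
  case: (boolP (A \in C)) => [aC|_] /=; last by rewrite eqxx.
  move=> /bd_nz[v vA]; case: (_ |: _ =P X) => [E|_]; last by rewrite eqxx.
  by move: XS; rewrite -E !inE aC cardsU1 vA add1n eqSS => /andP[].
transitivity (bd (bd (fun Y : {set 'I_n} => (Y == X)%:R : L)) A); last exact: bdbd.
apply: bd_ext => v vA; case: ifPn => // vC.
apply/esym/bd0 => w wA; case: eqP => // E.
case/negP: vC; apply: (C_closed (A := X)); first by move: XS; rewrite inE => /andP[].
by rewrite -E subsetUr.
Qed.

(** A truncated difference equal to 0 is the inequality saying that boundaries have at least the
    rank of the cycles that contain them. Ranks over [k] and [L] agree. *)
Lemma cyc_exact c s : rbetti k C s = 0%N -> (forall A, c A != 0 -> A \in level s) ->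
  (forall A, A \in C -> bd c A = 0) ->
  exists b, (forall A, b A != 0 -> A \in level s.+1) /\ (forall A, A \in C -> bd b A = c A).
Proof.
move=> /eqP; rewrite subn_eq0 => le cs c0.
have /submxP[u uE] : (chrow c <= map_mx f (bdmx k C s.+1))%MS.
  apply: submx_trans (cyc_chain cs c0) _; rewrite -(geq_leqif (mxrank_leqif_sup (bd_cyc s))).
  by rewrite mxrank_map; apply: leq_trans (rank_cyc s) le.
pose b0 A := u 0 (enum_rank A).
have uE0 : u = chrow b0 by apply/rowP => j; rewrite mxE /b0 enum_valK.
exists (fun X => if X \in level s.+1 then b0 X else 0); split.
  by move=> A; case: ifP; rewrite // eqxx.
move=> A aC; have := mul_bdmx b0 s.+1 A; rewrite aC mul1r => <-.
by rewrite -uE0 -uE mxE enum_rankK.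
Qed.

Lemma bdmx_empty s : level s = set0 -> \rank (bdmx k C s) = 0%N.
Proof.
move=> ls; apply/eqP; rewrite mxrank_eq0; apply/eqP/matrixP => i j; rewrite !mxE /=.
have := in_set0 (enum_val i); rewrite -ls inE.
by case: (_ \in C) => //= ->; rewrite andbF.
Qed.

(** With no faces above, there are no boundaries, so the Betti number bounds the dimension of the
    space of cycles by 1, and [b] spans it. *)
Lemma cyc_top c b s : rbetti k C s = 1%N -> level s.+1 = set0 ->
  (forall A, c A != 0 -> A \in level s) ->
  (forall A, A \in C -> bd c A = 0) -> (forall A, b A != 0 -> A \in level s) ->
  (forall A, A \in C -> bd b A = 0) -> (exists A, b A != 0) -> exists a, forall A, c A = a * b A.
Proof.
move=> be /bdmx_empty r0 cs c0 bs b0 [A bA]; have cZ := cyc_chain cs c0; have bZ := cyc_chain bs b0.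
have bn : chrow b != 0.
  by apply: contraNneq bA => /rowP/(_ (enum_rank A)); rewrite !mxE enum_rankK => ->.
have r1 : (\rank (cyc s) <= \rank (chrow b))%N.
  by rewrite rank_rV bn; have := rank_cyc s; move: be; rewrite /rbetti r0 subn0 => ->.
have /sub_rVP[a aE] : (chrow c <= chrow b)%MS.
  apply: submx_trans cZ _.
  by rewrite -(geq_leqif (mxrank_leqif_sup bZ)).
by exists a => X; have := congr1 (fun w : 'rV__ => w 0 (enum_rank X)) aE; rewrite !mxE enum_rankK.
Qed.
End LinkHomology.

Lemma disjointsU1 n v (A T : {set 'I_n}) : [disjoint v |: A & T] = (v \notin T) && [disjoint A & T].
Proof.
rewrite !disjoints_subset -disjoints1 disjoints_subset; exact: subUset.
Qed.

Lemma disjointDT n (H T : {set 'I_n}) : [disjoint H :\: T & T].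
Proof. by rewrite disjoints_subset; apply/subsetP => x; rewrite !inE => /andP[]. Qed.

Lemma setDUK n (H T : {set 'I_n}) : T \subset H -> (H :\: T) :|: T = H.
Proof.
move=> /subsetP TH; apply/setP => x; rewrite !inE.
by case: (boolP (x \in T)) => [/TH ->|_] /=; rewrite ?orbT ?orbF.
Qed.

Section Twist.
Variables (n : nat) (L : fieldType) (T : {set 'I_n}).
Implicit Types (A H : {set 'I_n}) (c b : {set 'I_n} -> L).

(* The sign relating the order of a face containing T to the order of its link part. *)
Definition tw A := (\sum_(v in A) sg v T)%N.
Definition to_link c A : L := if [disjoint A & T] then (-1) ^+ tw A * c (A :|: T) else 0.
Definition of_link b H : L := if T \subset H then (-1) ^+ tw (H :\: T) * b (H :\: T) else 0.

Lemma sg_disjointU v A : [disjoint A & T] -> sg v (A :|: T) = (sg v A + sg v T)%N.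
Proof.
move=> AT; rewrite /sg.
have -> : [set u in A :|: T | (u < v)%N] = [set u in A | (u < v)%N] :|: [set u in T | (u < v)%N].
  by apply/setP => u; rewrite !inE andb_orl.
rewrite cardsU (_ : _ :&: _ = set0) ?cards0 ?subn0 //.
apply/setP => u; rewrite !inE; case: (boolP (u \in A)) => //= uA.
by rewrite (disjointFr AT uA) !andbF.
Qed.

Lemma twU1 v A : v \notin A -> tw (v |: A) = (sg v T + tw A)%N.
Proof. by move=> vA; rewrite /tw big_setU1. Qed.

Lemma bd_to_link c A : [disjoint A & T] -> bd (to_link c) A = (-1) ^+ tw A * bd c (A :|: T).
Proof.
move=> AT; rewrite /bd mulr_sumr; apply: eq_bigr => v _; rewrite /io /to_link.
rewrite in_setU disjointsU1 AT andbT setUA.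
case: (boolP (v \in A)) => vA; first by rewrite mulr0.
case: (boolP (v \in T)) => vT /=; first by rewrite !mulr0.
rewrite twU1 // sg_disjointU // !exprD.
have ss : (-1) ^+ sg v T * (-1) ^+ sg v T = 1 :> L by rewrite -expr2 sqrr_sign.
by ring: ss.
Qed.

Lemma to_of_link b A : [disjoint A & T] -> to_link (of_link b) A = b A.
Proof.
move=> AT; rewrite /to_link AT /of_link subsetUr.
have -> : (A :|: T) :\: T = A.
  by rewrite setDUl setDv setU0; apply/eqP; rewrite eqEsubset subsetDl subsetD subxx AT.
by rewrite mulrA -expr2 sqrr_sign mul1r.
Qed.

Lemma to_link_at c H : T \subset H -> c H = (-1) ^+ tw (H :\: T) * to_link c (H :\: T).
Proof.
move=> TH; have dT := disjointDT H T.
rewrite /to_link dT mulrA -expr2 sqrr_sign mul1r; congr c.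
by rewrite setDUK.
Qed.
End Twist.

(** * From the homology of links to chains on stars *)

Section Manifold.
Variables (k L : fieldType) (f : {rmorphism k -> L}) (n d : nat) (D : {set {set 'I_n}}).
Hypotheses (sc : simplicial_complex D) (hd : has_dim D d) (hm : homology_manifold k D d).
Implicit Types (A H T F : {set 'I_n}) (c b e : {set 'I_n} -> L).

Let closed F H : F \in D -> H \subset F -> H \in D. Proof. by case: sc => _ cl _; apply: cl. Qed.
Let dim F : F \in D -> (#|F| <= d)%N. Proof. by case: hd => _; apply. Qed.

Lemma mem_link A T : (A \in link D T) = [disjoint A & T] && (A :|: T \in D).
Proof.
rewrite inE; case: (boolP (A \in D)) => //= AD; apply/esym/negbTE; apply: contra AD => /andP[_ AT].
by apply: (closed AT); apply: subsetUl.
Qed.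

Lemma link_closed T A H : A \in link D T -> H \subset A -> H \in link D T.
Proof.
rewrite !mem_link => /andP[AT AD] HA; rewrite (disjointWl HA AT) (closed AD) //.
exact: setSU.
Qed.

Lemma card_disjointU A T : [disjoint A & T] -> #|A :|: T| = (#|A| + #|T|)%N.
Proof. by rewrite -setI_eq0 cardsU => /eqP ->; rewrite cards0 subn0. Qed.

Lemma link_level c T i : (#|T| <= i)%N ->
  (forall H, c H != 0 -> [/\ H \in D, T \subset H & #|H| = i]) ->
  forall A, to_link T c A != 0 -> A \in level (link D T) (i - #|T|)%N.
Proof.
move=> Ti cs A; rewrite /to_link; case: ifP => [AT|_]; last by rewrite eqxx.
rewrite mulf_eq0 signr_eq0 /= => /cs[AD _ Ai]; rewrite inE mem_link AT AD /=.
by rewrite -Ai card_disjointU // addnK.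
Qed.

Lemma link_cycle c T : (forall H, T \subset H -> bd c H = 0) ->
  forall A, A \in link D T -> bd (to_link T c) A = 0.
Proof.
move=> c0 A; rewrite mem_link => /andP[AT _]; rewrite bd_to_link // c0 ?mulr0 //.
exact: subsetUr.
Qed.

(** Through [to_link], chains of faces containing [T] become chains of the link, with sizes shifted
    by [#|T|]; as [i < d], this lands below the top degree of the link, where it has no homology. *)
Lemma manifold_exact T i c : T \in D -> T != set0 -> (i < d)%N ->
    (forall H, c H != 0 -> [/\ H \in D, T \subset H & #|H| = i]) ->
    (forall H, T \subset H -> bd c H = 0) ->
    exists b, (forall H, b H != 0 -> [/\ H \in D, T \subset H & #|H| = i.+1]) /\
              (forall H, T \subset H -> bd b H = c H).
Proof.
move=> TD T0 id cs c0; case: (leqP #|T| i) => Ti; last first.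
  have cz H : c H = 0.
    apply/eqP; apply: contraT => /cs[_ TH Hi].
    by have := subset_leq_card TH; rewrite Hi leqNgt Ti.
  exists (fun=> 0); split=> H; first by rewrite eqxx.
  by rewrite cz => _; apply: bd0.
have be : rbetti k (link D T) (i - #|T|)%N = 0%N.
  by rewrite hm //; have := dim TD; case: eqP => //; lia.
have [b [bs bE]] := cyc_exact f (@link_closed T) be (link_level Ti cs) (link_cycle c0).
have bl H : of_link T b H != 0 -> [/\ H \in D, T \subset H & #|H| = i.+1].
  rewrite /of_link; case: ifP => [TH|_]; last by rewrite eqxx.
  rewrite mulf_eq0 signr_eq0 /= => /bs; rewrite inE mem_link (setDUK TH) => /andP[/andP[_ HD] /eqP E].
  split=> //; move: E (subset_leq_card TH) Ti; rewrite cardsD (setIidPr TH).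
  by move: #|H| #|T| => h t; lia.
exists (of_link T b); split=> // H TH.
case: (boolP (H \in D)) => HD; last first.
  rewrite bd0 => [|v vH].
    by apply/esym/eqP; apply: contraNT HD => /cs[].
  apply/eqP; apply: contraNT HD => /bl[vD _ _]; apply: (closed vD); exact: subsetUr.
have HE : (H :\: T) :|: T = H by rewrite setDUK.
have HL : H :\: T \in link D T by rewrite mem_link disjointDT HE.
rewrite (to_link_at c TH) -(bE _ HL).
have := bd_to_link (of_link T b) (disjointDT H T); rewrite HE => E.
have -> : bd b (H :\: T) = bd (to_link T (of_link T b)) (H :\: T).
  apply: bd_ext => v vH; case: (boolP (v \in T)) => vT.
    rewrite /to_link disjointsU1 vT /=; apply/eqP; apply: contraT => /bs.
    by rewrite inE mem_link disjointsU1 vT.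
  by rewrite to_of_link // disjointsU1 vT disjointDT.
by rewrite E mulrA -expr2 sqrr_sign mul1r.
Qed.

Lemma level_top T : T \in D -> level (link D T) (d - #|T|)%N.+1%N = set0.
Proof.
move=> TD; apply/setP => A; rewrite in_set0 in_set mem_link; apply/negP => /andP[/andP[AT AD] /eqP E].
have := dim AD; rewrite card_disjointU // E; have := dim TD; lia.
Qed.

Lemma manifold_pure T : T \in D -> T != set0 -> exists F, [/\ F \in D, T \subset F & #|F| = d].
Proof.
move=> TD T0; have be : rbetti k (link D T) (d - #|T|)%N = 1%N by rewrite hm // eqxx.
have : level (link D T) (d - #|T|)%N != set0.
  by apply/eqP => E; move: be; rewrite /rbetti -/(level _ _) E cards0.
move=> /set0Pn[A]; rewrite inE mem_link => /andP[/andP[AT AD] /eqP E].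
exists (A :|: T); split=> //; first exact: subsetUr.
by rewrite card_disjointU // E subnK // dim.
Qed.

Lemma manifold_top e T c : (forall H, (e H != 0) = (H \in D) && (#|H| == d)) ->
    (forall H, bd e H = 0) -> T \in D -> T != set0 ->
    (forall H, c H != 0 -> [/\ H \in D, T \subset H & #|H| = d]) ->
    (forall H, T \subset H -> bd c H = 0) ->
    exists a, forall H, T \subset H -> c H = a * e H.
Proof.
move=> eP e0 TD T0 cs c0.
have be : rbetti k (link D T) (d - #|T|)%N = 1%N by rewrite hm // eqxx.
have es A : to_link T e A != 0 -> A \in level (link D T) (d - #|T|)%N.
  rewrite /to_link; case: ifP => [AT|_]; last by rewrite eqxx.
  rewrite mulf_eq0 signr_eq0 /= eP inE mem_link AT => /andP[-> /eqP <-].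
  by rewrite card_disjointU // addnK eqxx.
have ex : exists A, to_link T e A != 0.
  have [F [FD TF Fd]] := manifold_pure TD T0; exists (F :\: T).
  have := eP F; rewrite FD Fd eqxx (to_link_at e TF) mulf_eq0 signr_eq0 /= => -> //.
have [a aE] := cyc_top f be (level_top TD) (link_level (dim TD) cs)
  (link_cycle c0) es (link_cycle (fun H _ => e0 H)) ex.
exists a => H TH; rewrite (to_link_at c TH) (to_link_at e TH) aE; ring.
Qed.

(** The link of a ridge is a 0-sphere. Its only empty face and its vanishing Betti number in size 0
    give the boundary matrix of the vertices rank 1; the Betti number 1 in size 1 then leaves two
    vertices. *)
Lemma two_cofaces H : H \in D -> H != set0 -> #|H| = d.-1 -> (0 < d)%N ->
  exists v w, [/\ v != w, v \notin H /\ v |: H \in D, w \notin H /\ w |: H \in D &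
    forall x, x \notin H -> x |: H \in D -> x = v \/ x = w].
Proof.
move=> HD H0 Hd d0; set C := link D H.
have HS : (d - #|H|)%N = 1%N by lia.
have l2 : level C 2 = set0 by have := level_top HD; rewrite HS.
have l0 : #|level C 0| = 1%N.
  rewrite (_ : level C 0 = [set set0]) ?cards1 //; apply/setP => A; rewrite in_set mem_link cards_eq0 in_set1.
  by case: eqP => [->|_]; rewrite ?andbF // disjoints_subset sub0set set0U HD.
have r0 : \rank (bdmx k C 0) = 0%N.
  apply/eqP; rewrite mxrank_eq0; apply/eqP/matrixP => i j; rewrite !mxE /=.
  case: ifP => // /andP[_ /eqP/cards0_eq ->]; rewrite big1 // => v; rewrite inE //.
have b0 : rbetti k C 0 = 0%N by rewrite hm // HS.
have b1 : rbetti k C 1 = 1%N by rewrite hm // HS.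
have r1 : (\rank (bdmx k C 1) <= 1)%N.
  rewrite -(mxrank_map f); apply: leq_trans (mxrankS (bd_cyc f (@link_closed H) 0)) _.
  by apply: leq_trans (mxrankS (capmxSl _ _)) _; rewrite -[X in (_ <= X)%N]l0; apply: rank_leq_row.
have l1 : #|level C 1| = 2%N.
  have c0 : (#|level C 0| - \rank (bdmx k C 0) - \rank (bdmx k C 1) = 0)%N by exact: b0.
  have c1 : (#|level C 1| - \rank (bdmx k C 1) - \rank (bdmx k C 2) = 1)%N by exact: b1.
  rewrite l0 r0 in c0; rewrite (bdmx_empty k l2) in c1.
  by move: c0 c1 r1; move: #|_| (\rank _) => l r; lia.
have /cards2P[A [B [AB E]]] : #|level C 1| == 2%N by rewrite l1.
have inL X : X \in level C 1 -> exists x, [/\ X = [set x], x \notin H & x |: H \in D].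
  rewrite inE mem_link => /andP[/andP[XH XD] /cards1P[x xE]]; exists x.
  by move: XH XD; rewrite xE disjoints1.
have [v [vE vH vD]] : exists x, [/\ A = [set x], x \notin H & x |: H \in D].
  by apply: inL; rewrite E !inE eqxx.
have [w [wE wH wD]] : exists x, [/\ B = [set x], x \notin H & x |: H \in D].
  by apply: inL; rewrite E !inE eqxx orbT.
exists v, w; split=> //; first by apply: contraNneq AB => vw; rewrite vE wE vw.
move=> x xH xD; have : [set x] \in level C 1 by rewrite inE mem_link disjoints1 xH xD cards1.
rewrite E !inE vE wE => /orP[]/eqP/set1_inj ->; by [left|right].
Qed.
End Manifold.

(** * The orientation as a top-dimensional cycle *)

Section Inversions.
Variable n : nat.
Implicit Types (s t : seq 'I_n) (v x y : 'I_n).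

Lemma inversions_cons x s : inversions (x :: s) = (count (fun y => y < x) s + inversions s)%N.
Proof.
rewrite /inversions /= big_ord_recl; congr (_ + _)%N.
  rewrite [LHS]big_mkcond big_ord_recl /= add0n -sum1_count [RHS](big_nth x) big_mkord [RHS]big_mkcond.
  by apply: eq_bigr => i _; rewrite add0n (nth_map x) //=; case: (_ < _)%N.
apply: eq_bigr => i _; rewrite big_mkcond big_ord_recl /= add0n [RHS]big_mkcond.
by apply: eq_bigr => j _; rewrite /= /bump !leq0n !add1n ltnS.
Qed.

Lemma inversions_mid s t v :
  inversions (s ++ v :: t) = (count (fun y => (v < y)%N) s + count (fun y => (y < v)%N) t + inversions (s ++ t))%N.
Proof.
elim: s => [|x s IH] /=; first by rewrite inversions_cons.
rewrite !inversions_cons IH !count_cat /=; lia.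
Qed.

(** The inversions involving [v] are the larger entries before it and the smaller ones after it;
    their parity is that of its position plus the number of all smaller entries. *)
Lemma seq_sign_rem s v : uniq s -> v \in s ->
  seq_sign s = (-1) ^+ sg v [set u in s] * induced_sign s v.
Proof.
move=> us vs; case/splitPr: s / vs us => s t us.
have vs : v \notin s by move: us; rewrite cat_uniq /= => /and3P[_]; rewrite negb_or => /andP[].
have vt : v \notin t by move: us; rewrite cat_uniq /= => /and4P[].
have remE : rem v (s ++ v :: t) = s ++ t.
  elim: s vs {us} => [|x s IH] /=; first by rewrite eqxx.
  by rewrite inE negb_or eq_sym => /andP[/negbTE -> /IH ->].
have idx : index v (s ++ v :: t) = size s.
  by rewrite index_cat (negbTE vs) /= eqxx addn0.
rewrite /induced_sign /seq_sign remE idx inversions_mid.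
have sgE : sg v [set u in s ++ v :: t] = (count (fun y => y < v)%N s + count (fun y => y < v)%N t)%N.
  rewrite -count_cat /sg -size_filter.
  have uf : uniq (filter (fun y => y < v)%N (s ++ t)).
    apply: filter_uniq; apply: subseq_uniq us.
    by apply: cat_subseq => //; apply: subseq_cons.
  rewrite -(card_uniqP uf); apply: eq_card => u; rewrite !inE mem_filter !mem_cat inE.
  by case: (u =P v) => [->|_]; rewrite ?ltnn ?andbF //= andbC.
have szE : size s = (count (fun y => y < v)%N s + count (fun y => (v < y))%N s)%N.
  rewrite -(count_predC (fun y => y < v)%N); congr (_ + _)%N; apply: eq_in_count => y ys /=.
  rewrite -leqNgt leq_eqVlt; case: eqP => //= /val_inj E; by move: vs; rewrite E ys.
rewrite sgE szE -!exprD.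
set c := count (fun y => (v < y)%N) s; set a := count (fun y => (y < v)%N) s.
rewrite -signr_odd -[RHS]signr_odd; congr (_ ^+ nat_of_bool _).
rewrite !oddD; case: (odd a); case: (odd c); case: (odd (count _ _)); case: (odd _) => //.
Qed.
End Inversions.

Section Orientation.
Variables (k L : fieldType) (f : {rmorphism k -> L}) (n d : nat) (D : {set {set 'I_n}}).
Hypotheses (sc : simplicial_complex D) (hd : has_dim D d) (hm : homology_manifold k D d).
Variable o : {set 'I_n} -> seq 'I_n.
Hypotheses (ho : orderings D o) (hor : (2%N \in [pchar k]) \/ orientation_cond D o).
Hypothesis d2 : (1 < d)%N.
Implicit Types (H F : {set 'I_n}).

Definition oclass F : L := if (F \in D) && (#|F| == d) then (eps o F)%:~R else 0.

Lemma facet_card F : F \in D -> #|F| = d -> facet D F.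
Proof.
move=> FD Fd; rewrite /facet FD; apply/forallP => H; apply/implyP => HD; apply/negP => /proper_card.
by rewrite Fd ltnNge; case: hd => _ ->.
Qed.

Lemma eps_sign F : exists b : bool, eps o F = (-1) ^+ b.
Proof. by exists (odd (inversions (o F))); rewrite signr_odd. Qed.

Lemma oclass_neq0 H : (oclass H != 0) = (H \in D) && (#|H| == d).
Proof.
rewrite /oclass; case: ifP => _; last by rewrite eqxx.
by have [b ->] := eps_sign H; rewrite rmorphXn rmorphN rmorph1 signr_eq0.
Qed.

Lemma oclass_induced H v : v \notin H -> v |: H \in D -> #|v |: H| = d ->
  (-1) ^+ sg v H * oclass (v |: H) = (induced_sign (o (v |: H)) v)%:~R.
Proof.
move=> vH FD Fd; rewrite /oclass FD Fd eqxx /= /eps.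
have pF := ho (facet_card FD Fd).
have uF : uniq (o (v |: H)) by rewrite (perm_uniq pF) enum_uniq.
have vF : v \in o (v |: H) by rewrite (perm_mem pF) mem_enum setU11.
rewrite (seq_sign_rem uF vF).
have -> : [set u in o (v |: H)] = v |: H by apply/setP => u; rewrite inE (perm_mem pF) mem_enum.
by rewrite sgU1 rmorphM rmorphXn rmorphN rmorph1 mulrA -expr2 sqrr_sign mul1r.
Qed.

(** A ridge has exactly two cofaces, with opposite induced signs; in characteristic 2 all signs are
    1 and the two terms cancel on their own. *)
Lemma oclass_cycle H : bd oclass H = 0.
Proof.
have closed : forall F G : {set 'I_n}, F \in D -> G \subset F -> G \in D by case: sc => _ cl _; apply: cl.
case: (boolP [exists v, (v \notin H) && (v |: H \in D) && (#|v |: H| == d)]); last first.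
  rewrite negb_exists => /forallP no; apply: bd0 => v vH; apply/eqP.
  by have := no v; rewrite vH /= -oclass_neq0 negbK.
move=> /existsP[x /andP[/andP[xH xD] /eqP xd]].
have HD : H \in D by apply: (closed _ _ xD); apply: subsetUr.
have Hd : #|H| = d.-1 by rewrite -xd cardsU1 xH.
have H0 : H != set0 by rewrite -card_gt0 Hd; lia.
have card v : v \notin H -> #|v |: H| = d by move=> vH; rewrite cardsU1 vH Hd; lia.
have [v [w [vw [vH vD] [wH wD] only]]] := two_cofaces f sc hd hm HD H0 Hd (ltnW d2).
rewrite /bd (bigD1 v) //= (bigD1 w) /=; last by rewrite eq_sym.
rewrite big1 ?addr0 => [|y /andP[yv yw]]; last first.
  rewrite /io; case: ifPn => // yH; rewrite (_ : oclass _ = 0) ?mulr0 //.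
  apply/eqP; apply: contraT; rewrite oclass_neq0 => /andP[yD _].
  by case: (only _ yH yD) => E; [case/eqP: yv | case/eqP: yw].
rewrite /io (negbTE vH) (negbTE wH) !oclass_induced ?card //.
case: hor => [p2|oc]; last first.
  rewrite (oc H (v |: H) (w |: H) v w) ?facet_card ?card // ?rmorphN ?addNr //.
  by apply: contraNneq vw => E; have := setU11 v H; rewrite E !inE (negbTE vH) orbF.
have two : 1 + 1 = 0 :> L by have := pcharf0 (rmorph_pchar f p2); rewrite mulr2n.
have sgn s x0 : (induced_sign s x0)%:~R = 1 :> L.
  rewrite /induced_sign /seq_sign -exprD rmorphXn rmorphN rmorph1.
  by have -> : -1 = 1 :> L by [apply/eqP; rewrite eq_sym -subr_eq0 opprK two]; rewrite expr1n.
by rewrite !sgn two.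
Qed.

Lemma manifold_good : connected_cx D -> good d D oclass.
Proof.
move=> cx; have closed : forall F G : {set 'I_n}, F \in D -> G \subset F -> G \in D.
  by case: sc => _ cl _; apply: cl.
split=> //.
- by case: hd.
- by case: hd.
- exact: (manifold_exact f sc hd hm).
- move=> T c; exact: (manifold_top f sc hd hm oclass_neq0 oclass_cycle).
- exact: oclass_neq0.
- exact: oclass_cycle.
move=> P PE x y; have /connectP[p pP ->] := cx x y.
elim: p x pP => //= z p IH x /andP[xz zp] Px.
by apply: IH zp (PE _ _ xz Px).
Qed.
End Orientation.

(** * Homology of the stellar subdivision *)

Section LiftedChains.
Variables (n : nat) (L : fieldType).
Implicit Types (A : {set 'I_n}) (X : {set 'I_n.+1}).
Local Notation om := (@ord_max n).

Lemma sg_wd v A : sg (wd v) (liftS A) = sg v A.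
Proof.
rewrite /sg -(card_liftS [set u in A | _]); apply: eq_card => u; case: (ordSP u) => [|x].
  by rewrite in_set !om_liftS.
by rewrite in_set !mem_liftS in_set.
Qed.

Lemma sg_wd_om v A : sg (wd v) (om |: liftS A) = sg v A.
Proof. by rewrite sgU ?om_liftS // sg_wd /= ltnNge ltnW. Qed.

Lemma sg_om A : sg om (liftS A) = #|A|.
Proof.
rewrite /sg -(card_liftS A); apply: eq_card => u; case: (ordSP u) => [|x].
  by rewrite in_set om_liftS.
by rewrite in_set mem_liftS /= ltn_ord andbT.
Qed.

Lemma liftSU1 v A : liftS (v |: A) = wd v |: liftS A.
Proof. exact: imsetU1. Qed.

Lemma bd_lift (c : {set 'I_n.+1} -> L) A : bd c (liftS A) =
  bd (fun Y => c (liftS Y)) A + (-1) ^+ #|A| * c (om |: liftS A).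
Proof.
rewrite /bd big_ord_recr; congr (_ + _); last by rewrite /io om_liftS sg_om.
by apply: eq_bigr => v _; rewrite /io mem_liftS sg_wd liftSU1.
Qed.

Lemma bd_om (c : {set 'I_n.+1} -> L) A : bd c (om |: liftS A) = bd (fun Y => c (om |: liftS Y)) A.
Proof.
rewrite /bd big_ord_recr /= [X in _ + X]/io setU11 addr0.
apply: eq_bigr => v _; rewrite /io in_setU1 wd_om mem_liftS sg_wd_om liftSU1.
by rewrite setUCA.
Qed.

(* A chain of the stellar subdivision is a pair: c0 on the faces of the old complex,
   c1 on the boundary of G, the link of the new vertex. *)
Definition mk_chain (c0 c1 : {set 'I_n} -> L) X : L := if om \in X then c1 (unliftS X) else c0 (unliftS X).

Lemma unliftS_om A : unliftS (om |: liftS A) = A.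
Proof. by apply/setP => x; rewrite inE in_setU1 wd_om mem_liftS. Qed.
Lemma mk_chain_lift c0 c1 A : mk_chain c0 c1 (liftS A) = c0 A.
Proof. by rewrite /mk_chain om_liftS liftSK. Qed.
Lemma mk_chain_om c0 c1 A : mk_chain c0 c1 (om |: liftS A) = c1 A.
Proof. by rewrite /mk_chain setU11 unliftS_om. Qed.

Lemma bd_mk_chain_lift c0 c1 A : bd (mk_chain c0 c1) (liftS A) = bd c0 A + (-1) ^+ #|A| * c1 A.
Proof. by rewrite bd_lift mk_chain_om; congr (_ + _); apply: bd_eq => Y; rewrite mk_chain_lift. Qed.
Lemma bd_mk_chain_om c0 c1 A : bd (mk_chain c0 c1) (om |: liftS A) = bd c1 A.
Proof. by rewrite bd_om; apply: bd_eq => Y; rewrite mk_chain_om. Qed.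

Variant set_spec : {set 'I_n.+1} -> Type :=
  | SetLift A : set_spec (liftS A)
  | SetOm A : set_spec (om |: liftS A).
Lemma setP_lift X : set_spec X.
Proof.
case: (boolP (om \in X)) => oX; first by rewrite -(liftS_dn_om oX); apply: SetOm.
by rewrite -(liftS_dn oX); apply: SetLift.
Qed.

Lemma om_sub A B : (om |: liftS A \subset om |: liftS B) = (A \subset B).
Proof.
apply/idP/idP => [/subsetP AB|AB]; last by rewrite setUS ?liftS_sub.
by apply/subsetP => x; have := AB (wd x); rewrite !in_setU1 !wd_om !mem_liftS.
Qed.
Lemma om_nsub A B : (om |: liftS A \subset liftS B) = false.
Proof. by rewrite subUset sub1set om_liftS. Qed.
Lemma lift_sub_om A B : (liftS A \subset om |: liftS B) = (A \subset B).
Proof.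
apply/idP/idP => [/subsetP AB|AB]; last by rewrite subsetU // liftS_sub AB orbT.
by apply/subsetP => x; have := AB (wd x); rewrite !in_setU1 !wd_om !mem_liftS.
Qed.
Lemma card_om A : #|om |: liftS A| = #|A|.+1.
Proof. by rewrite cardsU1 om_liftS card_liftS. Qed.
End LiftedChains.

Section Cone.
Variables (n : nat) (L : fieldType) (G : {set 'I_n}).
Implicit Types (A H T : {set 'I_n}) (c b : {set 'I_n} -> L).

Definition dlt A : L := (A == G)%:R.

Lemma bd_dlt_supp A : bd dlt A != 0 -> exists2 v, v \notin A & v |: A = G.
Proof.
by move=> /bd_nz[v vA]; rewrite /dlt; case: (_ |: _ =P G) => [E _|]; [exists v | rewrite eqxx].
Qed.

Lemma bd_dlt_neq0 A v : v \notin A -> v |: A = G -> bd dlt A != 0.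
Proof.
move=> vA vG; rewrite /bd (bigD1 v) //= big1 => [|w wv].
  by rewrite addr0 /io (negbTE vA) /dlt vG eqxx mulr1 signr_eq0.
rewrite /io; case: ifPn => // wA; rewrite /dlt; case: eqP => [E|_]; last by rewrite mulr0.
have : w \in v |: A by rewrite vG -E setU11.
by rewrite in_setU1 (negbTE wv) (negbTE wA).
Qed.

(** Instance of the Clifford relation; the wedge of the boundary vanishes because [g \notin T] keeps
    [T] inside [H :\ g]. *)
Lemma bd_cone g c T : g \notin T -> (forall H, T \subset H -> bd c H = 0) ->
  forall H, T \subset H -> bd (ep g c) H = c H.
Proof.
move=> gT c0 H TH; have : bd (ep g c) H + ep g (bd c) H = c H.
  rewrite /bd ep_sum -big_split /=.
  under eq_bigr => v _ do rewrite ioep.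
  by rewrite (bigD1 g) //= eqxx mul1r big1 ?addr0 // => v /negbTE ->; rewrite mul0r.
have -> : ep g (bd c) H = 0; last by rewrite addr0.
by rewrite /ep; case: ifP => // gH; rewrite c0 ?mulr0 // subsetD1 TH.
Qed.

Lemma ep_supp g c H : ep g c H != 0 -> g \in H /\ c (H :\ g) != 0.
Proof.
by rewrite /ep; case: ifP => [gH|_]; rewrite ?eqxx // mulf_eq0 signr_eq0.
Qed.
End Cone.

Section StellarGood.
Variables (n d : nat) (L : fieldType) (D : {set {set 'I_n}}) (e : {set 'I_n} -> L).
Hypotheses (gD : good d D e) (d2 : (1 < d)%N).
Variable G : {set 'I_n}.
Hypotheses (GD : G \in D) (Gd : #|G| = d).
Implicit Types (A H T : {set 'I_n}) (X Y : {set 'I_n.+1}).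
Local Notation om := (@ord_max n).
Local Notation D' := (stellar D G).
Local Notation kappa := ((-1) ^+ d.-1 : L).
Local Notation dl := (@dlt n L G).

Let inL T : (liftS T \in D') = (T \in D) && (T != G) := stellar_lift gD GD Gd T.
Let inO T : (om |: liftS T \in D') = (T \proper G) := stellar_om D G T.

(** The orientation class with [G] replaced by the cone from the new vertex over its boundary. As
    this vertex comes last, [bd_lift] gives it the sign [(-1) ^+ #|A|], here [kappa], which the
    factor compensates. *)
Definition st_class : {set 'I_n.+1} -> L :=
  mk_chain (fun A => if A == G then 0 else e A) (fun A => kappa * e G * bd dl A).

Let eG0 : e G != 0. Proof. by rewrite (good_e gD) GD Gd eqxx. Qed.
Let kk : kappa * kappa = 1. Proof. by rewrite -expr2 sqrr_sign. Qed.

Lemma bd_dlt_card A : bd dl A != 0 -> A \proper G /\ #|A| = d.-1.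
Proof.
move=> /bd_dlt_supp[v vA vG]; split; last by rewrite -Gd -vG cardsU1 vA.
by rewrite -vG properE subsetUr; apply/subsetPn; exists v; rewrite ?setU11.
Qed.

Lemma st_class_neq0 X : (st_class X != 0) = (X \in D') && (#|X| == d).
Proof.
case: (setP_lift X) => A; rewrite /st_class.
  rewrite mk_chain_lift inL card_liftS; case: (A =P G) => _; first by rewrite eqxx andbF.
  by rewrite andbT (good_e gD).
rewrite mk_chain_om inO card_om !mulf_eq0 signr_eq0 (negbTE eG0) /=; apply/idP/andP => [nz|[AG /eqP Ad]].
  by have [-> ->] := bd_dlt_card nz; rewrite prednK ?(ltnW d2).
have [AG' [v vG vA]] := properP AG.
apply: (bd_dlt_neq0 L vA); apply/eqP; by rewrite eqEcard subUset sub1set vG AG' cardsU1 vA Gd -Ad add1n leqnn.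
Qed.

Lemma st_class_cycle X : bd st_class X = 0.
Proof.
case: (setP_lift X) => A; last first.
  by rewrite /st_class bd_mk_chain_om bdZ bdbd mulr0.
rewrite /st_class bd_mk_chain_lift.
have -> : bd (fun A0 => if A0 == G then 0 else e A0) A = - (e G * bd dl A).
  have : bd (fun A0 => (if A0 == G then 0 else e A0) + e G * dl A0) A = 0.
    apply: etrans (good_cycle gD A); apply: bd_eq => Y; rewrite /dlt /=.
    by case: (Y =P G) => [->|_]; rewrite ?mulr1 ?mulr0 ?add0r ?addr0.
  by rewrite bdD bdZ => /eqP; rewrite addr_eq0 => /eqP.
have [->|/bd_dlt_card[_ ->]] := eqVneq (bd dl A) 0; first by rewrite !mulr0 oppr0 addr0.
by rewrite !mulrA kk mul1r addNr.
Qed.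

(* Coning off from g, a vertex of G outside T, writes c1 as the boundary of a multiple of G. *)
Lemma top_boundary T c1 : T \proper G ->
  (forall A, c1 A != 0 -> [/\ A \proper G, T \subset A & #|A| = d.-1]) ->
  (forall A, T \subset A -> bd c1 A = 0) -> exists a, forall A, T \subset A -> c1 A = a * bd dl A.
Proof.
move=> /properP[TG [g gG gT]] s1 z1; exists (ep g c1 G) => A TA.
rewrite -(bd_cone gT z1 TA) -bdZ; apply: bd_eq => H; rewrite /dlt; case: (H =P G) => [->|HG]; first by rewrite mulr1.
rewrite mulr0; apply/eqP; apply: contraT => /ep_supp[gH /s1[HG' _ Hd]]; case: HG.
apply/eqP; rewrite eqEcard Gd -(setD1K gH) subUset sub1set gG (proper_sub HG') /=.
by rewrite setD1K // (cardsD1 g H) gH Hd; lia.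
Qed.

Section FixFace.
Variables (X0 : {set 'I_n.+1}) (i : nat) (c : {set 'I_n.+1} -> L).
Hypotheses (X0D : X0 \in D') (X00 : X0 != set0).
Hypothesis cs : forall X, c X != 0 -> [/\ X \in D', X0 \subset X & #|X| = i].
Hypothesis cz : forall X, X0 \subset X -> bd c X = 0.

Let c0 A := c (liftS A).
Let c1 A := c (om |: liftS A).

Let supp0 A : c0 A != 0 -> [/\ A \in D, A != G, X0 \subset liftS A & #|A| = i].
Proof. by move=> /cs[]; rewrite inL card_liftS => /andP[]. Qed.
Let supp1 A : c1 A != 0 -> [/\ A \proper G, X0 \subset om |: liftS A & #|A|.+1 = i].
Proof. by move=> /cs[]; rewrite inO card_om. Qed.
Let cyc0 A : X0 \subset liftS A -> bd c0 A + (-1) ^+ #|A| * c1 A = 0.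
Proof. by move=> /cz; rewrite bd_lift. Qed.
Let cyc1 A : X0 \subset om |: liftS A -> bd c1 A = 0.
Proof. by move=> /cz; rewrite bd_om. Qed.

(** The part of the cycle at the new vertex lives on proper faces of [G] and is filled by a cone
    from a vertex [g] of [G]; [i < d] keeps the cone among proper faces. Removing its boundary
    leaves a cycle of [D], filled there. *)
Lemma st_exact : (i < d)%N -> exists b,
  (forall X, b X != 0 -> [/\ X \in D', X0 \subset X & #|X| = i.+1]) /\
  (forall X, X0 \subset X -> bd b X = c X).
Proof.
move=> id.
have cone T g : (forall A, (X0 \subset om |: liftS A) = (T \subset A)) -> g \in G -> g \notin T ->
  (forall A, ep g c1 A != 0 -> [/\ A \proper G, T \subset A & #|A| = i]) /\
  (forall A, T \subset A -> bd (ep g c1) A = c1 A).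
  move=> XT gG gT; split=> [A|]; last by apply: bd_cone => // A TA; apply: cyc1; rewrite XT.
  move=> /ep_supp[gA /supp1[AG]]; rewrite XT => TA Ai.
  have AE : #|A| = i by rewrite -Ai (cardsD1 g A) gA.
  have AG' : A \subset G by rewrite -(setD1K gA) subUset sub1set gG proper_sub.
  split=> //; last by apply: subset_trans TA (subsetDl _ _).
  by rewrite properEcard AG' Gd AE.
case: (setP_lift X0) X0D X00 supp0 supp1 cyc0 cyc1 cone => T; rewrite ?inL ?inO; last first.
  move=> TG _ s0 s1 z0 z1 cone; have [TG' [g gG gT]] := properP TG.
  have [bs bE] := cone T g (om_sub T) gG gT.
  have c00 A : c (liftS A) = 0 by apply/eqP; apply: contraT => /s0[_ _]; rewrite om_nsub.
  exists (mk_chain (fun=> 0) (ep g c1)); split=> X; case: (setP_lift X) => A.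
  - by rewrite mk_chain_lift eqxx.
  - by rewrite mk_chain_om inO om_sub card_om => /bs[-> -> ->].
  - by rewrite om_nsub.
  by rewrite om_sub bd_mk_chain_om => /bE.
move=> /andP[TD TnG] T00 s0 s1 z0 z1 cone.
have T0 : T != set0 by apply: contraNneq T00 => ->; rewrite /liftS imset0.
case: (boolP (T \subset G)) => TG; last first.
  have c10 A : c (om |: liftS A) = 0.
    apply/eqP; apply: contraT => /s1[/proper_sub AG]; rewrite lift_sub_om => TA.
    by rewrite (subset_trans TA AG) in TG.
  have [|H TH|b [bs bE]] := good_exact gD TD T0 id (c := c0).
  - by move=> A /s0[]; rewrite liftS_sub.
  - by have := z0 H; rewrite liftS_sub => /(_ TH); rewrite /c1 c10 mulr0 addr0.
  exists (mk_chain b (fun=> 0)); split=> X; case: (setP_lift X) => A.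
  - rewrite mk_chain_lift inL liftS_sub card_liftS => /bs[-> TA ->]; split=> //=.
    by apply: contraNneq TG => <-.
  - by rewrite mk_chain_om eqxx.
  - by rewrite liftS_sub bd_mk_chain_lift mulr0 addr0 => /bE.
  by rewrite bd_mk_chain_om c10 => _; apply: bd0.
have TGp : T \proper G by rewrite properEneq TnG.
have [_ [g gG gT]] := properP TGp.
have [bs bE] := cone T g (lift_sub_om T) gG gT.
pose z A := c0 A - (-1) ^+ i * ep g c1 A.
have zs A : z A != 0 -> [/\ A \in D, T \subset A & #|A| = i].
  rewrite /z; have [E|/bs[AG TA Ai]] := eqVneq (ep g c1 A) 0.
    by rewrite E mulr0 subr0 => /s0[]; rewrite liftS_sub.
  by split=> //; apply: (good_closed gD GD); apply: proper_sub.
have zz A : T \subset A -> bd z A = 0.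
  move=> TA; rewrite /z bdB bdZ bE //; have := z0 A; rewrite liftS_sub => /(_ TA) /eqP.
  rewrite addr_eq0 => /eqP ->; have [->|/s1[_ _ Ai]] := eqVneq (c1 A) 0; first by rewrite !mulr0 oppr0 addr0.
  by rewrite -Ai exprS mulN1r mulNr opprK addNr.
have [b0 [b0s b0E]] := good_exact gD TD T0 id zs zz.
pose r A := if T \subset A then bd dl A else 0.
(* The filling [b0] in [D] may use [G], which is no face of the subdivision: that term is removed
   and replaced by the cone over the boundary of [G], cut down to faces containing [T]. *)
exists (mk_chain (fun A => b0 A - b0 G * dl A) (fun A => ep g c1 A + (-1) ^+ i * b0 G * r A)).
split=> X; case: (setP_lift X) => A.
- rewrite mk_chain_lift inL liftS_sub card_liftS /dlt; case: (A =P G) => [->|AG].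
    by rewrite mulr1 subrr eqxx.
  by rewrite mulr0 subr0 => /b0s[-> -> ->].
- rewrite mk_chain_om inO lift_sub_om card_om /r; have [E|/bs[-> -> ->]] := eqVneq (ep g c1 A) 0; last by [].
  rewrite E add0r !mulf_eq0 signr_eq0 !negb_or /= => /andP[/b0s[_ _ Gi]].
  case: ifP => [TA|_]; last by rewrite eqxx.
  by move=> /bd_dlt_card[-> ->]; rewrite prednK ?(ltnW d2) // -Gi Gd.
- rewrite liftS_sub bd_mk_chain_lift => TA; rewrite bdB bdZ b0E // /z /r TA.
  have [E|/bd_dlt_card[_ Ad]] := eqVneq (bd dl A) 0.
    rewrite E !mulr0 subr0 addr0; have [->|/bs[_ _ ->]] := eqVneq (ep g c1 A) 0.
      by rewrite !mulr0 subr0 addr0.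
    by rewrite subrK.
  have [b00|/b0s[_ _ Gi]] := eqVneq (b0 G) 0.
    rewrite b00 mulr0 !mul0r subr0 addr0; have [->|/bs[_ _ ->]] := eqVneq (ep g c1 A) 0.
      by rewrite !mulr0 subr0 addr0.
    by rewrite subrK.
  have -> : #|A| = i by rewrite Ad -Gd Gi.
  have ss : (-1) ^+ i * (-1) ^+ i = 1 :> L by rewrite -expr2 sqrr_sign.
  by rewrite mulrDr !mulrA ss mul1r addrA; rewrite /c0; ring.
rewrite lift_sub_om bd_mk_chain_om => TA; rewrite bdD bdZ bE //.
have -> : bd r A = bd (bd dl) A.
  by apply: bd_ext => v vA; rewrite /r (subset_trans TA) // subsetUr.
by rewrite bdbd mulr0 addr0.
Qed.

(** By [top_boundary] the part at the new vertex is a multiple of the boundary of [G]. Putting that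
    multiple of [G] back into the old part gives a top cycle of [D], to which [good_top] applies. *)
Lemma st_top : i = d -> exists a, forall X, X0 \subset X -> c X = a * st_class X.
Proof.
move=> iE; have ke : kappa * e G != 0 by rewrite mulf_neq0 // signr_eq0.
have bnd T : (forall A, (X0 \subset om |: liftS A) = (T \subset A)) -> T \proper G ->
    exists a, forall A, T \subset A -> c1 A = a * bd dl A.
  move=> XT TG; apply: top_boundary TG _ _ => [A /supp1[AG]|A TA]; last by apply: cyc1; rewrite XT.
  by rewrite XT iE => TA <-.
case: (setP_lift X0) X0D X00 supp0 supp1 cyc0 cyc1 bnd => T; rewrite ?inL ?inO; last first.
  move=> TG _ s0 s1 z0 z1 bnd; have [a aE] := bnd T (om_sub T) TG.
  exists (a / (kappa * e G)) => X; case: (setP_lift X) => A; first by rewrite om_nsub.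
  by rewrite om_sub /st_class mk_chain_om => /aE E; rewrite -[LHS]/(c1 A) E mulrA divfK.
move=> /andP[TD TnG] T00 s0 s1 z0 z1 bnd.
have T0 : T != set0 by apply: contraNneq T00 => ->; rewrite /liftS imset0.
case: (boolP (T \subset G)) => TG; last first.
  have c10 A : c (om |: liftS A) = 0.
    apply/eqP; apply: contraT => /s1[/proper_sub AG]; rewrite lift_sub_om => TA.
    by rewrite (subset_trans TA AG) in TG.
  have [|H TH|a aE] := good_top gD TD T0 (c := c0).
  - by move=> A /s0[]; rewrite liftS_sub -iE.
  - by have := z0 H; rewrite liftS_sub => /(_ TH); rewrite /c1 c10 mulr0 addr0.
  exists a => X; case: (setP_lift X) => A; rewrite /st_class.
    rewrite liftS_sub mk_chain_lift => TA; rewrite -[LHS]/(c0 A) aE //; case: eqP => // AG.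
    by move: TG; rewrite -AG TA.
  rewrite lift_sub_om mk_chain_om c10 => TA.
  have [->|/bd_dlt_card[/proper_sub AG _]] := eqVneq (bd dl A) 0; first by rewrite !mulr0.
  by rewrite (subset_trans TA AG) in TG.
have TGp : T \proper G by rewrite properEneq TnG.
have [a aE] := bnd T (lift_sub_om T) TGp.
pose z A := c0 A + kappa * a * dl A.
have zs A : z A != 0 -> [/\ A \in D, T \subset A & #|A| = d].
  rewrite /z /dlt; case: (A =P G) => [-> _|_]; first by split.
  by rewrite mulr0 addr0 => /s0[]; rewrite liftS_sub iE.
have zz A : T \subset A -> bd z A = 0.
  move=> TA; rewrite /z bdD bdZ -mulrA -aE //; have := z0 A; rewrite liftS_sub => /(_ TA).
  have [->|/s1[_ _ Ai]] := eqVneq (c1 A) 0; first by rewrite !mulr0.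
  by rewrite (_ : d.-1 = #|A|) // -iE -Ai.
have [a' a'E] := good_top gD TD T0 zs zz.
have c0G : c0 G = 0 by apply/eqP; apply: contraT => /s0[_]; rewrite eqxx.
have aG : kappa * a = a' * e G.
  by have := a'E G TG; rewrite /z c0G add0r /dlt eqxx mulr1.
exists a' => X; case: (setP_lift X) => A; rewrite /st_class.
  rewrite liftS_sub mk_chain_lift -/(c0 A) => TA; case: (A =P G) => [->|/eqP/negbTE AG]; first by rewrite mulr0.
  by rewrite -a'E // /z /dlt AG mulr0 addr0.
rewrite lift_sub_om mk_chain_om -/(c1 A) => TA; rewrite aE //.
transitivity (kappa * (kappa * a) * bd dl A); first by rewrite mulrA kk mul1r.
by rewrite aG; ring.
Qed.
End FixFace.

Lemma stellar_good : good d D' st_class.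
Proof.
have d0 := ltnW d2.
split.
- move=> X Y; case: (setP_lift X) => A; case: (setP_lift Y) => B; rewrite ?inL ?inO ?om_nsub //.
  + rewrite liftS_sub => /andP[AD AG] BA; rewrite (good_closed gD AD BA).
    apply: contraNneq AG => BG; rewrite eq_sym eqEcard -BG BA BG Gd (good_dim gD) //.
  + move=> AG; rewrite lift_sub_om => BA; rewrite (good_closed gD GD) ?(subset_trans BA (proper_sub AG)) //=.
    by apply: contraTneq AG => BG; rewrite properE -BG BA andbF.
  by move=> AG; rewrite om_sub => BA; apply: sub_proper_trans BA AG.
- move=> X; case: (setP_lift X) => A; rewrite ?inL ?inO ?card_liftS ?card_om.
    by move=> /andP[AD _]; apply: (good_dim gD).
  by move=> /proper_card; rewrite Gd.
- have /card_gt0P[g gG] : (0 < #|G|)%N by rewrite Gd.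
  exists (om |: liftS (G :\ g)); rewrite inO card_om properD1 //; split=> //.
  by have := cardsD1 g G; rewrite gG Gd add1n => <-.
- by move=> X0 i c X0D X00 id cs cz; apply: (st_exact X0D X00 cs cz id).
- by move=> X0 c X0D X00 cs cz; apply: (st_top X0D X00 cs cz).
- exact: st_class_neq0.
- exact: st_class_cycle.
move=> P PE.
have Pom g : g \in G -> (P (wd g) <-> P om).
  move=> gG; have ed : om |: liftS [set g] \in D'.
    by rewrite inO properEcard sub1set gG cards1 Gd.
  have E : om |: liftS [set g] = [set om; wd g] by rewrite /liftS imset_set1.
  by split; apply: PE; rewrite ?[[set wd g; om]]setUC -E.
have Pwd x y : P (wd x) -> P (wd y).
  apply: (good_conn gD (P := fun x => P (wd x))) => {}x {}y xyD.
  (* When [d = 2] the edge may be [G] itself, which the subdivision destroys; its ends are then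
     joined through [om]. *)
  case: ([set x; y] =P G) => [E|/eqP ne].
    by move/(Pom x); rewrite -E !inE eqxx => /(_ isT) /(Pom y); apply; rewrite -E !inE eqxx orbT.
  apply: PE; have <- : liftS [set x; y] = [set wd x; wd y] by rewrite /liftS imsetU1 imset_set1.
  by rewrite inL xyD ne.
have /card_gt0P[g gG] : (0 < #|G|)%N by rewrite Gd.
move=> x y; case: (ordSP x) => [|x']; case: (ordSP y) => [|y'] //.
- by move/(Pom g gG); apply: Pwd.
- by move/(Pwd _ g); case: (Pom g gG).
exact: Pwd.
Qed.
End StellarGood.

(** * The degree map and the theorem *)

Lemma theta_linsys k d n : @theta k d n = linsys (evpar (tofracm k d n)).
Proof. exact: functional_extensionality. Qed.

Section DegreeMap.
Variables (k : fieldType) (d n : nat) (D : {set {set 'I_n}}) (o : {set 'I_n} -> seq 'I_n).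
Local Notation K := (Kf k (d * n)).
Hypothesis closed : forall F G : {set 'I_n}, F \in D -> G \subset F -> G \in D.
Hypothesis fac : forall F, F \in D -> #|F| = d -> facet D F.
Variable degf : {mpoly K[n]} -> K.
Hypothesis degP : is_deg D o degf.

Lemma degf_dgp p : degf p = dgp d (fun m => degf 'X_[m]) p.
Proof.
have [lin hd _ _] := degP.
have deg0 : degf 0 = 0.
  have := lin 0 0 0; rewrite scale0r addr0 mul0r add0r => _.
  by have := lin 1 0 0; rewrite scaler0 addr0 mul1r => /eqP; rewrite -subr_eq0 opprD addrA subrr sub0r oppr_eq0 => /eqP.
rewrite {2}(mpolyE p) dgp_sum {1}(mpolyE p).
elim: (msupp p : seq _) => [|m s IH]; first by rewrite !big_nil.
rewrite !big_cons lin IH dgpZ dgpX; congr (_ * _ + _).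
by case: eqP => // /eqP md; apply: hd.
Qed.

Lemma degf_gendeg : gendeg D (fun m => degf 'X_[m]).
Proof.
have [lin hd J0 fc] := degP; split.
- move=> be i _; transitivity (degf ('X_[be] * theta k n i)); last first.
    by apply: J0; apply: (inJM closed); apply: inJ_th.
  rewrite degf_dgp /theta mulr_sumr dgp_sum; apply: eq_bigr => j _.
  by rewrite -scalerAr dgpZ -mpolyXD -degf_dgp.
- by move=> al _ aD; apply: J0; apply: inJ_X.
move=> F FD Fd; have := fc F (fac FD Fd); rewrite mset_prod => ->.
rewrite divfK ?tofrac_eq0 ?bracket_neq0 //; have [b ->] := eps_sign o F.
by exists b; rewrite rmorphXn rmorphN rmorph1.
Qed.
End DegreeMap.

Theorem theorem1p6 (k : fieldType) (d n : nat) (D : {set {set 'I_n}})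
  (o : {set 'I_n} -> seq 'I_n) (q : nat) :
  (2 <= d)%N ->
  simplicial_complex D -> has_dim D d -> connected_cx D ->
  homology_manifold k D d ->
  orderings D o -> (2%N \in [pchar k]) \/ orientation_cond D o ->
  (2 * q <= d)%N ->
  (forall F : {set 'I_n}, #|F| = d -> F \notin D ->
     SLP D (@thetaF k d _ F) q) ->
  (forall G : {set 'I_n}, facet D G ->
     forall F : {set 'I_n.+1}, #|F| = d -> F \notin stellar D G ->
       SLP (stellar D G) (@thetaF k d _ F) q) ->
  forall degf : {mpoly (Kf k (d * n))[n]} -> Kf k (d * n),
    is_deg D o degf ->
  forall (m : nat) (b : 'I_m -> {mpoly (Kf k (d * n))[n]}),
    Hbar_basis D (@theta k d n) q b ->
  let Dq := \det (\matrix_(i < m, j < m)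
                    degf (ell (Kf k (d * n)) n ^+ (d - 2 * q) * b i * b j)) in
  Dq != 0 /\
  (forall F : {set 'I_n}, #|F| = d ->
     forall e : int, has_ord (@bracket k d n F) Dq e ->
       odd `|e|%N = facet D F).
Proof.
move=> d2 sc hd cx hm ho hor qd slpF slpG degf degP m b [hb ib sb] Dq.
have closed : forall F G : {set 'I_n}, F \in D -> G \subset F -> G \in D.
  by case: sc => _ cl _; apply: cl.
have fac F := @facet_card n d D hd F.
(* The complex is considered over two fields: its own function field, and the one with an extra
   vertex, where it is compared with its subdivisions. *)
pose f n' : {rmorphism k -> Kf k (d * n')} := tofracm k d n' \o @mpolyC (d * n') k.
have gD := manifold_good (f n) sc hd hm ho hor d2 cx.
have gD1 := manifold_good (f n.+1) sc hd hm ho hor d2 cx.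
have gdg := degf_gendeg closed fac degP.
set dg := fun _ => _ in gdg.
have E0 : allbr k d D != 0 by exact: E_neq0.
have lD : lsop D (evpar (tofracm k d n)) by apply: (ev_lsop gD); rewrite tofrac_eq0.
have dgP := degcond_gen gdg E0.
have nN a := nullN_inN gD d2 lD dgP qd (a := a).
have iV : indepN d dg q b.
  move=> c nc; apply: ib; rewrite theta_linsys; apply/nN => //.
  by apply: homog_sum => i _; apply: homogZ.
have sV : spanN d dg q b.
  move=> a ha; have [c] := sb a ha; rewrite theta_linsys => nc; exists c.
  have hab : is_homog q (a - \sum_i c i *: b i).
    by apply: homogB ha _; apply: homog_sum => i _; apply: homogZ.
  exact: (proj1 (nN _ hab) nc).
have DqE : Dq = \det (gram d dg q (ell (Kf k (d * n)) n) b).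
  by congr (\det _); apply/matrixP => i j; rewrite !mxE (degf_dgp degP).
have par G : G \in D -> #|G| = d -> Dq != 0 /\ forall e, has_ord (bracket k d G) Dq e -> odd `|e|%N.
  move=> GD Gd; rewrite DqE; have gD' := stellar_good gD1 d2 GD Gd.
  apply: (facet_parity gD d2 gdg qd hb iV sV gD1 GD Gd gD'); apply: slpG; rewrite ?card_liftS //.
    exact: fac.
  by rewrite (stellar_lift gD1 GD Gd) eqxx andbF.
(* Nonvanishing comes with the parity along any one facet. *)
split; first by have [G [GD Gd]] := good_facet gD; case: (par G GD Gd).
move=> F Fd e he; have [FD|FD] := boolP (F \in D).
  by have [_ /(_ e he) ->] := par F FD Fd; rewrite fac.
rewrite DqE in he.
have /negbTE -> := nonface_parity gD d2 gdg qd hb iV sV Fd FD (slpF F Fd FD) he.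
by rewrite /facet (negbTE FD).
Qed.
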